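(* The following assertions hold for the continuous linear operators $T\colon L\log L\to L^1$ and $\widehat T\colon L\log L\to L^1$. (i) The range $T(L\log L)$ is a proper dense linear subspace of $L^1$. (ii) $L(\log L)^2$ is included in the range $T(L\log L)$. (iii) The range $T(L\log L)$ is not included in $L\log L$. (iv) The range $\widehat T(L\log L)$ is not included in $L\log L$. (v) $L\log L$ is not included in the range $T(L\log L)$. (vi) $L\log L$ is not included in the range $\widehat T(L\log L)$.
   Context: All functions are complex-valued, Lebesgue measurable on $(-1,1)$, identified when equal a.e.; $L^1=L^1(-1,1)$. The decreasing rearrangement of $f$ is $f^*(t)=\inf\{\lambda\ge 0: |\{x\in(-1,1):|f(x)|>\lambda\}|\le t\}$, $0<t<2$. For $\alpha\ge1$, $L(\log L)^\alpha=L(\log L)^\alpha(-1,1)$ is the space of all measurable $f$ with $\|f\|_{L(\log L)^\alpha}:=\int_0^2 f^*(t)\log^\alpha\big(\tfrac{2e}{t}\big)\,dt<\infty$, and $L\log L=L(\log L)^1$; these are contained in $L^1$. For $f\in L^1$ the finite Hilbert transform is $$T(f)(t)=\lim_{\varepsilon\to0^+}\frac1\pi\Big(\int_{-1}^{t-\varepsilon}+\int_{t+\varepsilon}^1\Big)\frac{f(x)}{x-t}\,dx ,$$ which exists for a.e. $t\in(-1,1)$ and is measurable. For $g\in L^1$ the measurable function $\widehat T(g)$ is defined by $$\widehat T(g)(x)=\frac{-1}{\sqrt{1-x^2}}\,T\big(\sqrt{1-t^2}\,g(t)\big)(x)\quad\text{for a.e. }x\in(-1,1).$$ Both $T$ and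 $\widehat T$ map $L\log L$ boundedly into $L^1$. *)

(* Defs.v *)
From HB Require Import structures.
From mathcomp Require Import all_boot all_order all_algebra.
From mathcomp Require Import complex.
From mathcomp Require Import all_classical all_reals all_analysis.

Set Implicit Arguments.
Unset Strict Implicit.
Unset Printing Implicit Defensive.
Import Order.TTheory GRing.Theory Num.Theory.
Import numFieldNormedType.Exports.

Local Open Scope classical_set_scope.
Local Open Scope complex_scope.
Local Open Scope ring_scope.

(* R equipped with the complete Lebesgue sigma-algebra (not the Borel one, which
   is the default on R). Functions on (-1, 1) are represented by total functions
   R -> R[i], only whose values on `]-1, 1[ matter. Elements of the function
   spaces are functions rather than classes; all the spaces and ranges below are
   closed under equality a.e. on (-1, 1). *)
Definition leb (R : realType) : measurableType _ :=
  caratheodory_type (mu_ext (@wlength R idfun)).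

Local Notation mu := completed_lebesgue_measure.

Definition I11 (R : realType) : set R := `]-1, 1[.
Arguments I11 : clear implicits.

Definition ae_eq11 (R : realType) (f g : R -> R[i]) : Prop :=
  f = g %[ae mu in I11 R].

Definition cmeasurable (R : realType) (f : R -> R[i]) : Prop :=
  measurable_fun (I11 R : set (leb R)) (fun x => complex.Re (f x)) /\
  measurable_fun (I11 R : set (leb R)) (fun x => complex.Im (f x)).

Definition cintegral (R : realType) (D : set R) (f : R -> R[i]) :
    R[i] :=
  (\int[mu]_(x in D) complex.Re (f x)) +i* (\int[mu]_(x in D) complex.Im (f x)).

Definition norm1 (R : realType) (f : R -> R[i]) : \bar R :=
  (\int[mu]_(x in I11 R) (Normc.normc (f x))%:E)%E.

Definition L1 (R : realType) : set (R -> R[i]) :=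
  [set f | cmeasurable f /\ (norm1 f < +oo)%E].
Arguments L1 : clear implicits.

Definition rearrangement (R : realType) (f : R -> R[i]) (t : R) : \bar R :=
  ereal_inf [set l%:E | l in [set l : R | 0 <= l /\
    (mu [set x : R | I11 R x /\ (l < Normc.normc (f x))%R] <= t%:E)%E]].

Definition norm_LlogL (R : realType) (a : R) (f : R -> R[i]) : \bar R :=
  (\int[mu]_(t in `]0%R, 2%R[%classic : set R)
     (rearrangement f t * ((ln (2 * expR 1 / t)) `^ a)%:E))%E.

Definition LlogL (R : realType) (a : R) : set (R -> R[i]) :=
  [set f | cmeasurable f /\ (norm_LlogL a f < +oo)%E].

Definition truncated_fht (R : realType) (f : R -> R[i]) (t e : R) : R[i] :=
  (pi^-1)%:C *
  (cintegral `]-1, t - e[ (fun x => f x / (x - t)%:C) +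
   cintegral `]t + e, 1[ (fun x => f x / (x - t)%:C)).

(* For f in L1 the limit exists for a.e. t in (-1, 1); elsewhere `lim` takes an
   unspecified value. The cast selects the topology of the modulus on R[i]. *)
Definition fht (R : realType) (f : R -> R[i]) : R -> R[i] :=
  fun t => lim ((truncated_fht f t e : (R[i] : numClosedFieldType)) @[e --> (0 : R)^'+]).

Definition fht_hat (R : realType) (g : R -> R[i]) : R -> R[i] :=
  fun x => (- 1 / Num.sqrt (1 - x ^+ 2))%:C *
           fht (fun t => (Num.sqrt (1 - t ^+ 2))%:C * g t) x.

(* Image of the space A under an operator, up to equality a.e. on (-1, 1). *)
Definition ae_range (R : realType) (op : (R -> R[i]) -> R -> R[i])
    (A : set (R -> R[i])) : set (R -> R[i]) :=
  [set g | exists2 f, A f & ae_eq11 g (op f)].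

Definition linear_subspace (R : realType) (A B : set (R -> R[i])) : Prop :=
  [/\ A `<=` B, A (fun=> 0),
      forall f g, A f -> A g -> A (fun x => f x + g x)
    & forall (c : R[i]) f, A f -> A (fun x => c * f x)].

Definition dense_in_L1 (R : realType) (A : set (R -> R[i])) : Prop :=
  forall h, L1 R h -> forall e : R, 0 < e ->
    exists2 g, A g & (norm1 (fun x => (h x - g x)%R) < e%:E)%E.

(* Main.v *)
(* With x = cos theta, the finite Hilbert transform of f is characterized by
     int_{-1}^1 sin (n theta) (T f)(x) dx = int_{-1}^1 cos (n theta) f(x) dx, n >= 1
   ([conj_pair f (T f)]): Abel summation of these identities yields a conjugate
   Poisson integral, which differs from the truncated integral by an error that
   vanishes at the Lebesgue points of f and T f. A solution of the identities in
   L^1 exists for f in L log L by Zygmund's inequality, itself dual to the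
   exponential integrability of the conjugate of a bounded function, which is read
   off the moments of analytic polynomials. The same argument for the weight
   1 / w, where w(x) = sqrt (1 - x^2), inverts T on L(log L)^2: f is -1/w times
   the conjugate of w g, and a level-set decomposition shows that it is in L log L.
   Density follows, since bounded functions lie in L(log L)^2.

   The negative results all use c(x) = 1 / (x |ln x|^3) on (0, 1/e), a function of
   L log L such that T(m c) is not in L log L for any multiplier 0 <= m <= 1 bounded
   below near 0. For (iii) and (iv) take m = 1 and m = w. If c = T u with u in
   L log L, the Poincare-Bertrand identity T(w T u) = (int u) / pi - w u puts T(w c)
   in L log L, a contradiction; if c = T^ u, the same with w u in place of u gives
   (vi), with m = w^2. Properness in (i) follows from (v). *)
Require Import Defs.
From mathcomp Require Import all_boot all_order all_algebra.
From mathcomp Require Import complex ring lra.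
From mathcomp Require Import all_classical all_reals all_analysis.
From mathcomp Require Import measurable_realfun.

Set Implicit Arguments.
Unset Strict Implicit.
Unset Printing Implicit Defensive.
Import Order.TTheory GRing.Theory Num.Def Num.Theory.
Import numFieldNormedType.Exports.

Local Open Scope classical_set_scope.
Local Open Scope ring_scope.

(** * Integration of real Borel functions over (-1, 1) *)

Section interval_integrals.
Context {R : realType}.
Implicit Types (f g h : R -> R) (x k M : R).
Local Notation mu := (@lebesgue_measure R).
Local Notation I := (I11 R).

(** In the variable theta, integrals are means over the upper half circle and polynomials in
    [exp(i theta)] play the part of holomorphic functions: multiplicativity of evaluation and the
    mean value property yield all pairing identities by algebra. The obstacle is the passage from
    polynomials to L log L. As [Phi] is not homogeneous, Zygmund's inequality is carried as a
    family, [s ||C a|| <= int Phi (6 s |S a|) + 16] for all scales s > 0. At s = 2^k the additive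
    constant costs 16 / 2^k; this makes the approximating sequences converge geometrically and the
    level-set sums finite, in place of a weak-type bound. Two measures occur because dx = sin theta
    dtheta: with weight 1 cosines are paired with sines, which serves T itself; with weight 1 / w
    cosines are paired with cosines and sines with sines, which serves the inversion. The function c
    is borderline: multiplying it by |ln x| leaves 1 / (x |ln x|^2), still integrable, whereas
    averaging it over (0, y) loses one logarithm, and [Phi] of the result is of order 1 / (y |ln
    y|), no longer integrable. *)

Definition mI f := measurable_fun I f.
Definition itg f := mu.-integrable I (EFin \o f).
(** The value defaults to 0 when the integral is infinite, so linearity and comparison are stated
    together with [itg]. *)
Definition J f : R := \int[mu]_(x in I) f x.

Lemma measurableI11 : measurable (I : set R).
Proof. exact: measurable_itv. Qed.
Hint Resolve measurableI11 : core.

Lemma I11P x : I x <-> -1 < x < 1.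
Proof. by rewrite /I11 /= in_itv. Qed.

Lemma I11_lty : (mu I < +oo)%E.
Proof. by rewrite /I11 lebesgue_measure_itv /= lte_fin; case: ifP => // _; rewrite ltry. Qed.

Lemma eq_mI f g : (forall x, I x -> f x = g x) -> mI f -> mI g.
Proof. by move=> fg; apply: eq_measurable_fun => x; rewrite inE => /fg. Qed.

Lemma mI_T f : measurable_fun [set: R] f -> mI f.
Proof. exact: measurable_funTS. Qed.

Lemma mI_cont f : continuous f -> mI f.
Proof. by move=> cf; apply: mI_T; exact: continuous_measurable_fun. Qed.

Lemma mI_id : mI (fun x => x).
Proof. exact: measurable_id. Qed.

Lemma mI_cst k : mI (fun=> k).
Proof. exact: measurable_cst. Qed.

Lemma mI_D f g : mI f -> mI g -> mI (fun x => f x + g x).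
Proof. exact: measurable_funD. Qed.

Lemma mI_B f g : mI f -> mI g -> mI (fun x => f x - g x).
Proof. exact: measurable_funB. Qed.

Lemma mI_N f : mI f -> mI (fun x => - f x).
Proof. exact: measurable_funN. Qed.

Lemma mI_M f g : mI f -> mI g -> mI (fun x => f x * g x).
Proof. exact: measurable_funM. Qed.

Lemma mI_X f n : mI f -> mI (fun x => f x ^+ n).
Proof. exact: measurable_funX. Qed.

Lemma mI_comp (F : R -> R) f : measurable_fun [set: R] F -> mI f -> mI (fun x => F (f x)).
Proof. by move=> mF mf; exact: (measurableT_comp mF mf). Qed.

Lemma mI_norm f : mI f -> mI (fun x => `|f x|).
Proof. by move=> mf; apply: (mI_comp (F := normr)) => //; exact: normr_measurable. Qed.

Lemma measurable_invr : measurable_fun [set: R] (fun x => x^-1).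
Proof.
rewrite (_ : [set: R] = [set 0] `|` ~` [set 0]); last by rewrite setUv.
apply/measurable_funU => //; first exact: measurableC.
split; first exact: measurable_fun_set1.
apply: open_continuous_measurable_fun => //.
  by apply: closed_openC; exact: closed_eq.
by move=> x; rewrite inE /= => /eqP x0; exact: inv_continuous.
Qed.

Lemma mI_V f : mI f -> mI (fun x => (f x)^-1).
Proof. by move=> mf; apply: (mI_comp (F := fun x => x^-1)) => //; exact: measurable_invr. Qed.

Lemma mI_exp f : mI f -> mI (fun x => expR (f x)).
Proof. by move=> mf; apply: (mI_comp (F := expR)) => //; exact: measurable_expR. Qed.

Lemma mI_ln f : mI f -> mI (fun x => ln (f x)).
Proof. by move=> mf; apply: (mI_comp (F := @ln R)) => //; exact: measurable_ln. Qed.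

Lemma mI_max f g : mI f -> mI g -> mI (fun x => Num.max (f x) (g x)).
Proof. exact: measurable_maxr. Qed.

Lemma mI_min f g : mI f -> mI g -> mI (fun x => Num.min (f x) (g x)).
Proof. exact: measurable_minr. Qed.

Lemma mI_iflt (a b : R -> R) f g : mI a -> mI b -> mI f -> mI g ->
  mI (fun x => if a x < b x then f x else g x).
Proof.
move=> ma mb mf mg; apply: measurable_fun_if => //.
- exact: measurable_fun_ltr.
- by apply: measurable_funS mf => //; exact: subIsetl.
- by apply: measurable_funS mg => //; exact: subIsetl.
Qed.

Lemma mI_ifle (a b : R -> R) f g : mI a -> mI b -> mI f -> mI g ->
  mI (fun x => if a x <= b x then f x else g x).
Proof.
move=> ma mb mf mg; apply: measurable_fun_if => //.
- exact: measurable_fun_ler.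
- by apply: measurable_funS mf => //; exact: subIsetl.
- by apply: measurable_funS mg => //; exact: subIsetl.
Qed.

Lemma mI_sum (T : Type) (s : seq T) (h : T -> R -> R) :
  (forall i, mI (h i)) -> mI (fun x => \sum_(i <- s) h i x).
Proof. by move=> mh; apply: measurable_sum => i; exact: mh. Qed.

Lemma itg_m f : itg f -> mI f.
Proof. by move=> /measurable_int/measurable_EFinP. Qed.

Lemma eq_itg f g : (forall x, I x -> f x = g x) -> itg f -> itg g.
Proof. by move=> fg; apply: eq_integrable => // x; rewrite inE /= => /fg ->. Qed.

Lemma itg_le f g : mI f -> (forall x, I x -> `|f x| <= g x) -> itg g -> itg f.
Proof.
move=> mf fg; apply: le_integrable => //; first exact/measurable_EFinP.
by move=> x Ix /=; rewrite lee_fin (le_trans (fg x Ix))// ler_norm.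
Qed.

Lemma itgD f g : itg f -> itg g -> itg (fun x => f x + g x).
Proof. by move=> fi gi; apply: (@integrableD _ _ _ mu I measurableI11 _ _ fi gi). Qed.

Lemma itgN f : itg f -> itg (fun x => - f x).
Proof. by move=> fi; have := integrableN fi; apply: eq_integrable. Qed.

Lemma itgB f g : itg f -> itg g -> itg (fun x => f x - g x).
Proof. by move=> fi gi; apply: itgD => //; exact: itgN. Qed.

Lemma itgZ k f : itg f -> itg (fun x => k * f x).
Proof. by move=> fi; apply: (@integrableZl _ _ _ mu I measurableI11 k _ fi). Qed.

Lemma itg_norm f : itg f -> itg (fun x => `|f x|).
Proof. exact: integrable_norm. Qed.

Lemma itg_cst k : itg (fun=> k).
Proof.
have H : (forall x, I x -> `|k| <= `|k|) by [].
apply: measurable_bounded_integrable => //; first exact: I11_lty.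
by exists `|k|; split; rewrite ?num_real// => y /ltW ky z _ /=.
Qed.

Lemma itg_bd h M : mI h -> (forall x, I x -> `|h x| <= M) -> itg h.
Proof. by move=> mh hM; apply: itg_le mh hM _; exact: itg_cst. Qed.

Lemma itgM h f M : mI h -> (forall x, I x -> `|h x| <= M) -> itg f -> itg (fun x => h x * f x).
Proof.
move=> mh hM fi; apply: (@itg_le _ (fun x => M * `|f x|)).
- by apply: mI_M => //; exact: itg_m.
- by move=> x Ix; rewrite normrM ler_wpM2r// hM.
- by apply: itgZ; exact: itg_norm.
Qed.

Lemma itg_sum (T : Type) (s : seq T) (h : T -> R -> R) :
  (forall i, itg (h i)) -> itg (fun x => \sum_(i <- s) h i x).
Proof.
move=> hi; elim: s => [|a s IH].
  by apply: eq_itg (itg_cst 0) => x _; rewrite big_nil.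
by apply: eq_itg (itgD (hi a) IH) => x _; rewrite big_cons.
Qed.

Lemma eq_J f g : (forall x, I x -> f x = g x) -> J f = J g.
Proof. by move=> fg; apply: eq_Rintegral => x; rewrite inE => /fg. Qed.

Lemma JD f g : itg f -> itg g -> J (fun x => f x + g x) = J f + J g.
Proof. exact: RintegralD. Qed.

Lemma JB f g : itg f -> itg g -> J (fun x => f x - g x) = J f - J g.
Proof. exact: RintegralB. Qed.

Lemma JZ k f : itg f -> J (fun x => k * f x) = k * J f.
Proof. exact: RintegralZl. Qed.

Lemma JN f : itg f -> J (fun x => - f x) = - J f.
Proof.
move=> fi; rewrite -mulN1r -JZ//; apply: eq_J => x _; by rewrite mulN1r.
Qed.

Lemma J0 : J (fun=> 0) = 0.
Proof. by rewrite /J /Rintegral integral0. Qed.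

Lemma J_sum (T : Type) (s : seq T) (h : T -> R -> R) : (forall i, itg (h i)) ->
  J (fun x => \sum_(i <- s) h i x) = \sum_(i <- s) J (h i).
Proof.
move=> hi; elim: s => [|a s IH].
  by rewrite big_nil -[RHS]J0; apply: eq_J => x _; rewrite big_nil.
rewrite big_cons -IH -JD//; last exact: itg_sum.
by apply: eq_J => x _; rewrite big_cons.
Qed.

Lemma J_le f g : itg f -> itg g -> (forall x, I x -> f x <= g x) -> J f <= J g.
Proof. by move=> fi gi fg; apply: le_Rintegral => //. Qed.

Lemma J_ge0 f : (forall x, I x -> 0 <= f x) -> 0 <= J f.
Proof. by move=> f0; apply: Rintegral_ge0. Qed.

Lemma le_normJ f : itg f -> `|J f| <= J (fun x => `|f x|).
Proof. exact: le_normr_Rintegral. Qed.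

Lemma EFin_J f : itg f -> (\int[mu]_(x in I) (f x)%:E)%E = (J f)%:E.
Proof. by move=> fi; rewrite /J /Rintegral fineK//; exact: integrable_fin_num. Qed.

Lemma itg_ge0P f : mI f -> (forall x, I x -> 0 <= f x) ->
  (\int[mu]_(x in I) (f x)%:E < +oo)%E -> itg f.
Proof.
move=> mf f0 fi; apply/integrableP; split; first exact/measurable_EFinP.
apply: le_lt_trans fi; apply: ge0_le_integral => //.
- by apply/measurable_EFinP; exact: mI_norm.
- exact/measurable_EFinP.
- by move=> x Ix /=; rewrite lee_fin ger0_norm ?f0.
Qed.

Lemma J_ge0_lty f : itg f -> (\int[mu]_(x in I) (f x)%:E < +oo)%E.
Proof. by move=> /EFin_J ->; rewrite ltry. Qed.

Lemma J_dct (F : nat -> R -> R) f g : (forall n, mI (F n)) -> mI f ->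
  (forall x, I x -> F ^~ x @ \oo --> f x) -> itg g ->
  (forall n x, I x -> `|F n x| <= g x) -> J (F n) @[n --> \oo] --> J f.
Proof.
move=> mF mf Ff gi Fg.
have gi' : mu.-integrable I (EFin \o g) by [].
have fi : itg f.
  apply: itg_le mf _ gi => x Ix; apply: (ler_cvg_to (cvg_norm (Ff x Ix)) (cvg_cst (g x))).
  by near=> n; exact: Fg.
have mF' n : measurable_fun I (EFin \o F n) by apply/measurable_EFinP; exact: mF.
have mf' : measurable_fun I (EFin \o f) by exact/measurable_EFinP.
have cF : {ae mu, forall x, I x -> (EFin \o F n) x @[n --> \oo] --> (EFin \o f) x}.
  by apply: aeW => x Ix; apply: cvg_EFin; [by apply: nearW|exact: Ff].
have bF : {ae mu, forall x n, I x -> (`|(EFin \o F n) x| <= (EFin \o g) x)%E}.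
  by apply: aeW => x n Ix; rewrite /= lee_fin Fg.
have [_ _ H] := @dominated_convergence _ _ R mu I measurableI11 _ _ _ mF' mf' cF gi' bF.
rewrite (_ : (fun n => J (F n)) = fine \o (fun n => \int[mu]_(x in I) (EFin \o F n) x)%E)//.
by apply: fine_cvg; rewrite -EFin_J.
Unshelve. all: by end_near. Qed.

Lemma cvg_ex_le (u : nat -> R) (l e : R) : u n @[n --> \oo] --> l -> 0 < e ->
  exists N, forall n, (N <= n)%N -> `|u n - l| <= e.
Proof.
move=> ul e0; have [N _ H] := (cvgrPdist_le _ _).1 ul _ e0.
by exists N => n Nn; rewrite distrC; exact: H.
Qed.

Lemma cvg_eventually (u : nat -> R) (l : R) N :
  (forall n, (N <= n)%N -> u n = l) -> u n @[n --> \oo] --> l.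
Proof. by move=> ul; apply: cvg_near_cst; exists N => // n /= /ul ->. Qed.

Lemma ex_nat_ge (x : R) : exists N, forall n, (N <= n)%N -> x <= n%:R.
Proof.
exists (truncn x).+1 => n Nn; apply: (le_trans (ltW (truncnS_gt x))).
by rewrite ler_nat.
Qed.

End interval_integrals.
#[global] Hint Resolve measurableI11 : core.

(** * Bernstein polynomials and approximation by polynomials with the same bound *)

Section bernstein.
Context {R : realType}.
Implicit Types (g h : nat -> R) (x y : R).
Local Notation I := (I11 R).

(* The Bernstein polynomial of degree n on [-1, 1], with node values [g k]. *)
Fixpoint bernstein n g : {poly R} :=
  if n is m.+1 then
    (2^-1 *: (1 + 'X)) * bernstein m (g \o S) + (2^-1 *: (1 - 'X)) * bernstein m g
  else (g 0%N)%:P.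

Arguments bernstein : simpl never.

Lemma bernsteinS n g x : (bernstein n.+1 g).[x] =
  (1 + x) / 2 * (bernstein n (g \o S)).[x] + (1 - x) / 2 * (bernstein n g).[x].
Proof. by rewrite /bernstein -/bernstein !hornerE ![2^-1 * _]mulrC. Qed.

Lemma bernstein_le n g h x : -1 <= x <= 1 -> (forall k, (k <= n)%N -> g k <= h k) ->
  (bernstein n g).[x] <= (bernstein n h).[x].
Proof.
move=> /andP[x1 x2]; elim: n g h => [|n IH] g h gh; first by rewrite !hornerC gh.
rewrite !bernsteinS lerD// ler_wpM2l//.
- lra.
- by apply: IH => k kn; apply: gh.
- lra.
- by apply: IH => k kn; apply: gh; rewrite (leq_trans kn).
Qed.

Lemma bernsteinD n g h x : (bernstein n (fun k => g k + h k)).[x] =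
  (bernstein n g).[x] + (bernstein n h).[x].
Proof.
elim: n g h => [|n IH] g h; first by rewrite !hornerC.
rewrite !bernsteinS (_ : _ \o S = (fun k => (g \o S) k + (h \o S) k))// !IH; ring.
Qed.

Lemma bernsteinZ n (c : R) g x : (bernstein n (fun k => c * g k)).[x] = c * (bernstein n g).[x].
Proof.
elim: n g => [|n IH] g; first by rewrite !hornerC.
rewrite !bernsteinS (_ : _ \o S = (fun k => c * (g \o S) k))// !IH; ring.
Qed.

Lemma bernstein_cst n (c : R) x : (bernstein n (fun=> c)).[x] = c.
Proof.
elim: n => [|n IH]; first by rewrite hornerC.
by rewrite bernsteinS (_ : _ \o S = (fun=> c))// IH; field.
Qed.

Lemma bernstein_norm n g x (M : R) : -1 <= x <= 1 -> (forall k, (k <= n)%N -> `|g k| <= M) ->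
  `|(bernstein n g).[x]| <= M.
Proof.
move=> x1 gM; rewrite ler_norml; apply/andP; split.
  by rewrite -(bernstein_cst n (- M) x); apply: bernstein_le => // k /gM; rewrite ler_norml => /andP[].
by rewrite -[leRHS](bernstein_cst n M x); apply: bernstein_le => // k /gM; rewrite ler_norml => /andP[].
Qed.

(** Second moment about c of twice a binomial count with success probability (1 + x) / 2: the
    variance n (1 - x^2) plus the squared bias. *)
Lemma bernstein_var n (c x : R) :
  (bernstein n (fun k => (2 * k%:R - c) ^+ 2)).[x] = n%:R * (1 - x ^+ 2) + (n%:R * (1 + x) - c) ^+ 2.
Proof.
elim: n c => [|n IH] c; first by rewrite hornerC; ring.
rewrite bernsteinS IH (_ : _ \o S = (fun k => (2 * k%:R - (c - 2)) ^+ 2)); last first.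
  by apply/funext => k /=; rewrite -natr1; ring.
by rewrite IH -natr1; field.
Qed.

Lemma bernstein_cvg (f : R -> R) x (M : R) : -1 <= x <= 1 -> continuous f -> (forall y, `|f y| <= M) ->
  (bernstein n.+1 (fun k => f (2 * k%:R / n.+1%:R - 1))).[x] @[n --> \oo] --> f x.
Proof.
move=> x1 cf fM; apply/cvgrPdist_le => e e0.
have M0 : 0 <= M by rewrite (le_trans _ (fM 0)).
have e20 : 0 < e / 2 by rewrite divr_gt0.
have /cvgrPdist_le/(_ _ e20) := cf x.
rewrite near_simpl => /nbhs_ballP[d /= d0 dH].
(* Near x, continuity gives e / 2; at distance at least d, the crude bound 2 M is at most 2 M (y -
   x)^2 / d^2. The quadratic is averaged by [bernstein_var]. *)
have fd y : `|f y - f x| <= e / 2 + (2 * M / d ^+ 2) * (y - x) ^+ 2.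
  have [yd|yd] := ltP `|x - y| d.
    rewrite distrC (le_trans (dH y yd))// lerDl mulr_ge0 ?sqr_ge0//.
    by rewrite divr_ge0 ?sqr_ge0 ?mulr_ge0.
  rewrite (le_trans (ler_normB _ _))// (le_trans (lerD (fM y) (fM x)))//.
  apply: (@le_trans _ _ (2 * M / d ^+ 2 * d ^+ 2)).
    by rewrite mulfVK ?mulr_natl// ?expf_neq0 ?gt_eqF.
  rewrite ler_wpDl ?(ltW e20)// ler_wpM2l ?divr_ge0 ?sqr_ge0 ?mulr_ge0//.
  rewrite -[leRHS]real_normK ?num_real// -[y - x]opprB normrN.
  by rewrite ler_pXn2r ?nnegrE ?(ltW d0).
have key n : `|(bernstein n.+1 (fun k => f (2 * k%:R / n.+1%:R - 1))).[x] - f x| <=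
    e / 2 + (2 * M / d ^+ 2) * n.+1%:R^-1.
  have -> : (bernstein n.+1 (fun k => f (2 * k%:R / n.+1%:R - 1))).[x] - f x =
      (bernstein n.+1 (fun k => f (2 * k%:R / n.+1%:R - 1) - f x)).[x].
    by rewrite (bernsteinD _ _ (fun=> - f x)) bernstein_cst.
  pose G k : R := e / 2 + (2 * M / d ^+ 2) * ((2 * k%:R / n.+1%:R - 1) - x) ^+ 2.
  have n0 : n.+1%:R != 0 :> R by rewrite pnatr_eq0.
  have GE : (bernstein n.+1 G).[x] = e / 2 + (2 * M / d ^+ 2) * (n.+1%:R^-1 * (1 - x ^+ 2)).
    rewrite (_ : G = fun k => e / 2 + (2 * M / d ^+ 2 / n.+1%:R ^+ 2) *
       (2 * k%:R - n.+1%:R * (1 + x)) ^+ 2); last first.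
      apply/funext => k; rewrite /G; congr (_ + _); field.
      by rewrite (gt_eqF d0) addrC natr1 n0.
    rewrite bernsteinD bernstein_cst bernsteinZ bernstein_var; congr (_ + _); field.
    by rewrite (gt_eqF d0) addrC natr1 n0.
  apply: (@le_trans _ _ (bernstein n.+1 G).[x]).
    rewrite ler_norml; apply/andP; split.
      rewrite -[X in X <= _]mulN1r -bernsteinZ; apply: bernstein_le => // k _.
      by have := fd (2 * k%:R / n.+1%:R - 1); rewrite ler_norml mulN1r => /andP[].
    apply: bernstein_le => // k _.
    by have := fd (2 * k%:R / n.+1%:R - 1); rewrite ler_norml => /andP[].
  rewrite GE lerD2l ler_wpM2l ?divr_ge0 ?sqr_ge0 ?mulr_ge0//.
  by rewrite ler_piMr ?invr_ge0// gerBl sqr_ge0.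
have K0 : 0 <= 2 * M / d ^+ 2 by rewrite divr_ge0 ?sqr_ge0 ?mulr_ge0.
have eK : 0 < e / 2 / (2 * M / d ^+ 2 + 1) by rewrite divr_gt0// ltr_wpDl.
near=> n; rewrite distrC (le_trans (key n))//.
rewrite [leRHS]splitr lerD2l.
have : n.+1%:R^-1 < e / 2 / (2 * M / d ^+ 2 + 1).
  by near: n; exact: (near_infty_natSinv_lt (PosNum eK)).
rewrite ltr_pdivlMr ?ltr_wpDl// mulrDr mulr1 => /ltW; apply: le_trans.
by rewrite mulrC lerDl invr_ge0.
Unshelve. all: by end_near. Qed.

Lemma poly_approx_continuous (f gam : R -> R) (M e : R) : 0 < e -> continuous f ->
  (forall y, `|f y| <= M) -> itg gam -> (forall x, I x -> 0 <= gam x) ->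
  exists2 p : {poly R}, (forall x, I x -> `|p.[x]| <= M) &
    J (fun x => `|p.[x] - f x| * gam x) <= e.
Proof.
move=> e0 cf fM ig g0.
pose P n := bernstein n.+1 (fun k => f (2 * k%:R / n.+1%:R - 1)).
have I1 x : I x -> -1 <= x <= 1 by move=> /I11P /andP[? ?]; apply/andP; split; lra.
have PM n x : I x -> `|(P n).[x]| <= M by move=> /I1 Ix; apply: bernstein_norm.
have mP n : mI (fun x => (P n).[x]).
  by apply: mI_cont; exact: continuous_horner.
have : J (fun x => `|(P n).[x] - f x| * gam x) @[n --> \oo] --> J (fun=> 0 : R).
  apply: (J_dct (g := fun x => (M + M) * gam x)).
  - move=> n; apply: mI_M; last exact: itg_m.
    by apply: mI_norm; apply: mI_B => //; exact: mI_cont.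
  - exact: mI_cst.
  - move=> x Ix; rewrite -(mul0r (gam x)); apply: cvgM; last exact: cvg_cst.
    rewrite -(@normr0 _ R); apply: cvg_norm; rewrite -(subrr (f x)); apply: cvgB; last exact: cvg_cst.
    by apply: (bernstein_cvg (M := M)) => //; exact: I1.
  - exact: itgZ.
  - move=> n x Ix; rewrite normrM normr_id (ger0_norm (g0 x Ix)) ler_wpM2r ?g0//.
    by rewrite (le_trans (ler_normB _ _))// lerD// PM.
rewrite J0 => /cvg_ex_le/(_ e0)[n /(_ n (leqnn n)) H].
exists (P n) => [x|]; first exact: PM.
by move: H; rewrite /= subr0; apply: le_trans; exact: ler_norm.
Qed.

(** The bound M has to survive exactly, since the polynomials become test functions in the unit
    ball. A continuous L^1 approximant is therefore clamped to [-M, M], and Bernstein polynomials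
    respect the bound of their node values. *)
Lemma poly_approx (f gam : R -> R) (M e : R) : 0 < e -> mI f ->
  (forall y, I y -> `|f y| <= M) -> itg gam -> (forall x, I x -> 0 <= gam x) ->
  exists2 p : {poly R}, (forall x, I x -> `|p.[x]| <= M) &
    J (fun x => `|p.[x] - f x| * gam x) <= e.
Proof.
move=> e0 mf fM ig g0.
have M0 : 0 <= M by rewrite (le_trans _ (fM 0 _))//; apply/I11P; apply/andP; split; lra.
have e2 : 0 < e / 2 by rewrite divr_gt0.
have e4 : 0 < e / 2 / 2 by rewrite divr_gt0.
have fi : itg f by exact: itg_bd mf fM.
have [G [cG iG GE]] := approximation_continuous_integrable measurableI11 I11_lty fi.
pose clamp y := Num.max (- M) (Num.min M y).
have clampM y : `|clamp y| <= M.
  rewrite ler_norml /clamp le_max lexx /= ge_max ge_min lexx /= andbT.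
  by rewrite ge0_cp.
have clampB (y z : R) : `|z| <= M -> `|clamp y - z| <= `|y - z|.
  have n1 : y - z <= `|y - z| by exact: ler_norm.
  have n2 : z - y <= `|y - z| by rewrite distrC; exact: ler_norm.
  rewrite ler_norml /clamp => /andP[z1 z2].
  case: (leP M y) => h1; case: (leP (- M) _) => h2; rewrite ler_norml; apply/andP; split; lra.
have ccl : continuous clamp.
  move=> y; apply: (@normed_module.continuous_max _ _ (cst (- M)) (fun y => Num.min M y)); first exact: cvg_cst.
  by apply: (@normed_module.continuous_min _ _ (cst M) id); [exact: cvg_cst|exact: cvg_id].
have GJ : J (fun x => `|f x - G n x|) @[n --> \oo] --> (0 : R) by exact: (fine_cvg GE).
have tJ : J (fun x => gam x - Num.min (gam x) n%:R) @[n --> \oo] --> J (fun=> 0 : R).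
  apply: (J_dct (g := gam)) => //.
  - move=> n; apply: mI_B; first exact: itg_m.
    by apply: mI_min; [exact: itg_m|exact: mI_cst].
  - exact: mI_cst.
  - move=> x Ix; have [N HN] := ex_nat_ge (gam x); apply: (cvg_eventually (N := N)) => n /HN gn.
    by rewrite min_l ?subrr.
  - move=> n x Ix; have := g0 x Ix => g0x.
    by rewrite ger0_norm ?subr_ge0 ?ge_min ?lexx// gerBl le_min g0x ler0n.
move: tJ; rewrite J0 => /cvg_ex_le tJ.
have eM : 0 < e / 2 / 2 / (2 * M + 1) by rewrite divr_gt0// ltr_wpDl ?mulr_ge0.
have {tJ}[N /(_ N (leqnn N))] := tJ _ eM; rewrite subr0 => tN.
have eN : 0 < e / 2 / 2 / (N%:R + 1) by rewrite divr_gt0// ltr_wpDl.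
have [n /(_ n (leqnn n))] := cvg_ex_le GJ eN; rewrite subr0 => Gn.
pose c := clamp \o G n.
have cc : continuous c by move=> y; apply: continuous_comp; [exact: cG|exact: ccl].
have [p pM pJ] := poly_approx_continuous e2 cc (fun y => clampM (G n y)) ig g0.
exists p => //.
have mG : mI (G n) by apply: mI_cont; exact: cG.
have mp : mI (fun x => p.[x]) by apply: mI_cont; exact: continuous_horner.
have mc : mI c by exact: mI_cont.
have i1 : itg (fun x => `|p.[x] - c x| * gam x).
  apply: (itgM (M := M + M)) => //; first by apply: mI_norm; exact: mI_B.
  by move=> x Ix; rewrite normr_id (le_trans (ler_normB _ _))// lerD ?pM//; exact: clampM.
have i2 : itg (fun x => `|f x - G n x|) by apply: itg_norm; apply: itgB => //; exact: iG.
have i3 : itg (fun x => gam x - Num.min (gam x) N%:R).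
  apply: (itg_le (g := gam)) => //.
    apply: mI_B; first exact: itg_m.
    by apply: mI_min; [exact: itg_m|exact: mI_cst].
  move=> x Ix; have := g0 x Ix => g0x.
  by rewrite ger0_norm ?subr_ge0 ?ge_min ?lexx// gerBl le_min g0x ler0n.
(* The weight is split at height N: below it, closeness of [G n] to f in L^1 suffices; above it, the
   crude bound 2 M meets the small excess of [gam]. *)
apply: (@le_trans _ _ (J (fun x => `|p.[x] - c x| * gam x + (N%:R * `|f x - G n x| +
   2 * M * (gam x - Num.min (gam x) N%:R))))).
  apply: J_le.
  - apply: (itgM (M := M + M)) => //; first by apply: mI_norm; exact: mI_B.
    by move=> x Ix; rewrite normr_id (le_trans (ler_normB _ _))// lerD ?pM ?fM.
  - by apply: itgD => //; apply: itgD; exact: itgZ.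
  - move=> x Ix; have g0x := g0 x Ix.
    have h1 : `|p.[x] - f x| <= 2 * M.
      by rewrite (le_trans (ler_normB _ _))// mulr2n mulrDl mul1r lerD ?pM ?fM.
    have h2 : `|p.[x] - f x| <= `|p.[x] - c x| + `|f x - G n x|.
      rewrite (le_trans (ler_distD (c x) _ _))// lerD2l /c /= (le_trans (clampB _ _ (fM x Ix)))//.
      by rewrite distrC.
    have h3 : 0 <= `|p.[x] - c x| by [].
    have h4 : 0 <= `|f x - G n x| by [].
    have h5 : 0 <= `|p.[x] - f x| by [].
    have h6 : (0 : R) <= N%:R by [].
    case: (leP (gam x) N%:R) => h; nra.
rewrite JD//; last by apply: itgD; exact: itgZ.
rewrite JD; [|exact: itgZ|exact: itgZ]; rewrite !JZ//.
rewrite [leRHS]splitr lerD// [leRHS]splitr lerD//.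
  apply: (@le_trans _ _ (N%:R * (e / 2 / 2 / (N%:R + 1)))).
    by rewrite ler_wpM2l// (le_trans _ Gn)// ler_norm.
  by rewrite mulrCA ler_piMr ?(ltW e4)// ler_pdivrMr ?ltr_wpDl// mul1r lerDl.
apply: (@le_trans _ _ (2 * M * (e / 2 / 2 / (2 * M + 1)))).
  by rewrite ler_wpM2l ?mulr_ge0// (le_trans _ tN)// ler_norm.
by rewrite mulrCA ler_piMr ?(ltW e4)// ler_pdivrMr ?ltr_wpDl ?mulr_ge0// mul1r lerDl.
Qed.

End bernstein.

(** * The fundamental theorem of calculus on an open interval *)

Section improper.
Context {R : realType}.
Local Notation mu := (@lebesgue_measure R).

(** Monotone convergence along compact subintervals. The sign condition spares any prior proof of
    integrability; signed integrands are shifted by an integrable function before the lemma is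
    applied. *)
Lemma improper_FTC (f F : R -> R) (a b la lb : R) : a < b ->
  (forall x, a < x < b -> 0 <= f x) -> (forall x, a < x < b -> {for x, continuous f}) ->
  (forall x, a < x < b -> is_derive x 1 F (f x)) ->
  F x @[x --> a^'+] --> la -> F x @[x --> b^'-] --> lb ->
  (\int[mu]_(x in `]a, b[) (f x)%:E = (lb - la)%:E)%E.
Proof.
move=> ab f0 cf dF Fa Fb.
pose d := b - a; have d0 : 0 < d by rewrite subr_gt0.
(* The shift by 3 gives e n <= d / 3, hence u n < v n already for n = 0. *)
pose e n := d / n.+3%:R.
have e0 n : 0 < e n by rewrite divr_gt0.
have e3 n : e n <= d / 3.
  by rewrite ler_pM2l// lef_pV2 ?posrE// ler_nat.
have ed n : e n < d / 2 by rewrite (le_lt_trans (e3 n))// ltr_pM2l// ltf_pV2 ?posrE ?ltr_nat.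
pose u n := a + e n; pose v n := b - e n.
have uv n : u n < v n by have := ed n; rewrite /u /v /d; lra.
have ea : e n @[n --> \oo] --> (0 : R).
  rewrite /e -(mulr0 d); apply: cvgM; first exact: cvg_cst.
  have := @cvg_harmonic R; rewrite -(cvg_shiftn 2); apply: cvg_trans.
  by apply: near_eq_cvg; near=> n; rewrite /= addn2.
have ua : u n @[n --> \oo] --> a.
  by rewrite -[X in _ --> X]addr0; apply: cvgD => //; exact: cvg_cst.
have vb : v n @[n --> \oo] --> b.
  by rewrite -[X in _ --> X]subr0; apply: cvgB => //; exact: cvg_cst.
have Fu : F (u n) @[n --> \oo] --> la.
  by move/cvg_at_rightP : Fa; apply; split => // n; rewrite /u ltrDl.
have Fv : F (v n) @[n --> \oo] --> lb.
  by move/cvg_at_leftP : Fb; apply; split => // n; rewrite /v ltrBlDr ltrDl.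
have inab n x : u n <= x <= v n -> a < x < b.
  by have := e0 n; rewrite /u /v => ? /andP[? ?]; apply/andP; split; lra.
have intn n : (\int[mu]_(x in `[u n, v n]) (f x)%:E = (F (v n) - F (u n))%:E)%E.
  rewrite EFinB; apply: continuous_FTC2 => //.
  - apply: continuous_in_subspaceT => x; rewrite inE /= in_itv /= => /inab.
    exact: cf.
  - have cF x : a < x < b -> {for x, continuous F}.
      by move=> xab; apply/differentiable_continuous/derivable1_diffP; have [] := dF x xab.
    split.
    + move=> x; rewrite in_itv /= => /andP[/ltW ux /ltW xv].
      by have [] := dF x (inab n x _); rewrite ?ux ?xv.
    + by apply: cvg_at_right_filter; apply: cF; apply: (inab n); rewrite lexx ltW.
    + by apply: cvg_at_left_filter; apply: cF; apply: (inab n); rewrite lexx ltW.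
  - move=> x; rewrite in_itv /= => /andP[/ltW ux /ltW xv].
    have dFx := dF x (inab n x _); rewrite derive1E.
    by apply: derive_val; apply: dFx; rewrite ux xv.
have cup : `]a, b[%classic = \bigcup_n `[u n, v n]%classic.
  apply/seteqP; split => x /=.
    rewrite in_itv /= => /andP[ax xb].
    have : \forall n \near \oo, u n < x by exact: (cvgr_lt a ua).
    move=> un; have vn : \forall n \near \oo, x < v n by exact: (cvgr_gt b vb).
    near \oo => n; exists n => //=; rewrite in_itv /=.
    by apply/andP; split; apply: ltW; near: n.
  by move=> [n _ /=]; rewrite !in_itv /= => /inab.
rewrite cup.
have mf : measurable_fun `]a, b[%classic f.
  apply: open_continuous_measurable_fun => // x; rewrite inE /= in_itv /=.
  exact: cf.
have nd : nondecreasing_seq (fun n => `[u n, v n]%classic).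
  move=> m n mn; rewrite subsetEset => x /=; rewrite !in_itv /= => /andP[ux xv].
  have enm : e n <= e m by rewrite ler_pM2l// lef_pV2 ?posrE// ler_nat !ltnS.
  by move: ux xv; rewrite /u /v => ? ?; apply/andP; split; lra.
have H : (\int[mu]_(x in `[u n, v n]) (f x)%:E @[n --> \oo] -->
    \int[mu]_(x in \bigcup_n `[u n, v n]%classic) (f x)%:E)%E.
  apply: ge0_nondecreasing_set_cvg_integral => //.
  - move=> n; apply/measurable_EFinP; apply: measurable_funS mf => //.
    by rewrite cup => x; exists n.
  - by move=> n x /=; rewrite in_itv /= => /inab ?; rewrite lee_fin f0.
apply: (cvg_unique _ H) => //.
rewrite (_ : (fun n => _) = (fun n => (F (v n) - F (u n))%:E)); last first.
  by apply/funext => n; rewrite -intn.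
by apply: cvg_EFin; [by apply: nearW|exact: cvgB].
Unshelve. all: by end_near. Qed.

End improper.

(** * Analytic polynomials on the half circle: Chebyshev functions *)

Section chebyshev.
Context {R : realType}.
Implicit Types (x c : R) (a b p : {poly R}).
Local Notation I := (I11 R).

Definition w x : R := sqrtr (1 - x ^+ 2).

Definition xi x : R[i] := Complex x (w x).

(* With x = cos theta and 0 < theta < pi, [xi x = exp(i theta)], [w x = sin theta]
   and [C a x + i S a x = a(exp(i theta))]; for a = 'X^n these are cos (n theta)
   and sin (n theta). *)
Definition ev a x : R[i] := (map_poly (real_complex R) a).[xi x].
Definition C a x : R := complex.Re (ev a x).
Definition S a x : R := complex.Im (ev a x).

Lemma w_ge0 x : 0 <= w x.
Proof. exact: sqrtr_ge0. Qed.

Lemma I_sqr x : I x -> 0 < 1 - x ^+ 2.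
Proof. by move=> /I11P /andP[? ?]; nra. Qed.

Lemma w_gt0 x : I x -> 0 < w x.
Proof. by move=> /I_sqr; rewrite /w sqrtr_gt0. Qed.

Lemma w_neq0 x : I x -> w x != 0.
Proof. by move=> /w_gt0/lt0r_neq0. Qed.

Lemma w2 x : I x -> w x ^+ 2 = 1 - x ^+ 2.
Proof. by move=> /I_sqr/ltW/sqr_sqrtr. Qed.

Lemma w_le1 x : w x <= 1.
Proof. by rewrite /w -[leRHS]sqrtr1 ler_sqrt ?ler01// gerBl sqr_ge0. Qed.

Lemma continuous_w : continuous w.
Proof.
move=> x; apply: continuous_comp; last exact: sqrt_continuous.
by apply: cvgB; [exact: cvg_cst|exact: exprn_continuous].
Qed.

Lemma cReD (z z' : R[i]) : complex.Re (z + z') = complex.Re z + complex.Re z'.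
Proof. by case: z; case: z'. Qed.
Lemma cImD (z z' : R[i]) : complex.Im (z + z') = complex.Im z + complex.Im z'.
Proof. by case: z; case: z'. Qed.
Lemma cReM (z z' : R[i]) : complex.Re (z * z') =
  complex.Re z * complex.Re z' - complex.Im z * complex.Im z'.
Proof. by case: z; case: z'. Qed.
Lemma cImM (z z' : R[i]) : complex.Im (z * z') =
  complex.Re z * complex.Im z' + complex.Im z * complex.Re z'.
Proof. by case: z; case: z'. Qed.

Lemma evD a b x : ev (a + b) x = ev a x + ev b x.
Proof. by rewrite /ev rmorphD hornerD. Qed.
Lemma evM a b x : ev (a * b) x = ev a x * ev b x.
Proof. by rewrite /ev rmorphM hornerM. Qed.
Lemma ev_C c x : ev c%:P x = Complex c 0.
Proof. by rewrite /ev map_polyC hornerC. Qed.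
Lemma ev_X x : ev 'X x = xi x.
Proof. by rewrite /ev map_polyX hornerX. Qed.

Lemma C_D a b x : C (a + b) x = C a x + C b x.
Proof. by rewrite /C evD cReD. Qed.
Lemma S_D a b x : S (a + b) x = S a x + S b x.
Proof. by rewrite /S evD cImD. Qed.
Lemma C_M a b x : C (a * b) x = C a x * C b x - S a x * S b x.
Proof. by rewrite /C evM cReM. Qed.
Lemma S_M a b x : S (a * b) x = C a x * S b x + S a x * C b x.
Proof. by rewrite /S evM cImM. Qed.
Lemma C_C c x : C c%:P x = c.
Proof. by rewrite /C ev_C. Qed.
Lemma S_C c x : S c%:P x = 0.
Proof. by rewrite /S ev_C. Qed.
Lemma C_X x : C 'X x = x.
Proof. by rewrite /C ev_X. Qed.
Lemma S_X x : S 'X x = w x.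
Proof. by rewrite /S ev_X. Qed.
Lemma C_Z c a x : C (c *: a) x = c * C a x.
Proof. by rewrite -mul_polyC C_M C_C S_C mul0r subr0. Qed.
Lemma S_Z c a x : S (c *: a) x = c * S a x.
Proof. by rewrite -mul_polyC S_M C_C S_C mul0r addr0. Qed.
Lemma C_N a x : C (- a) x = - C a x.
Proof. by rewrite -scaleN1r C_Z mulN1r. Qed.
Lemma S_N a x : S (- a) x = - S a x.
Proof. by rewrite -scaleN1r S_Z mulN1r. Qed.
Lemma C_B a b x : C (a - b) x = C a x - C b x.
Proof. by rewrite C_D C_N. Qed.
Lemma S_B a b x : S (a - b) x = S a x - S b x.
Proof. by rewrite S_D S_N. Qed.
Lemma C_MX a c x : C (a * 'X + c%:P) x = x * C a x - w x * S a x + c.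
Proof. by rewrite C_D C_M C_C C_X S_X mulrC [S a x * _]mulrC. Qed.
Lemma S_MX a c x : S (a * 'X + c%:P) x = w x * C a x + x * S a x.
Proof. by rewrite S_D S_M S_C C_X S_X addr0 mulrC [S a x * _]mulrC. Qed.
Lemma C_0 x : C 0 x = 0.
Proof. exact: C_C. Qed.
Lemma S_0 x : S 0 x = 0.
Proof. exact: S_C. Qed.
Lemma C_1 x : C 1 x = 1.
Proof. exact: C_C. Qed.
Lemma S_1 x : S 1 x = 0.
Proof. exact: S_C. Qed.

Lemma C_Xn n x : C 'X^(n.+1) x = x * C 'X^n x - w x * S 'X^n x.
Proof. by rewrite exprSr C_M C_X S_X mulrC [S _ x * _]mulrC. Qed.
Lemma S_Xn n x : S 'X^(n.+1) x = w x * C 'X^n x + x * S 'X^n x.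
Proof. by rewrite exprSr S_M C_X S_X mulrC [S _ x * _]mulrC. Qed.

Lemma CS2 n x : I x -> C 'X^n x ^+ 2 + S 'X^n x ^+ 2 = 1.
Proof.
move=> Ix; have := w2 Ix; elim: n => [|n IH] w2x.
  by rewrite expr0 C_1 S_1; ring.
rewrite C_Xn S_Xn; transitivity ((x ^+ 2 + w x ^+ 2) * (C 'X^n x ^+ 2 + S 'X^n x ^+ 2)).
  by ring.
by rewrite IH// w2x; ring.
Qed.

Lemma C_le1 n x : I x -> `|C 'X^n x| <= 1.
Proof. by move=> /(CS2 n) H; rewrite ler_norml; apply/andP; split; nra. Qed.
Lemma S_le1 n x : I x -> `|S 'X^n x| <= 1.
Proof. by move=> /(CS2 n) H; rewrite ler_norml; apply/andP; split; nra. Qed.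

Lemma continuous_CS a : continuous (C a) /\ continuous (S a).
Proof.
elim/poly_ind: a => [|a c [IC IS]].
  by split=> x; rewrite (_ : _ 0 = fun=> 0) ?(funext C_0) ?(funext S_0)//; exact: cvg_cst.
split.
  rewrite (_ : C _ = fun x => x * C a x - w x * S a x + c); last exact/funext/C_MX.
  move=> x; apply: cvgD; last exact: cvg_cst.
  by apply: cvgB; apply: cvgM; [exact: cvg_id|exact: IC|exact: continuous_w|exact: IS].
rewrite (_ : S _ = fun x => w x * C a x + x * S a x); last exact/funext/S_MX.
move=> x; by apply: cvgD; apply: cvgM; [exact: continuous_w|exact: IC|exact: cvg_id|exact: IS].
Qed.

Lemma continuous_C a : continuous (C a).
Proof. by case: (continuous_CS a). Qed.
Lemma continuous_S a : continuous (S a).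
Proof. by case: (continuous_CS a). Qed.
Lemma mI_C a : mI (C a).
Proof. by apply: mI_cont; case: (continuous_CS a). Qed.
Lemma mI_S a : mI (S a).
Proof. by apply: mI_cont; case: (continuous_CS a). Qed.
Lemma mI_w : mI w.
Proof. by apply: mI_cont; exact: continuous_w. Qed.
Lemma mI_rw : mI (fun x => (w x)^-1).
Proof. by apply: mI_V; exact: mI_w. Qed.

Lemma CS_bounded a : exists2 M, 0 <= M & forall x, I x -> `|C a x| <= M /\ `|S a x| <= M.
Proof.
elim/poly_ind: a => [|a c [M M0 IH]].
  by exists 0 => // x _; rewrite C_0 S_0 normr0.
exists (M + M + `|c|) => [|x Ix]; first by rewrite !addr_ge0.
have [IC IS] := IH x Ix; rewrite C_MX S_MX.
have x1 : `|x| <= 1 by rewrite ler_norml; move/I11P: Ix => /andP[? ?]; apply/andP; split; lra.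
have w1 : `|w x| <= 1 by rewrite ger0_norm ?w_ge0 ?w_le1.
have xC : `|x * C a x| <= M by rewrite normrM -[M]mul1r ler_pM.
have xS : `|x * S a x| <= M by rewrite normrM -[M]mul1r ler_pM.
have wC : `|w x * C a x| <= M by rewrite normrM -[M]mul1r ler_pM.
have wS : `|w x * S a x| <= M by rewrite normrM -[M]mul1r ler_pM.
split.
  by rewrite (le_trans (ler_normD _ _))// lerD2r (le_trans (ler_normB _ _))// lerD.
by rewrite (le_trans (ler_normD _ _))// -[leLHS]addr0 !lerD.
Qed.

Lemma poly_decomp a : exists b c, a = b * 'X + c%:P.
Proof. by elim/poly_ind: a => [|q c _]; [exists 0, 0; rewrite mul0r add0r|exists q, c]. Qed.

(** Multiplication by x = cos theta takes cos (n theta) to the half sum of cos ((n + 1) theta) and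
    cos ((n - 1) theta), so it averages the two shifts of a. The backward shift [b] loses the
    constant term, which should move to exponent -1; on the circle that has the same real part as
    ['X], whence [c' *: 'X]. *)
Lemma poly_C p : exists a, forall x, I x -> C a x = p.[x].
Proof.
elim/poly_ind: p => [|p c [a Ha]].
  by exists 0 => x _; rewrite C_0 horner0.
have [b [c' ab]] := poly_decomp a.
exists (2^-1 *: (a * 'X + c' *: 'X + b) + c%:P) => x Ix.
rewrite hornerD hornerM hornerX hornerC -Ha// C_D C_C; congr (_ + _).
have := w2 Ix; rewrite C_Z !C_D C_M C_Z C_X S_X {2}ab ab C_MX S_MX => w2x.
apply: (mulfI (x := 2)) => //; rewrite mulrA divff// mul1r.
have : w x ^+ 2 * C b x = (1 - x ^+ 2) * C b x by rewrite w2x.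
by move=> H; ring: H.
Qed.

(** From 2 sin theta cos (n theta) = sin ((n + 1) theta) - sin ((n - 1) theta). Removing the
    constant coefficient changes no sine and supplies the normalization that the pairing identities
    ask for. *)
Lemma poly_wS p : exists2 a : {poly R}, a`_0 = 0 & forall x, I x -> S a x = w x * p.[x].
Proof.
have [a Ha] := poly_C p.
have [b [c ab]] := poly_decomp a.
pose a' := 2^-1 *: (a * 'X - b + c *: 'X).
exists (a' - (a'`_0)%:P); first by rewrite coefB coefC subrr.
move=> x Ix; rewrite S_B S_C subr0 -Ha// S_Z S_D S_B S_M S_Z C_X S_X.
apply: (mulfI (x := 2)) => //; rewrite mulrA divff// mul1r ab C_MX S_MX.
have : w x ^+ 2 * S b x = (1 - x ^+ 2) * S b x by rewrite w2.
by move=> H; ring: H.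
Qed.

Lemma is_derive_w x : I x -> is_derive x 1 w (- x / w x).
Proof.
move=> Ix.
have d1 : is_derive x 1 (fun y : R => 1 - y ^+ 2) (- (2 * x)).
  apply: is_derive_eq; rewrite /GRing.scale /=; ring.
have d2 := is_derive1_sqrt (I_sqr Ix).
have := @is_derive1_comp _ _ (fun y : R => 1 - y ^+ 2) x _ _ d2 d1.
rewrite (_ : _ * - (2 * x) = - x / w x)//.
by rewrite -/(w x); field; exact: w_neq0.
Qed.

Lemma is_derive_CS n x : I x -> is_derive x 1 (C 'X^n) (n%:R * S 'X^n x / w x) /\
  is_derive x 1 (S 'X^n) (- (n%:R * C 'X^n x / w x)).
Proof.
move=> Ix; have w0 := w_neq0 Ix; have w2x := w2 Ix; have dw := is_derive_w Ix.
elim: n => [|n [dC dS]].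
  rewrite expr0 !mul0r oppr0 (funext C_1) (funext S_1); split; exact: is_derive_cst.
split.
  rewrite (funext (C_Xn n)) S_Xn; apply: is_derive_eq; rewrite /GRing.scale /= -natr1; field: w2x => //.
rewrite (funext (S_Xn n)) C_Xn; apply: is_derive_eq; rewrite /GRing.scale /= -natr1; field: w2x => //.
Qed.

End chebyshev.

(** * Mean values of cosine and sine polynomials *)

Section chebyshev_integrals.
Context {R : realType}.
Implicit Types (x c : R) (a b p : {poly R}).
Local Notation mu := (@lebesgue_measure R).
Local Notation I := (I11 R).

Lemma acos_lt x (e : R) : -1 < x < 1 -> 0 <= e <= pi -> cos e < x -> acos x < e.
Proof.
move=> /andP[x1 x2] /andP[e0 epi] ex; rewrite ltNge; apply/negP => le.
have xK : cos (acos x) = x by rewrite acosK// in_itv /= !ltW.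
have H : cos (acos x) <= cos e.
  have [->//|ne] := eqVneq e (acos x).
  apply/ltW; rewrite ltr_cos ?in_itv /= ?e0 ?epi ?acos_ge0 ?acos_lepi ?(ltW x1) ?(ltW x2)//.
  by rewrite lt_neqAle ne.
by move: ex; rewrite -{1}xK ltNge H.
Qed.

Lemma cvg_acos1 : acos x @[x --> (1 : R)^'-] --> (0 : R).
Proof.
apply/cvgrPdist_lt => e e0; pose e' := Num.min e pi.
have e'0 : 0 < e' by rewrite lt_min e0 pi_gt0.
have e'pi : e' <= pi by rewrite ge_min lexx orbT.
have c1 : cos e' < 1.
  by rewrite -cos0 ltr_cos ?in_itv /= ?lexx ?pi_ge0 ?(ltW e'0).
near=> x.
have x1 : x < 1 by near: x; exact: nbhs_left_lt.
have xc : cos e' < x by near: x; exact: nbhs_left_gt.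
have xm : -1 < x by near: x; apply: nbhs_left_gt; lra.
rewrite sub0r normrN ger0_norm ?acos_ge0 ?(ltW x1) ?(ltW xm)//.
apply: (@lt_le_trans _ _ e'); last by rewrite ge_min lexx.
by apply: acos_lt => //; rewrite ?xm ?x1 ?(ltW e'0).
Unshelve. all: by end_near. Qed.

Lemma cvg_acosN1 : acos x @[x --> (-1 : R)^'+] --> (pi : R).
Proof.
apply/cvgrPdist_lt => e e0; pose e' := Num.min e pi.
have e'0 : 0 < e' by rewrite lt_min e0 pi_gt0.
have e'pi : e' <= pi by rewrite ge_min lexx orbT.
have c1 : cos e' < 1.
  by rewrite -cos0 ltr_cos ?in_itv /= ?lexx ?pi_ge0 ?(ltW e'0).
near=> x.
have x1 : -1 < x by near: x; exact: nbhs_right_gt.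
have xc : x < - cos e' by near: x; apply: nbhs_right_lt; lra.
have xm : x < 1 by near: x; apply: nbhs_right_lt; lra.
have := @acosN R x; rewrite (ltW x1) (ltW xm) => /(_ isT) E.
have -> : pi - acos x = acos (- x) by rewrite E.
rewrite ger0_norm ?acos_ge0; last by apply/andP; split; lra.
apply: (@lt_le_trans _ _ e'); last by rewrite ge_min lexx.
apply: acos_lt; rewrite ?(ltW e'0)//; last lra.
by apply/andP; split; lra.
Unshelve. all: by end_near. Qed.

Lemma itg_rw : itg (fun x : R => (w x)^-1) /\ J (fun x : R => (w x)^-1) = pi.
Proof.
have H : (\int[mu]_(x in I) ((w x)^-1)%:E = (pi : R)%:E)%E.
  rewrite (_ : pi = - 0 - (- pi)); last by rewrite oppr0 sub0r opprK.
  apply: (@improper_FTC _ _ (fun x => - acos x)).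
  - by lra.
  - by move=> x _; rewrite invr_ge0 w_ge0.
  - move=> x /I11P Ix; apply: cvgV; first exact: w_neq0.
    exact: continuous_w.
  - move=> x x1; have := @is_deriveN _ _ _ _ _ _ _ (is_derive1_acos x1).
    by rewrite opprK.
  - by apply: cvgN; exact: cvg_acosN1.
  - by apply: cvgN; exact: cvg_acos1.
split; last by rewrite /J /Rintegral H.
apply: itg_ge0P => [|x _|]; [exact: mI_rw|by rewrite invr_ge0 w_ge0|by rewrite H ltry].
Qed.

Lemma itg_b_rw (h : R -> R) M : mI h -> (forall x, I x -> `|h x| <= M) -> itg (fun x => h x / w x).
Proof. by move=> mh hM; apply: itgM mh hM _; exact: itg_rw.1. Qed.

Lemma itg_C a : itg (C a).
Proof. by have [M _ H] := CS_bounded a; apply: (itg_bd (M := M)); [exact: mI_C|move=> x /H[]]. Qed.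
Lemma itg_S a : itg (S a).
Proof. by have [M _ H] := CS_bounded a; apply: (itg_bd (M := M)); [exact: mI_S|move=> x /H[]]. Qed.
Lemma itg_Crw a : itg (fun x => C a x / w x).
Proof. by have [M _ H] := CS_bounded a; apply: (itg_b_rw (M := M)); [exact: mI_C|move=> x /H[]]. Qed.
Lemma itg_Srw a : itg (fun x => S a x / w x).
Proof. by have [M _ H] := CS_bounded a; apply: (itg_b_rw (M := M)); [exact: mI_S|move=> x /H[]]. Qed.

Lemma S_end n x : x ^+ 2 = 1 -> S 'X^n x = 0.
Proof.
move=> x1; have w0 : w x = 0 by rewrite /w x1 subrr sqrtr0.
by elim: n => [|n IH]; [rewrite expr0 S_1|rewrite S_Xn w0 IH mul0r mulr0 addr0].
Qed.

Lemma J_CXn n : J (fun x : R => C 'X^(n.+1) x / w x) = 0.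
Proof.
have [i1 J1] := @itg_rw.
have i2 := itg_Crw 'X^(n.+1).
(* Adding 1 / w makes the integrand nonnegative, as cosines are at least -1; the arccosine enters
   the primitive for this reason. *)
suff : J (fun x : R => C 'X^(n.+1) x / w x + (w x)^-1) = pi.
  by rewrite JD// J1 => H; lra.
rewrite /J /Rintegral.
suff -> : (\int[mu]_(x in I) (C 'X^(n.+1) x / w x + (w x)^-1)%:E =
    ((- (n.+1%:R^-1 * 0) - 0) - (- (n.+1%:R^-1 * 0) - pi))%:E)%E.
  by rewrite /= mulr0; lra.
apply: (@improper_FTC _ _ (fun x => - (n.+1%:R^-1 * S 'X^(n.+1) x) - acos x)).
- by lra.
- move=> x /I11P Ix; rewrite -{2}[_^-1]mul1r -mulrDl divr_ge0 ?w_ge0//.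
  by have := C_le1 n.+1 Ix; rewrite ler_norml => /andP[? _]; lra.
- move=> x /I11P Ix; apply: cvgD; last first.
    by apply: cvgV; [exact: w_neq0|exact: continuous_w].
  apply: cvgM; first exact: continuous_C.
  by apply: cvgV; [exact: w_neq0|exact: continuous_w].
- move=> x x1; have /I11P Ix := x1; have da := is_derive1_acos x1.
  have [_ dS] := is_derive_CS n.+1 Ix.
  apply: is_derive_eq; rewrite /GRing.scale /= -/(w x); field.
  by rewrite w_neq0// addrC natr1 pnatr_eq0.
- apply: cvgB; last exact: cvg_acosN1.
  apply: cvgN; apply: cvgM; first exact: cvg_cst.
  rewrite -[X in _ --> X](S_end n.+1 (x := -1)) ?sqrrN ?expr1n//.
  by apply: cvg_at_right_filter; exact: continuous_S.
- apply: cvgB; last exact: cvg_acos1.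
  apply: cvgN; apply: cvgM; first exact: cvg_cst.
  rewrite -[X in _ --> X](S_end n.+1 (x := 1)) ?expr1n//.
  by apply: cvg_at_left_filter; exact: continuous_S.
Qed.

Lemma C_sum (T : Type) (s : seq T) (F : T -> {poly R}) x :
  C (\sum_(i <- s) F i) x = \sum_(i <- s) C (F i) x.
Proof. by elim: s => [|i s IH]; rewrite ?big_nil ?C_0// !big_cons C_D IH. Qed.
Lemma S_sum (T : Type) (s : seq T) (F : T -> {poly R}) x :
  S (\sum_(i <- s) F i) x = \sum_(i <- s) S (F i) x.
Proof. by elim: s => [|i s IH]; rewrite ?big_nil ?S_0// !big_cons S_D IH. Qed.

(** The mean value property at the centre of the disc, dx / w being dtheta. Applied to products and
    powers, it yields the moments and the pairing identities below. *)
Lemma J_C a : J (fun x => C a x / w x) = pi * a`_0.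
Proof.
have E x : C a x / w x = \sum_(i < size a) a`_i * (C 'X^i x / w x).
  rewrite -{1}(coefK a) poly_def C_sum mulr_suml; apply: eq_bigr => i _.
  by rewrite C_Z mulrA.
rewrite (eq_J (g := fun x => \sum_(i < size a) a`_i * (C 'X^i x / w x)))//.
rewrite J_sum => [|i]; last by apply: itgZ; exact: itg_Crw.
under eq_bigr => i _ do rewrite JZ ?itg_Crw//.
have J0 : J (fun x : R => C 'X^0 x / w x) = pi.
  by rewrite -itg_rw.2; apply: eq_J => x _; rewrite expr0 C_1 mul1r.
case: (posnP (size a)) => [/eqP|]; first by rewrite size_poly_eq0 => /eqP ->; rewrite size_poly0 big_ord0 coef0 mulr0.
move=> sa; rewrite (bigD1 (Ordinal sa))//= J0 mulrC big1 ?addr0// => i.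
by rewrite -val_eqE /= -lt0n => i0; rewrite -(prednK i0) J_CXn mulr0.
Qed.

Lemma J_S n : J (S 'X^n : R -> R) = pi / 2 * (n == 1)%:R.
Proof.
case: n => [|n].
  by rewrite mulr0 -[RHS]J0; apply: eq_J => x _; rewrite expr0 S_1.
(* The factor sin theta of dx is absorbed by sin theta sin ((n + 1) theta) = (cos (n theta) - cos
   ((n + 2) theta)) / 2. *)
have E x : I x -> S 'X^(n.+1) x = C (2^-1 *: ('X^n - 'X^(n.+2))) x / w x.
  move=> Ix; have w0 := w_neq0 Ix; have w2x := w2 Ix.
  rewrite C_Z C_B C_Xn C_Xn S_Xn; field: w2x => //.
rewrite (eq_J E) J_C coefZ coefB !coefXn /= eqSS subr0 mulrA.
by rewrite eq_sym.
Qed.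

End chebyshev_integrals.

(** * Exponential integrability of the conjugate of a bounded function *)

Section exponential_integrability.
Context {R : realType}.
Implicit Types (x c t : R) (a b p : {poly R}).
Local Notation I := (I11 R).

Lemma Re_sum (T : Type) (s : seq T) (F : T -> R[i]) :
  complex.Re (\sum_(i <- s) F i) = \sum_(i <- s) complex.Re (F i).
Proof. by elim: s => [|i s IH]; rewrite ?big_nil// !big_cons cReD IH. Qed.

Lemma ReMn (z : R[i]) n : complex.Re (z *+ n) = complex.Re z *+ n.
Proof. by elim: n => [|n IH]; rewrite ?mulr0n// !mulrS cReD IH. Qed.

Lemma ReX_real (u : R) n : Complex u 0 ^+ n = Complex (u ^+ n) 0.
Proof.
elim: n => [|n IH]; first by rewrite !expr0.
rewrite !exprS IH; apply/eqP; rewrite eq_complex cReM cImM /=; apply/andP; split; apply/eqP; ring.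
Qed.

Lemma ReX_imag (v : R) n : `|v| <= 1 ->
  if odd n then complex.Re (Complex 0 v ^+ n) = 0 /\ `|complex.Im (Complex 0 v ^+ n)| <= 1
  else complex.Im (Complex 0 v ^+ n) = 0 /\ `|complex.Re (Complex 0 v ^+ n)| <= 1.
Proof.
move=> v1; elim: n => [|n IH] /=; first by rewrite normr1.
rewrite exprS cReM cImM /= !mul0r sub0r; move: IH; case: (odd n) => /= -[-> H].
  by rewrite mulr0 addr0 normrN normrM -[1]mulr1 ler_pM.
by rewrite mulr0 oppr0 add0r normrM -[1]mulr1 ler_pM.
Qed.

(* Expand [(u + i v)^n]: the terms odd in [v] are imaginary. *)
Lemma even_power_le (u v : R) n : `|v| <= 1 -> ~~ odd n ->
  u ^+ n <= complex.Re (Complex u v ^+ n) +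
    \sum_(m < n | ~~ odd m.+1) u ^+ (n - m.+1) *+ 'C(n, m.+1).
Proof.
move=> v1 en.
have -> : Complex u v = Complex u 0 + Complex 0 v.
  by apply/eqP; rewrite eq_complex cReD cImD /= addr0 add0r !eqxx.
rewrite exprDn Re_sum big_ord_recl /= subn0 expr0 mulr1 bin0 mulr1n ReX_real /= -addrA.
rewrite lerDl [X in 0 <= _ + X]big_mkcond -big_split /= sumr_ge0// => m _.
rewrite ReMn cReM ReX_real /= mul0r subr0 /bump /= add1n.
have := ReX_imag m.+1 v1; rewrite /=; have [om|om] := boolP (odd m) => /= -[H1 H2].
  rewrite -mulrnDl mulrn_wge0// -{2}[u ^+ _]mulr1 -mulrDr.
  have u0 : 0 <= u ^+ (n - m.+1).
    rewrite exprn_even_ge0// oddB//= (negbTE en) om//.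
  by rewrite mulr_ge0//; move: H2; rewrite ler_norml => /andP[]; lra.
by rewrite H1 mulr0 mul0rn add0r.
Qed.

Lemma geometric3 n : \sum_(m < n) (3 : R) ^+ (n - m.+1) <= 3 ^+ n / 2.
Proof.
elim: n => [|n IH]; first by rewrite big_ord0 divr_ge0 ?exprn_ge0.
rewrite big_ord_recl /= subn1 /=.
under eq_bigr => i _ do rewrite /bump /= add1n subSS.
have : (0 : R) <= 3 ^+ n by rewrite exprn_ge0.
by move: IH; rewrite exprS; lra.
Qed.

(* Here [u + i v] stands for a polynomial in [exp(i theta)], whose n-th power has
   mean at most 1 for even n. If |v| <= 1, its moments bound those of u, so that
   [u] is exponentially integrable. *)
Section moments.
Variables (u v : R -> R) (M : R).
Hypotheses (mu_ : mI u) (uM : forall x, I x -> `|u x| <= M).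
Hypothesis v1 : forall x, I x -> `|v x| <= 1.
Hypothesis iRe : forall n, ~~ odd n -> itg (fun x => complex.Re (Complex (u x) (v x) ^+ n) / w x).
Hypothesis JRe : forall n, ~~ odd n ->
  J (fun x => complex.Re (Complex (u x) (v x) ^+ n) / w x) <= pi.

Lemma itg_pow n : itg (fun x => u x ^+ n / w x).
Proof.
apply: (itg_b_rw (M := M ^+ n)) => [|x Ix]; first exact: mI_X.
by rewrite normrX lerXn2r ?nnegrE ?uM// (le_trans _ (uM Ix)).
Qed.

(** Integrating [even_power_le] bounds the n-th moment by pi plus binomial multiples of lower even
    moments. Since 'C(n, m) (n - m)! <= n!, the induction hypothesis sums to a geometric series
    worth half of the claim (this is where 3 comes from), and pi fits in the other half. *)
Lemma moment_le n : ~~ odd n -> J (fun x => u x ^+ n / w x) <= 4 * n`!%:R * 3 ^+ n.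
Proof.
elim/ltn_ind: n => n IH en.
have iS : itg (fun x => \sum_(m < n) (if ~~ odd m.+1 then 'C(n, m.+1)%:R else 0) *
    (u x ^+ (n - m.+1) / w x)).
  by apply: itg_sum => m; apply: itgZ; exact: itg_pow.
apply: (@le_trans _ _ (J (fun x => complex.Re (Complex (u x) (v x) ^+ n) / w x +
   \sum_(m < n) (if ~~ odd m.+1 then 'C(n, m.+1)%:R else 0) * (u x ^+ (n - m.+1) / w x)))).
  apply: J_le; [exact: itg_pow|by apply: itgD => //; exact: iRe|move=> x Ix].
  have := even_power_le (u x) (v1 Ix) en.
  rewrite -(ler_pM2r (x := (w x)^-1)) ?invr_gt0 ?w_gt0// mulrDl => /le_trans; apply.
  rewrite lerD2l mulr_suml big_mkcond /= ler_sum// => m _.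
  by case: ifP => _; rewrite ?mul0r// -mulr_natl mulrA.
rewrite JD//; last exact: iRe.
rewrite J_sum; last by move=> m; apply: itgZ; exact: itg_pow.
have fn0 : (0 : R) < n`!%:R by rewrite ltr0n fact_gt0.
have H m : m \in index_enum 'I_n -> true ->
    J (fun x => (if ~~ odd m.+1 then 'C(n, m.+1)%:R else 0) * (u x ^+ (n - m.+1) / w x)) <=
    4 * n`!%:R * 3 ^+ (n - m.+1).
  move=> _ _; rewrite JZ; last exact: itg_pow.
  case: ifPn => om; last by rewrite mul0r !mulr_ge0 ?exprn_ge0// ltW.
  have lt : (n - m.+1 < n)%N by rewrite ltn_subrL (leq_trans _ (ltn_ord m)).
  have ev : ~~ odd (n - m.+1) by rewrite oddB// (negbTE en) (negbTE om).
  apply: (@le_trans _ _ ('C(n, m.+1)%:R * (4 * (n - m.+1)`!%:R * 3 ^+ (n - m.+1)))).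
    by rewrite ler_wpM2l// IH.
    have f1 : (1 : R) <= (m.+1)`!%:R by rewrite ler1n fact_gt0.
  rewrite -(bin_fact (ltn_ord m)) natrM (natrM _ (m.+1)`!).
  move: (m.+1)`!%:R f1 => F f1.
  rewrite [leLHS](_ : _ = 4 * ('C(n, m.+1)%:R * (1 * (n - m.+1)`!%:R)) * 3 ^+ (n - m.+1)); last by ring.
  by rewrite ler_wpM2r ?exprn_ge0// ler_wpM2l// ler_wpM2l// ler_wpM2r.
have [n0|n0] := posnP n.
  have := JRe en; rewrite n0 big_ord0 fact0 !expr0 !mulr1 addr0 => /le_trans; apply.
  by have := @pihalf_lt2 R; lra.
apply: (@le_trans _ _ (pi + \sum_(m < n) 4 * n`!%:R * 3 ^+ (n - m.+1))).
  by rewrite lerD ?JRe// big_seq [leRHS]big_seq ler_sum// => m /H; exact.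
rewrite -mulr_sumr; have g := geometric3 n.
have n1 : (1 : R) <= n`!%:R by rewrite ler1n fact_gt0.
have n3 : (3 : R) <= 3 ^+ n by rewrite -{1}(expr1 3) ler_eXn2l ?ltr1n.
have p4 : pi <= 4 :> R by have := @pihalf_lt2 R; lra.
nra.
Qed.

Definition exp_partial (t : R) N : R := \sum_(n < N) t ^+ n / n`!%:R.

Lemma exp_partial_cvg t : exp_partial t N @[N --> \oo] --> expR t.
Proof.
have := is_cvg_series_exp_coeff t; rewrite /expR; apply: cvg_trans.
by apply: near_eq_cvg; near=> N; rewrite /exp_partial /series /= big_mkord.
Unshelve. all: by end_near. Qed.

Lemma exp_partial_le t N : `|exp_partial t N| <= expR `|t|.
Proof.
apply: (@le_trans _ _ (exp_partial `|t| N)).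
  rewrite (le_trans (ler_norm_sum _ _ _))// ler_sum// => n _.
  by rewrite normrM normrX [`|_^-1|]ger0_norm ?invr_ge0.
have nd : nondecreasing_seq (exp_partial `|t|).
  apply/nondecreasing_seqP => n; rewrite /exp_partial big_ord_recr /= lerDl.
  by rewrite divr_ge0 ?exprn_ge0.
have c := @exp_partial_cvg `|t|; rewrite -(cvg_lim _ c)//.
by apply: nondecreasing_cvgn_le => //; apply/cvg_ex; exists (expR `|t|).
Qed.

(** At scale 6 the moment bound 4 n! 3^n turns the exponential series into 8 times a geometric
    series of ratio 1 / 2, hence 16. Only even moments are controlled, so exp(u / 6) + exp(-u / 6)
    is expanded instead of exp(|u| / 6). *)
Lemma J_exp_le : itg (fun x => expR (`|u x| / 6) / w x) /\
  J (fun x => expR (`|u x| / 6) / w x) <= 16.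
Proof.
have mE : mI (fun x => expR (`|u x| / 6)).
  by apply: mI_exp; apply: mI_M; [exact: mI_norm|exact: mI_cst].
have iE : itg (fun x => expR (`|u x| / 6) / w x).
  apply: (itg_b_rw (M := expR (M / 6))) => // x Ix.
  by rewrite ger0_norm ?expR_ge0// ler_expR ler_pM2r// uM.
split=> //.
pose F N x := (exp_partial (u x / 6) N + exp_partial (- (u x / 6)) N) / w x.
pose G x := (expR (u x / 6) + expR (- (u x / 6))) / w x.
have mu6 : mI (fun x => u x / 6) by apply: mI_M => //; exact: mI_cst.
have mu6N : mI (fun x => - (u x / 6)) by exact: mI_N.
have mG : mI G.
  apply: mI_M; last exact: mI_rw.
  by apply: mI_D; exact: mI_exp.
have mF N : mI (F N).
  apply: mI_M; last exact: mI_rw.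
  by apply: mI_D; apply: mI_sum => n; apply: mI_M; [exact: mI_X|exact: mI_cst|exact: mI_X|exact: mI_cst].
have u6M x : I x -> expR `|u x / 6| <= expR (M / 6).
  by move=> Ix; rewrite ler_expR normrM [`|_^-1|]ger0_norm// ler_pM2r// uM.
have FG : J (F N) @[N --> \oo] --> J G.
  apply: (J_dct (g := fun x => (expR (M / 6) + expR (M / 6)) / w x)) => //.
  - move=> x Ix; apply: cvgM; last exact: cvg_cst.
    by apply: cvgD; exact: exp_partial_cvg.
  - by apply: (itg_b_rw (M := `|expR (M / 6) + expR (M / 6)|)) => //; exact: mI_cst.
  - move=> N x Ix; rewrite normrM [`|_^-1|]ger0_norm ?invr_ge0 ?w_ge0//.
    rewrite ler_wpM2r ?invr_ge0 ?w_ge0// (le_trans (ler_normD _ _))//.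
    rewrite lerD// (le_trans (exp_partial_le _ _))// ?normrN u6M//.
have iG : itg G.
  apply: (itg_b_rw (M := expR (M / 6) + expR (M / 6))) => [|x Ix].
    by apply: mI_D; exact: mI_exp.
  have e1 : expR (u x / 6) <= expR `|u x / 6| by rewrite ler_expR ler_norm.
  have e2 : expR (- (u x / 6)) <= expR `|u x / 6| by rewrite ler_expR -normrN ler_norm.
  rewrite ger0_norm ?addr_ge0 ?expR_ge0//.
  by apply: lerD; apply: le_trans (u6M x Ix).
have FN N : J (F N) <= 16.
  have E x : F N x = \sum_(n < N) (if odd n then 0 else 2 / n`!%:R / 6 ^+ n) * (u x ^+ n / w x).
    rewrite /F /exp_partial -big_split /= mulr_suml; apply: eq_bigr => n _.
    rewrite exprNn -mulrDl -mulrA -signr_odd exprMn exprVn.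
    by case: (odd n); rewrite ?expr0 ?expr1 ?mul1r ?mulN1r ?subrr ?mul0r// ; ring.
  rewrite (eq_J (g := fun x => \sum_(n < N) (if odd n then 0 else 2 / n`!%:R / 6 ^+ n) * (u x ^+ n / w x)))//.
  rewrite J_sum; last by move=> n; apply: itgZ; exact: itg_pow.
  apply: (@le_trans _ _ (\sum_(n < N) 8 * (2^-1) ^+ n)).
    apply: ler_sum => n _; rewrite JZ; last exact: itg_pow.
    case: ifPn => on; first by rewrite mul0r mulr_ge0// exprn_ge0.
    have f0 : (0 : R) < n`!%:R by rewrite ltr0n fact_gt0.
    apply: (@le_trans _ _ (2 / n`!%:R / 6 ^+ n * (4 * n`!%:R * 3 ^+ n))).
      by rewrite ler_wpM2l ?moment_le// !divr_ge0 ?exprn_ge0// ltW.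
    rewrite (_ : 2^-1 = 3 / 6 :> R); last by field.
    rewrite exprMn exprVn le_eqVlt; apply/orP; left; apply/eqP; field.
    by rewrite (gt_eqF f0) expf_neq0.
  rewrite -mulr_sumr (_ : 16 = 8 * 2); last by ring.
  rewrite ler_wpM2l//.
  suff -> : \sum_(n < N) (2^-1 : R) ^+ n = 2 - 2 * 2^-1 ^+ N.
    by rewrite gerBl mulr_ge0 ?exprn_ge0.
  elim: (N) => [|m IHm]; first by rewrite big_ord0 expr0; ring.
  by rewrite big_ord_recr /= IHm exprS; field.
apply: (@le_trans _ _ (J G)).
  apply: J_le => // x Ix; rewrite /G ler_wpM2r ?invr_ge0 ?w_ge0//.
  have [u0|u0] := leP 0 (u x).
    by rewrite ger0_norm// lerDl expR_ge0.
  by rewrite ltr0_norm// mulNr lerDr expR_ge0.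
by apply: (ler_cvg_to FG (cvg_cst (16 : R))); near=> N; exact: FN.
Unshelve. all: by end_near. Qed.

End moments.

Lemma evXn a n x : Complex (C a x) (S a x) ^+ n = ev (a ^+ n) x.
Proof.
elim: n => [|n IH]; first by rewrite !expr0 /ev rmorph1 hornerE.
by rewrite !exprS IH evM /C /S; case: (ev a x).
Qed.

Lemma oppconjX (z : R[i]) n :
  (- z^*%C) ^+ n = Complex ((-1) ^+ n * complex.Re (z ^+ n)) (- ((-1) ^+ n * complex.Im (z ^+ n))).
Proof.
elim: n => [|n IH].
  by rewrite !expr0; apply/eqP; rewrite eq_complex /= mul1r mulr0 oppr0 !eqxx.
rewrite exprS {}IH (exprS z) (exprS (-1)); move: ((-1) ^+ n) (z ^+ n) => s y.
case: z y => [a b] [c d].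
by apply/eqP; rewrite eq_complex /=; apply/andP; split; apply/eqP; ring.
Qed.

Lemma coef0_exp a n : (a ^+ n)`_0 = a`_0 ^+ n.
Proof. by rewrite -!horner_coef0 horner_exp. Qed.

Lemma J_exp_C a : a`_0 = 0 -> (forall x, I x -> `|S a x| <= 1) ->
  itg (fun x => expR (`|C a x| / 6) / w x) /\ J (fun x => expR (`|C a x| / 6) / w x) <= 16.
Proof.
move=> a0 S1; have [M _ HM] := CS_bounded a.
have E n x : complex.Re (Complex (C a x) (S a x) ^+ n) / w x = C (a ^+ n) x / w x.
  by rewrite evXn.
apply: (@J_exp_le _ (S a) M) => //; first exact: mI_C.
- by move=> x /HM[].
- by move=> n _; apply: eq_itg (itg_Crw (a ^+ n)) => x _; rewrite E.
- move=> n _; rewrite (eq_J (g := fun x => C (a ^+ n) x / w x)) => [|x _]; last exact: E.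
  rewrite J_C coef0_exp a0 expr0n; case: n => [|n]; rewrite /= ?mulr1// mulr0; exact: pi_ge0.
Qed.

Lemma J_exp_S a : (forall x, I x -> `|C a x| <= 1) ->
  itg (fun x => expR (`|S a x| / 6) / w x) /\ J (fun x => expR (`|S a x| / 6) / w x) <= 16.
Proof.
move=> C1; have [M _ HM] := CS_bounded a.
have E n x : complex.Re (Complex (S a x) (C a x) ^+ n.*2) / w x = (-1) ^+ n * (C (a ^+ n.*2) x / w x).
  have -> : C (a ^+ n.*2) x = complex.Re (Complex (C a x) (S a x) ^+ n.*2) by rewrite evXn.
  rewrite mulrA; congr (_ / _).
  rewrite -!muln2 mulnC !exprM.
  have -> : Complex (S a x) (C a x) ^+ 2 = - (Complex (C a x) (S a x) ^+ 2)^*%C.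
    by rewrite !expr2; apply/eqP; rewrite eq_complex /=; apply/andP; split; apply/eqP; ring.
  by rewrite oppconjX.
have a01 : `|a`_0| <= 1.
  have p0 := @pi_gt0 R; rewrite -(ler_pM2l p0) mulr1 -{1}(gtr0_norm p0) -normrM -J_C.
  have iC := itg_Crw a; rewrite (le_trans (le_normJ iC))// -[leRHS]itg_rw.2.
  apply: J_le; [exact: itg_norm|exact: itg_rw.1|move=> x Ix].
  rewrite normrM [`|_^-1|]ger0_norm ?invr_ge0 ?w_ge0// -[leRHS]mul1r.
  by rewrite ler_wpM2r ?invr_ge0 ?w_ge0// C1.
apply: (@J_exp_le _ (C a) M) => //; first exact: mI_S.
- by move=> x /HM[].
- move=> n en; apply: eq_itg (itgZ ((-1) ^+ n./2) (itg_Crw (a ^+ n))) => x _.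
  by rewrite -{2 3}(even_halfK en) E.
- move=> n en; rewrite (eq_J (g := fun x => (-1) ^+ n./2 * (C (a ^+ n) x / w x))); last first.
    by move=> x _; rewrite -{1 3}(even_halfK en) E.
  rewrite JZ ?itg_Crw// J_C coef0_exp mulrCA -[leRHS]mulr1 ler_wpM2l ?pi_ge0//.
  rewrite (le_trans (ler_norm _))// normrM normrX normrN1 expr1n mul1r normrX.
  exact: exprn_ile1.
Qed.

Lemma J_S2_le a : J (fun x => S a x ^+ 2 / w x) <= J (fun x => C a x ^+ 2 / w x).
Proof.
rewrite -subr_ge0 -JB.
- rewrite (eq_J (g := fun x => C (a ^+ 2) x / w x)); last first.
    by move=> x _; rewrite expr2 C_M; ring.
  by rewrite J_C coef0_exp mulr_ge0 ?pi_ge0 ?sqr_ge0.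
- apply: (eq_itg (f := fun x => (C a x * C a x) / w x)) => //.
  by have [M M0 H] := CS_bounded a; apply: (itg_b_rw (M := M * M)) => [|x /H[? _]];
    [apply: mI_M; exact: mI_C|rewrite normrM ler_pM].
- apply: (eq_itg (f := fun x => (S a x * S a x) / w x)) => //.
  by have [M M0 H] := CS_bounded a; apply: (itg_b_rw (M := M * M)) => [|x /H[_ ?]];
    [apply: mI_M; exact: mI_S|rewrite normrM ler_pM].
Qed.

End exponential_integrability.

(** * Limit theorems for integrals *)

Section limits.
Context {R : realType}.
Implicit Types (f g h : R -> R).
Local Notation mu := (@lebesgue_measure R).
Local Notation I := (I11 R).

Lemma J_lim (u : nat -> R -> R) (v psi : R -> R) (M : R) :
  (forall k, itg (u k)) -> itg v -> mI psi -> (forall x, I x -> `|psi x| <= M) ->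
  J (fun x => `|u k x - v x|) @[k --> \oo] --> (0 : R) ->
  J (fun x => psi x * u k x) @[k --> \oo] --> J (fun x => psi x * v x).
Proof.
move=> iu iv mp pM uv; have M0 : 0 <= M.
  by rewrite (le_trans _ (pM 0 _))//; apply/I11P; apply/andP; split; lra.
apply/cvgrPdist_le => e e0.
have eM : 0 < e / (M + 1) by rewrite divr_gt0// ltr_wpDl.
have [N HN] := cvg_ex_le uv eM; exists N => // k /= /HN; rewrite subr0 => H.
rewrite -JB; [|exact: itgM mp pM _|exact: itgM mp pM _].
apply: (@le_trans _ _ (J (fun x => M * `|u k x - v x|))).
  have i1 : itg (fun x => psi x * v x - psi x * u k x).
    by apply: itgB; exact: itgM mp pM _.
  rewrite (le_trans (le_normJ i1))//; apply: J_le; [exact: itg_norm| |move=> x Ix].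
    by apply: itgZ; apply: itg_norm; exact: itgB.
  by rewrite -mulrBr normrM distrC ler_wpM2r// pM.
rewrite JZ; last by apply: itg_norm; exact: itgB.
rewrite (le_trans (ler_wpM2l M0 (le_trans (ler_norm _) H)))// mulrCA ler_piMr ?(ltW e0)//.
by rewrite ler_pdivrMr ?ltr_wpDl// mul1r lerDl.
Qed.

Lemma J_fatou (F : nat -> R -> R) f (A : R) :
  (forall n, itg (F n)) -> (forall n x, I x -> 0 <= F n x) -> (forall n, J (F n) <= A) ->
  mI f -> (forall x, I x -> F n x @[n --> \oo] --> f x) -> itg f /\ J f <= A.
Proof.
move=> iF F0 JF mf Ff.
have f0 x : I x -> 0 <= f x.
  move=> Ix; apply: (ler_cvg_to (cvg_cst (0 : R)) (Ff x Ix)).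
  by near=> n; exact: F0.
have H : (\int[mu]_(x in I) (f x)%:E <= A%:E)%E.
  have mF n : measurable_fun I (EFin \o F n) by apply/measurable_EFinP; exact: itg_m.
  have F0' n x : I x -> (0 <= (EFin \o F n) x)%E by move=> Ix; rewrite /= lee_fin F0.
  have := @fatou _ _ R mu I measurableI11 _ mF F0'.
  rewrite (_ : (\int[mu]_(x in I) limn_einf _)%E = (\int[mu]_(x in I) (f x)%:E)%E); last first.
    apply: eq_integral => x; rewrite inE => Ix.
    have c : (EFin \o F n) x @[n --> \oo] --> (f x)%:E.
      by apply: cvg_EFin; [by apply: nearW|exact: Ff].
    by rewrite is_cvg_limn_einfE; [exact/cvg_lim|apply/cvg_ex; exists (f x)%:E].
  move=> /le_trans; apply; rewrite limn_einf_lim; apply: lime_le.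
    exact: is_cvg_einfs.
  near=> n; apply: (@le_trans _ _ (\int[mu]_(x in I) (EFin \o F n) x)%E).
    by apply: ereal_inf_lbound; exists n => /=.
  by rewrite EFin_J ?lee_fin.
have fi : itg f by apply: itg_ge0P => //; exact: le_lt_trans H (ltry _).
by split => //; move: H; rewrite EFin_J// lee_fin.
Unshelve. all: by end_near. Qed.

(** The Riesz-Fischer argument: the series D of absolute increments is integrable, hence finite
    a.e.; it dominates the sequence and makes it converge a.e. *)
Lemma L1_complete (F : nat -> R -> R) (K : R) : (forall k, itg (F k)) ->
  (forall k, J (fun x => `|F k.+1 x - F k x|) <= K / 2 ^+ k) ->
  exists2 G, itg G & J (fun x => `|F k x - G x|) @[k --> \oo] --> (0 : R).
Proof.
move=> iF JF.
pose d k x : \bar R := `|F k.+1 x - F k x|%:E.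
pose D x : \bar R := (`|F 0%N x|%:E + \sum_(k <oo) d k x)%E.
have d0 k x : (0 <= d k x)%E by rewrite lee_fin.
have md k : measurable_fun I (d k).
  by apply/measurable_EFinP; apply: mI_norm; apply: mI_B; exact: itg_m.
have msd : measurable_fun I (fun x => \sum_(k <oo) d k x)%E.
  by apply: ge0_emeasurable_sum => // k x Ix _.
have K0 : 0 <= K.
  by have := JF 0%N; rewrite expr0 divr1; apply: le_trans; exact: J_ge0.
have isd : (\int[mu]_(x in I) (\sum_(k <oo) d k x) <= (2 * K)%:E)%E.
  rewrite (@integral_nneseries _ _ _ mu I measurableI11)//.
  apply: lime_le.
    by apply: is_cvg_nneseries => n _ _; apply: integral_ge0.
  near=> n; rewrite big_mkord.
  apply: (@le_trans _ _ (\sum_(k < n) (K / 2 ^+ k)%:E)%E).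
    apply: lee_sum => k _; rewrite /d EFin_J ?lee_fin//.
    by apply: itg_norm; exact: itgB.
  rewrite sumEFin lee_fin.
  have -> : \sum_(k < n) K / 2 ^+ k = 2 * K - 2 * K / 2 ^+ n.
    elim: (n) => [|m IH]; first by rewrite big_ord0 expr0 divr1 subrr.
    by rewrite big_ord_recr /= IH exprS; field; rewrite expf_neq0.
  by rewrite gerBl divr_ge0 ?mulr_ge0 ?exprn_ge0.
have sd0 x : (0 <= \sum_(k <oo) d k x)%E by apply: nneseries_ge0 => k _ _.
have iD : mu.-integrable I D.
  apply: (@integrableD _ _ _ mu I measurableI11); first by apply: itg_norm.
  apply/integrableP; split => //.
  apply: le_lt_trans (ltry (2 * K)); apply: le_trans isd.
  by rewrite le_eqVlt; apply/orP; left; apply/eqP; apply: eq_integral => x _; rewrite gee0_abs.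
(* The upper limit is defined and measurable everywhere; it is the limit wherever D is finite. *)
pose G x := fine (limn_esup (fun n => (F n x)%:E)).
have mF n : measurable_fun I (EFin \o F n) by apply/measurable_EFinP; exact: itg_m.
have mG : mI G.
  apply: (measurableT_comp (@fine_measurable R setT measurableT)).
  by apply: (measurable_fun_limn_esup mF).
have FD n x : (`|(F n x)%:E| <= D x)%E.
  apply: (@le_trans _ _ (`|F 0%N x|%:E + \sum_(0 <= k < n) d k x)%E); last first.
    by rewrite leeD2l// nneseries_lim_ge// => k _ _.
  rewrite big_mkord sumEFin -EFinD /= lee_fin.
  elim: n => [|n IH]; first by rewrite big_ord0 addr0.
  rewrite big_ord_recr /= addrA -[in leLHS](subrK (F n x) (F n.+1 x)) addrC.
  by rewrite (le_trans (ler_normD _ _))// lerD.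
have cF : {ae mu, forall x, I x -> (EFin \o F n) x @[n --> \oo] --> (EFin \o G) x}.
  have := @integrable_ae _ _ _ mu I measurableI11 _ iD.
  apply: filterS => x H Ix; have {}H := H Ix.
  have [l Fl] : exists l : R, F n x @[n --> \oo] --> l.
    have b n : \sum_(k < n) `|F k.+1 x - F k x| <= fine (D x).
      rewrite -lee_fin fineK// -sumEFin.
      apply: (@le_trans _ _ (`|F 0%N x|%:E + \sum_(0 <= k < n) d k x)%E).
        by rewrite big_mkord leeDr// lee_fin.
      by rewrite leeD2l// nneseries_lim_ge// => k _ _.
    have c1 : cvgn [normed series (fun k => F k.+1 x - F k x)].
      rewrite (_ : [normed _] = fun n => \sum_(k < n) `|F k.+1 x - F k x|); last first.
        by apply/funext => n; rewrite /normed_series_of /series /= big_mkord.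
      apply: nondecreasing_is_cvgn.
        by apply/nondecreasing_seqP => n; rewrite big_ord_recr /= lerDl.
      by exists (fine (D x)) => _ [n _ <-].
    have /cvg_ex[l Hl] := normed_cvg c1.
    exists (F 0%N x + l).
    rewrite (_ : (fun n => F n x) = (fun n => F 0%N x + series (fun k => F k.+1 x - F k x) n)).
      by apply: cvgD => //; exact: cvg_cst.
    apply/funext => n; rewrite /series /= telescope_sumr// addrC subrK//.
  have c : (EFin \o F n) x @[n --> \oo] --> l%:E.
    by apply: cvg_EFin; [by apply: nearW|exact: Fl].
  rewrite /= /G is_cvg_limn_esupE; last by apply/cvg_ex; exists l%:E.
  by move: (c) => /cvg_lim -> //.
have bF : {ae mu, forall x n, I x -> (`|(EFin \o F n) x| <= D x)%E}.
  by apply: aeW => x n Ix; exact: FD.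
have mG' : measurable_fun I (EFin \o G) by exact/measurable_EFinP.
have [iG H _] := @dominated_convergence _ _ R mu I measurableI11 _ _ _ mF mG' cF iD bF.
exists G => //.
by have := fine_cvg H; apply.
Unshelve. all: by end_near. Qed.

End limits.

(** * The function t log^+ t and its duality with the exponential *)

Section young.
Context {R : realType}.
Implicit Types (s t a b : R).

(** This is log^+. Cutting at 1 makes it nonnegative, monotone on the whole line and subadditive
    over products of nonnegative numbers. *)
Definition lnp t : R := ln (Num.max 1 t).
Definition Phi t : R := t * lnp t.

Lemma max1_gt0 t : 0 < Num.max 1 t.
Proof. by rewrite lt_max ltr01. Qed.

Lemma lnp_ge0 t : 0 <= lnp t.
Proof. by rewrite ln_ge0// le_max lexx. Qed.

Lemma le_lnp s t : s <= t -> lnp s <= lnp t.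
Proof.
move=> st; rewrite ler_ln ?posrE ?max1_gt0// ge_max le_max lexx /= le_max st orbT//.
Qed.

Lemma ln_le_lnp t : 0 < t -> ln t <= lnp t.
Proof. by move=> t0; rewrite ler_ln ?posrE ?max1_gt0// le_max lexx orbT. Qed.

Lemma lnp_le1 t : t <= 1 -> lnp t = 0.
Proof. by move=> t1; rewrite /lnp max_l// ln1. Qed.

Lemma lnp_ge1 t : 1 <= t -> lnp t = ln t.
Proof. by move=> t1; rewrite /lnp max_r. Qed.

Lemma lnpM s t : 0 <= s -> 0 <= t -> lnp (s * t) <= lnp s + lnp t.
Proof.
move=> s0 t0; rewrite /lnp -lnM ?posrE ?max1_gt0// ler_ln ?posrE ?mulr_gt0 ?max1_gt0//.
have m1 : 1 <= Num.max 1 s by rewrite le_max lexx.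
have m2 : 1 <= Num.max 1 t by rewrite le_max lexx.
rewrite ge_max -{1}[1]mulr1 !ler_pM// le_max lexx orbT//.
Qed.

Lemma Phi_ge0 t : 0 <= t -> 0 <= Phi t.
Proof. by move=> t0; rewrite mulr_ge0 ?lnp_ge0. Qed.

Lemma le_Phi s t : 0 <= s -> s <= t -> Phi s <= Phi t.
Proof. by move=> s0 st; rewrite ler_pM ?lnp_ge0 ?le_lnp. Qed.

Lemma PhiD s t : 0 <= s -> 0 <= t -> Phi (s + t) <= Phi (2 * s) + Phi (2 * t).
Proof.
move=> s0 t0; have [st|ts] := leP s t.
  apply: (@le_trans _ _ (Phi (2 * t))); first by apply: le_Phi; lra.
  by rewrite lerDr Phi_ge0// mulr_ge0.
apply: (@le_trans _ _ (Phi (2 * s))); first by apply: le_Phi; lra.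
by rewrite lerDl Phi_ge0// mulr_ge0.
Qed.

Lemma PhiM s t : 0 <= s -> 0 <= t -> Phi (s * t) <= s * lnp s * t + s * Phi t.
Proof.
move=> s0 t0; rewrite /Phi; have := lnpM s0 t0.
have : 0 <= s * t by rewrite mulr_ge0.
by move=> ? ?; nra.
Qed.

(** If b <= log^+ a, the first term suffices. Otherwise the excess a (b - log^+ a) is at most max(1,
    a) exp(b - log^+ a) = exp b, because y <= exp y. *)
Lemma young a b : 0 <= a -> a * b <= Phi a + expR b.
Proof.
move=> a0; have [bl|lb] := leP b (lnp a).
  by rewrite (le_trans (ler_wpM2l a0 bl))// lerDl expR_ge0.
rewrite -lerBlDl -mulrBr; set m := Num.max 1 a.
have am : a <= m by rewrite le_max lexx orbT.
have -> : expR b = m * expR (b - lnp a).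
  by rewrite expRB /lnp lnK ?posrE ?max1_gt0// mulrC mulfVK ?gt_eqF ?max1_gt0.
apply: ler_pM => //; first by rewrite subr_ge0 ltW.
by rewrite (le_trans _ (expR_ge1Dx _))// lerDr.
Qed.

Lemma mI_lnp f : mI f -> mI (fun x => lnp (f x)).
Proof. by move=> mf; apply: mI_ln; apply: mI_max => //; exact: mI_cst. Qed.

Lemma mI_Phi f : mI f -> mI (fun x => Phi (f x)).
Proof. by move=> mf; apply: mI_M => //; exact: mI_lnp. Qed.

End young.

(** * Norms tested against polynomials *)

Section duality.
Context {R : realType}.
Implicit Types (f g h : R -> R) (p : {poly R}).
Local Notation I := (I11 R).

Lemma mI_poly p : mI (fun x : R => p.[x]).
Proof. by apply: mI_cont; exact: continuous_horner. Qed.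

Lemma le_of_eps (a b : R) : (forall e, 0 < e -> a <= b + e) -> a <= b.
Proof. by move=> H; apply/ler_addgt0Pr => e e0; exact: H. Qed.

(** The extremal test function is the sign of g; [poly_approx] with weight |g| replaces it by a
    polynomial of the same bound. *)
Lemma J_norm_dual g (c : R) : itg g ->
  (forall p, (forall x, I x -> `|p.[x]| <= 1) -> J (fun x => p.[x] * g x) <= c) ->
  J (fun x => `|g x|) <= c.
Proof.
move=> ig H; apply: le_of_eps => e e0.
pose s x : R := if 0 <= g x then 1 else -1.
have ms : mI s by apply: mI_ifle; [exact: mI_cst|exact: itg_m|exact: mI_cst|exact: mI_cst].
have s1 x : I x -> `|s x| <= 1 by rewrite /s; case: ifP => _; rewrite ?normrN normr1.
have ig' : itg (fun x => `|g x|) by exact: itg_norm.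
have [p p1 pe] := poly_approx e0 ms s1 ig' (fun x _ => normr_ge0 _).
have sg x : s x * g x = `|g x|.
  by rewrite /s; case: (leP 0 (g x)) => g0; [rewrite mul1r ger0_norm|rewrite mulN1r ltr0_norm].
have i1 : itg (fun x => p.[x] * g x) by apply: itgM p1 _ => //; exact: mI_poly.
have i2 : itg (fun x => `|p.[x] - s x| * `|g x|).
  apply: (itgM (M := 1 + 1)) => //; first by apply: mI_norm; apply: mI_B => //; exact: mI_poly.
  by move=> x Ix; rewrite normr_id (le_trans (ler_normB _ _))// lerD ?p1 ?s1.
apply: (@le_trans _ _ (J (fun x => p.[x] * g x + `|p.[x] - s x| * `|g x|))).
  apply: J_le => //; first exact: itgD.
  move=> x Ix; rewrite -{1}sg -lerBlDl -mulrBl (le_trans (ler_norm _))// normrM distrC//.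
by rewrite JD// lerD// H.
Qed.

(* [invw_poly m] increases to [1 / w] on (-1, 1). *)
Fixpoint invw_poly (m : nat) : {poly R} :=
  if m is k.+1 then invw_poly k + 2^-1 *: (1 - (1 - 'X ^+ 2) * invw_poly k ^+ 2) else 0.

(** The iteration involves w only through w^2 = 1 - x^2, so it stays polynomial. Its error satisfies
    e' = e (1 - w (2 - e) / 2); for 0 <= e <= 1 each step gains at least the factor 1 - w / 2. *)
Lemma invw_polyP m x : I x -> let e := 1 - w x * (invw_poly m).[x] in
  0 <= e <= (1 - w x / 2) ^+ m.
Proof.
move=> Ix; have w0 := w_gt0 Ix; have w1 := w_le1 x; have w2x := w2 Ix.
elim: m => [|m /= /andP[IH0 IH1]]; first by rewrite /= horner0 mulr0 subr0 expr0 ler01 lexx.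
have le1 : (1 - w x / 2) ^+ m <= 1 by apply: exprn_ile1; lra.
set q := (invw_poly m).[x] in IH0 IH1 *.
have -> : 1 - w x * (invw_poly m + 2^-1 *: (1 - (1 - 'X ^+ 2) * invw_poly m ^+ 2)).[x] =
   (1 - w x * q) * (1 - w x / 2 * (2 - (1 - w x * q))).
  have h1 : (1 : {poly R}).[x] = 1 by rewrite hornerE.
  by rewrite !(hornerD, hornerZ, hornerN, hornerM, horner_exp, hornerX, h1) -/q -w2x; ring.
have e1 : 1 - w x * q <= 1 by exact: le_trans IH1 le1.
apply/andP; split; first by apply: mulr_ge0 => //; nra.
rewrite exprSr; apply: ler_pM => //; nra.
Qed.

(** Allows sine polynomials as the only test functions: w times [p * invw_poly m] keeps the bound of
    p and converges to p. *)
Lemma J_norm_dual_w g (c : R) : itg g ->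
  (forall p, (forall x, I x -> `|w x * p.[x]| <= 1) -> J (fun x => w x * p.[x] * g x) <= c) ->
  J (fun x => `|g x|) <= c.
Proof.
move=> ig H; apply: J_norm_dual => // p p1.
have wq m x : I x -> `|w x * (invw_poly m).[x]| <= 1.
  move=> Ix; have /andP[e0 e1] := invw_polyP m Ix; have w1 := w_le1 x; have w0 := w_gt0 Ix.
  have le1 : (1 - w x / 2) ^+ m <= 1 by apply: exprn_ile1; lra.
  rewrite ler_norml; apply/andP; split; lra.
have c1 : J (fun x => w x * (p * invw_poly m).[x] * g x) @[m --> \oo] --> J (fun x => p.[x] * g x).
  apply: (J_dct (g := fun x => `|g x|)).
  - move=> m; apply: mI_M; last exact: itg_m.
    by apply: mI_M; [exact: mI_w|exact: mI_poly].
  - by apply: mI_M; [exact: mI_poly|exact: itg_m].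
  - move=> x Ix; apply: cvgM; last exact: cvg_cst.
    rewrite (_ : (fun m => _) = (fun m => p.[x] * (w x * (invw_poly m).[x]))); last first.
      by apply/funext => m; rewrite hornerM; ring.
    rewrite -[X in _ --> X]mulr1; apply: cvgM; first exact: cvg_cst.
    have w1 := w_le1 x; have w0 := w_gt0 Ix.
    have c0 : (1 - w x / 2) ^+ m @[m --> \oo] --> (0 : R).
      by apply: cvg_expr; rewrite ger0_norm; lra.
    have c1 : 1 - (1 - w x / 2) ^+ m @[m --> \oo] --> (1 : R).
      by rewrite -[X in _ --> X](subr0 1); apply: cvgB => //; exact: cvg_cst.
    apply: (squeeze_cvgr _ c1 (cvg_cst (1 : R))).
    near=> m; have /andP[? ?] := invw_polyP m Ix; apply/andP; split; lra.
  - exact: itg_norm.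
  - move=> m x Ix; rewrite normrM -[leRHS]mul1r ler_wpM2r// hornerM mulrCA normrM.
    by rewrite -[leRHS]mul1r ler_pM// ?p1 ?wq.
apply: (ler_cvg_to c1 (cvg_cst c)); near=> m; apply: H => x Ix.
by rewrite hornerM mulrCA normrM -[leRHS]mul1r ler_pM// ?p1 ?wq.
Unshelve. all: by end_near. Qed.

(** With p close to a truncation of g, the hypothesis reads int t^2 <= A / 2 + int t^2 / 2 up to
    errors; the integral of the bounded truncation is finite, so half of it is absorbed, and Fatou's
    lemma removes the truncation. The approximation error enters four times, hence e / 4. *)
Lemma J_sqr_dual g (A : R) : itg (fun x => g x / w x) -> mI g ->
  (forall p, J (fun x => p.[x] * (g x / w x)) <= A / 2 + J (fun x => p.[x] ^+ 2 / w x) / 2) ->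
  itg (fun x => g x ^+ 2 / w x) /\ J (fun x => g x ^+ 2 / w x) <= A.
Proof.
move=> ig mg H.
pose t (N : nat) x := if `|g x| <= N%:R then g x else 0.
have mt N : mI (t N).
  by apply: mI_ifle => //; [exact: mI_norm|exact: mI_cst|exact: mI_cst].
have tN N x : `|t N x| <= N%:R by rewrite /t; case: ifP => // _; rewrite normr0.
have tg N x : t N x * g x = t N x ^+ 2.
  by rewrite /t; case: ifP => _; rewrite ?mul0r ?expr2 ?mul0r.
have it2 N : itg (fun x => t N x ^+ 2 / w x).
  apply: (itg_b_rw (M := N%:R ^+ 2)); first exact: mI_X.
  by move=> x _; rewrite normrX lerXn2r ?nnegrE.
apply: (J_fatou it2) => //.
- by move=> n x Ix; rewrite divr_ge0 ?sqr_ge0 ?w_ge0.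
- move=> N; apply: le_of_eps => e e0.
  have e4 : 0 < e / 4 by rewrite divr_gt0.
  (* One weight controls both errors: |g| / w for the linear term, N / w for the quadratic one. *)
  pose gam x := (`|g x| + N%:R) / w x.
  have ia : itg (fun x => `|g x| / w x).
    apply: eq_itg (itg_norm ig) => x Ix.
    by rewrite normrM [`|_^-1|]ger0_norm ?invr_ge0 ?w_ge0.
  have igam : itg gam.
    apply: eq_itg (itgD ia (itgZ N%:R itg_rw.1)) => x _; rewrite /gam mulrDl//.
  have gam0 x : I x -> 0 <= gam x by move=> Ix; rewrite divr_ge0 ?w_ge0 ?addr_ge0.
  have [p pN pe] := poly_approx e4 (mt N) (fun x _ => tN N x) igam gam0.
  have ip : itg (fun x => p.[x] * (g x / w x)) by apply: itgM pN _ => //; exact: mI_poly.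
  have ip2 : itg (fun x => p.[x] ^+ 2 / w x).
    apply: (itg_b_rw (M := N%:R ^+ 2)); first by apply: mI_X; exact: mI_poly.
    by move=> x Ix; rewrite normrX lerXn2r ?nnegrE// pN.
  have ie : itg (fun x => `|p.[x] - t N x| * gam x).
    apply: (itgM (M := N%:R + N%:R)) => //; first by apply: mI_norm; apply: mI_B => //; exact: mI_poly.
    by move=> x Ix; rewrite normr_id (le_trans (ler_normB _ _))// lerD ?pN.
  have h1 : J (fun x => t N x ^+ 2 / w x) <=
      J (fun x => p.[x] * (g x / w x) + `|p.[x] - t N x| * gam x).
    apply: J_le => //; first exact: itgD.
    move=> x Ix; have w0 : 0 <= (w x)^-1 by rewrite invr_ge0 w_ge0.
    rewrite -tg /gam !mulrA -mulrDl ler_wpM2r// mulrDr.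
    have : (t N x - p.[x]) * g x <= `|p.[x] - t N x| * `|g x|.
      by rewrite (le_trans (ler_norm _))// normrM distrC.
    have : 0 <= `|p.[x] - t N x| * N%:R by rewrite mulr_ge0.
    lra.
  have h2 : J (fun x => p.[x] ^+ 2 / w x) <=
      J (fun x => t N x ^+ 2 / w x + 2 * (`|p.[x] - t N x| * gam x)).
    apply: J_le => //; first by apply: itgD => //; exact: itgZ.
    move=> x Ix; have w0 : 0 <= (w x)^-1 by rewrite invr_ge0 w_ge0.
    rewrite /gam !mulrA -mulrDl ler_wpM2r//.
    have h3 : (p.[x] - t N x) * (p.[x] + t N x) <= `|p.[x] - t N x| * (N%:R + N%:R).
      rewrite (le_trans (ler_norm _))// normrM ler_wpM2l//.
      by rewrite (le_trans (ler_normD _ _))// lerD ?pN.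
    have : 0 <= `|p.[x] - t N x| * `|g x| by rewrite mulr_ge0.
    by nra.
  have := H p; move: h1 h2; rewrite !JD//; last exact: itgZ.
  by rewrite JZ//; lra.
- by apply: mI_M; [exact: mI_X|exact: mI_rw].
- move=> x Ix; have [N HN] := ex_nat_ge `|g x|.
  by apply: (cvg_eventually (N := N)) => n /HN gn; rewrite /t gn.
Qed.

End duality.

(** * Zygmund's inequality and the existence of conjugate functions in L^1 *)

Section zygmund.
Context {R : realType}.
Implicit Types (f g h : R -> R) (a b p : {poly R}) (s e : R).
Local Notation I := (I11 R).

(** The class L log L for the measure rho dx, by finiteness of a modular. It is used with rho = 1,
    that is dx, and rho = 1 / w, that is dtheta. *)
Definition zyg (rho h : R -> R) : Prop :=
  [/\ mI h, itg (fun x => `|h x| * rho x) & itg (fun x => Phi `|h x| * rho x)].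

Lemma J_Sa a : J (S a) = pi / 2 * a`_1.
Proof.
have E x : S a x = \sum_(i < size a) a`_i * S 'X^i x.
  rewrite -{1}(coefK a) poly_def S_sum; apply: eq_bigr => i _.
  by rewrite S_Z.
rewrite (eq_J (g := fun x => \sum_(i < size a) a`_i * S 'X^i x))//.
rewrite J_sum => [|i]; last by apply: itgZ; exact: itg_S.
under eq_bigr => i _ do rewrite JZ ?itg_S// J_S.
have [sa|sa] := leqP (size a) 1.
  rewrite [a`_1]nth_default// mulr0 big1// => i _.
  have : (i < 1)%N by exact: leq_trans (ltn_ord i) sa.
  by rewrite ltnS leqn0 => /eqP ->; rewrite !mulr0.
rewrite (bigD1 (Ordinal sa))//= [X in _ + X]big1 => [|i].
  by rewrite addr0; ring.
by rewrite -val_eqE /= => /negbTE ->; rewrite !mulr0.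
Qed.

Section weight.
Variable rho : R -> R.
Hypotheses (mrho : mI rho) (rho_gt0 : forall x, I x -> 0 < rho x).
Hypothesis rho_w : forall x, I x -> w x * rho x <= 1.

Let rho_ge0 x : I x -> 0 <= rho x. Proof. by move=> /rho_gt0/ltW. Qed.

Lemma itg_brho f (M : R) : mI f -> (forall x, I x -> `|f x| <= M) -> itg (fun x => f x * rho x).
Proof.
move=> mf fM; apply: (itg_le (g := fun x => M * (w x)^-1)).
- exact: mI_M.
- move=> x Ix; rewrite normrM (ger0_norm (rho_ge0 Ix)) ler_pM ?rho_ge0 ?fM//.
  by rewrite -div1r ler_pdivlMr ?w_gt0// mulrC rho_w.
- by apply: itgZ; exact: itg_rw.1.
Qed.

Lemma zyg_scale h s : 0 <= s -> zyg rho h -> itg (fun x => Phi (s * `|h x|) * rho x).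
Proof.
move=> s0 [mh i1 i2]; have i3 := itgD (itgZ (s * lnp s) i1) (itgZ s i2).
apply: itg_le i3; first by apply: mI_M => //; apply: mI_Phi; apply: mI_M; [exact: mI_cst|exact: mI_norm].
move=> x Ix; rewrite ger0_norm; last by rewrite mulr_ge0 ?rho_ge0// Phi_ge0// mulr_ge0.
by rewrite (mulrA (s * lnp s)) (mulrA s (Phi _)) -mulrDl ler_wpM2r ?rho_ge0// PhiM.
Qed.

Lemma zyg_le h g : mI g -> (forall x, I x -> `|g x| <= `|h x|) -> zyg rho h -> zyg rho g.
Proof.
move=> mg gh [mh i1 i2]; split=> //.
  apply: itg_le i1; first by apply: mI_M => //; exact: mI_norm.
  by move=> x Ix; rewrite normrM normr_id (ger0_norm (rho_ge0 Ix)) ler_wpM2r ?rho_ge0 ?gh.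
apply: itg_le i2; first by apply: mI_M => //; apply: mI_Phi; exact: mI_norm.
move=> x Ix; rewrite normrM (ger0_norm (rho_ge0 Ix)) ler_wpM2r ?rho_ge0//.
by rewrite ger0_norm ?Phi_ge0// le_Phi// gh.
Qed.

(** Cutting h off where |h| or 1 / w is large makes h / w bounded, hence close to a polynomial p
    with a uniform bound, and w p is a sine polynomial. The scale s is prescribed because smallness
    of the modular at one scale does not give it at another. *)
Lemma zyg_approx h s e : 0 <= s -> 0 < e -> zyg rho h ->
  exists a, [/\ a`_0 = 0, itg (fun x => `|h x - S a x| * rho x),
    J (fun x => `|h x - S a x| * rho x) <= e,
    itg (fun x => Phi (s * `|h x - S a x|) * rho x) &
    J (fun x => Phi (s * `|h x - S a x|) * rho x) <= e].
Proof.
move=> s0 e0 hz; have [mh ih iPh] := hz.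
pose t (N : nat) x := if `|h x| <= N%:R then if (w x)^-1 <= N%:R then h x else 0 else 0.
have mt N : mI (t N).
  by do 2 (apply: mI_ifle => //; try exact: mI_norm; try exact: mI_cst; try exact: mI_rw).
have tN N x : `|t N x| <= N%:R by rewrite /t; case: ifP => // ?; [case: ifP => // _|]; rewrite normr0.
have th N x : `|h x - t N x| <= `|h x|.
  by rewrite /t; case: ifP => ?; [case: ifP => ?|]; rewrite ?subrr ?normr0 ?subr0.
have tw N x : I x -> `|t N x / w x| <= N%:R ^+ 2.
  move=> Ix; rewrite /t; case: ifP => h1; last by rewrite mul0r normr0 sqr_ge0.
  case: ifP => h2; last by rewrite mul0r normr0 sqr_ge0.
  rewrite normrM [`|_^-1|]ger0_norm ?invr_ge0 ?w_ge0// expr2 ler_pM ?invr_ge0 ?w_ge0//.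
have tcvg x : I x -> exists N, forall n, (N <= n)%N -> h x - t n x = 0.
  move=> Ix; have [N1 H1] := ex_nat_ge `|h x|; have [N2 H2] := ex_nat_ge (w x)^-1.
  exists (maxn N1 N2) => n; rewrite geq_max => /andP[/H1 h1 /H2 h2].
  by rewrite /t h1 h2 subrr.
have mht N : mI (fun x => `|h x - t N x|) by apply: mI_norm; exact: mI_B.
have c1 : J (fun x => `|h x - t N x| * rho x) @[N --> \oo] --> J (fun=> 0 : R).
  apply: (J_dct (g := fun x => `|h x| * rho x)) => //.
  - by move=> n; exact: mI_M.
  - exact: mI_cst.
  - move=> x /tcvg[N HN]; apply: (cvg_eventually (N := N)) => n /HN ->.
    by rewrite normr0 mul0r.
  - move=> n x Ix; rewrite normrM normr_id (ger0_norm (rho_ge0 Ix)) ler_wpM2r ?rho_ge0//.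
have i2s := zyg_scale (mulr_ge0 (ler0n _ 2) s0) hz.
have c2 : J (fun x => Phi (2 * s * `|h x - t N x|) * rho x) @[N --> \oo] --> J (fun=> 0 : R).
  apply: J_dct i2s _ => //.
  - move=> n; apply: mI_M => //; apply: mI_Phi; apply: mI_M => //; exact: mI_cst.
  - exact: mI_cst.
  - move=> x /tcvg[N HN]; apply: (cvg_eventually (N := N)) => n /HN ->.
    by rewrite normr0 mulr0 /Phi !mul0r.
  - move=> n x Ix; rewrite normrM (ger0_norm (rho_ge0 Ix)) ler_wpM2r ?rho_ge0//.
    have ? : 0 <= 2 * s by rewrite mulr_ge0.
    by rewrite ger0_norm ?Phi_ge0 ?mulr_ge0// le_Phi ?mulr_ge0// ler_wpM2l.
have e2 : 0 < e / 2 by rewrite divr_gt0.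
rewrite J0 in c1 c2.
have [N1 HN1] := cvg_ex_le c1 e2; have [N2 HN2] := cvg_ex_le c2 e2.
pose N := maxn N1 N2.
have {HN1} := HN1 N (leq_maxl _ _); rewrite subr0 => /(le_trans (ler_norm _)) J1.
have {HN2} := HN2 N (leq_maxr _ _); rewrite subr0 => /(le_trans (ler_norm _)) J2.
have it1 : itg (fun x => `|h x - t N x| * rho x).
  apply: itg_le ih; first exact: mI_M.
  by move=> x Ix; rewrite normrM normr_id (ger0_norm (rho_ge0 Ix)) ler_wpM2r ?rho_ge0.
have it2 : itg (fun x => Phi (2 * s * `|h x - t N x|) * rho x).
  apply: itg_le i2s; first by apply: mI_M => //; apply: mI_Phi; apply: mI_M => //; exact: mI_cst.
  move=> x Ix; rewrite normrM (ger0_norm (rho_ge0 Ix)) ler_wpM2r ?rho_ge0//.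
  have ? : 0 <= 2 * s by rewrite mulr_ge0.
  by rewrite ger0_norm ?Phi_ge0 ?mulr_ge0// le_Phi ?mulr_ge0// ler_wpM2l.
pose B : R := N%:R ^+ 2.
(* On [0, 2 B] the function Phi (2 s y) is at most L y, so smallness in L^1 gives smallness of the
   modular. *)
pose L := 2 * s * lnp (2 * s * (2 * B)).
have B0 : 0 <= B by rewrite sqr_ge0.
have L0 : 0 <= L by rewrite mulr_ge0 ?lnp_ge0 ?mulr_ge0.
have eL : 0 < e / 2 / (L + 1) by rewrite divr_gt0// ltr_wpDl.
have mtw : mI (fun x => t N x / w x) by apply: mI_M => //; exact: mI_rw.
have mrw : mI (fun x => w x * rho x) by apply: mI_M => //; exact: mI_w.
have irw : itg (fun x => w x * rho x).
  apply: (itg_bd (M := 1)) => // x Ix; rewrite ger0_norm ?mulr_ge0 ?w_ge0 ?rho_ge0//.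
  exact: rho_w.
have [p pB pe] := poly_approx eL mtw (tw N) irw (fun x Ix => mulr_ge0 (w_ge0 x) (rho_ge0 Ix)).
have [a a0 Sa] := poly_wS p.
have dE x : I x -> `|t N x - S a x| = w x * `|p.[x] - t N x / w x|.
  move=> Ix; rewrite Sa// -{2}(ger0_norm (w_ge0 x)) -normrM distrC; congr `|_|.
  by field; exact: w_neq0.
have dB x : I x -> `|t N x - S a x| <= 2 * B.
  move=> Ix; rewrite dE// -[leRHS]mul1r ler_pM ?w_ge0 ?w_le1//.
  by rewrite (le_trans (ler_normB _ _))// mulr2n mulrDl mul1r lerD ?pB ?tw.
have mta : mI (fun x => `|t N x - S a x|) by apply: mI_norm; apply: mI_B => //; exact: mI_S.
have it3 : itg (fun x => `|t N x - S a x| * rho x).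
  by apply: (itg_brho (M := 2 * B)) => // x Ix; rewrite normr_id dB.
have J3 : J (fun x => `|t N x - S a x| * rho x) <= e / 2 / (L + 1).
  rewrite (le_trans _ pe)// le_eqVlt; apply/orP; left; apply/eqP; apply: eq_J => x Ix.
  by rewrite dE//; ring.
have J3' : J (fun x => `|t N x - S a x| * rho x) <= e / 2.
  by rewrite (le_trans J3)// ler_pdivrMr ?ltr_wpDl// ler_peMr ?(ltW e2)// lerDr.
have ms : mI (fun x => `|h x - S a x|) by apply: mI_norm; apply: mI_B => //; exact: mI_S.
have tri x : `|h x - S a x| <= `|h x - t N x| + `|t N x - S a x| by exact: ler_distD.
have i1' := itgD it1 it3.
have i1 : itg (fun x => `|h x - S a x| * rho x).
  apply: itg_le i1'; first exact: mI_M.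
  by move=> x Ix; rewrite normrM normr_id (ger0_norm (rho_ge0 Ix)) -mulrDl ler_wpM2r ?rho_ge0.
have PB x : I x -> Phi (s * `|h x - S a x|) * rho x <=
    Phi (2 * s * `|h x - t N x|) * rho x + L * (`|t N x - S a x| * rho x).
  move=> Ix; rewrite mulrA -mulrDl ler_wpM2r ?rho_ge0//.
  apply: (@le_trans _ _ (Phi (s * `|h x - t N x| + s * `|t N x - S a x|))).
    by rewrite le_Phi ?mulr_ge0// -mulrDr ler_wpM2l.
  rewrite (le_trans (PhiD _ _)) ?mulr_ge0// !mulrA lerD2l.
  rewrite /Phi (mulrAC (2 * s)) /L; apply: ler_wpM2r => //; apply: ler_wpM2l.
    by rewrite mulr_ge0.
  by apply: le_lnp; rewrite ler_wpM2l ?mulr_ge0// dB.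
have i2' := itgD it2 (itgZ L it3).
have i2 : itg (fun x => Phi (s * `|h x - S a x|) * rho x).
  apply: itg_le i2'; first by apply: mI_M => //; apply: mI_Phi; apply: mI_M => //; exact: mI_cst.
  by move=> x Ix; rewrite ger0_norm ?PB// mulr_ge0 ?rho_ge0// Phi_ge0// mulr_ge0.
exists a; split => //.
  apply: (@le_trans _ _ (J (fun x => `|h x - t N x| * rho x + `|t N x - S a x| * rho x))).
    by apply: J_le => // x Ix; rewrite -mulrDl ler_wpM2r ?rho_ge0.
  by rewrite JD// [leRHS]splitr lerD.
apply: (@le_trans _ _ (J (fun x => Phi (2 * s * `|h x - t N x|) * rho x +
    L * (`|t N x - S a x| * rho x)))); first exact: J_le.
rewrite JD//; last exact: itgZ.
rewrite JZ// [leRHS]splitr lerD// (le_trans (ler_wpM2l L0 J3))// mulrCA ler_piMr ?(ltW e2)//.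
by rewrite ler_pdivrMr ?ltr_wpDl// mul1r lerDl.
Qed.

(** Proved below for both weights as [bound_1] and [bound_w]. The free scale s does here what
    homogeneity does for a norm inequality. *)
Hypothesis bound : forall a s, a`_0 = 0 -> 0 < s ->
  s * J (fun x => `|C a x| * rho x) <= J (fun x => Phi (6 * s * `|S a x|) * rho x) + 16.

(** Sine polynomials approach h at faster and faster scales, and [bound] at s = 2^k applied to
    consecutive differences gives 2^k ||C d|| <= 1 + 1 + 16. The cosine parts thus converge
    geometrically in L^1, and their limit up to sign is the conjugate. *)
Lemma conjugate_exists h : zyg rho h -> exists G (a : nat -> {poly R}),
  [/\ mI G, itg (fun x => G x * rho x), forall k, (a k)`_0 = 0,
    J (fun x => `|S (a k) x * rho x - h x * rho x|) @[k --> \oo] --> (0 : R) &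
    J (fun x => `|C (a k) x * rho x + G x * rho x|) @[k --> \oo] --> (0 : R)].
Proof.
move=> hz; have [mh ih iPh] := hz.
have e0 k : 0 < (2 ^+ k)^-1 :> R by rewrite invr_gt0 exprn_gt0.
(* The scale must dominate 2 * 6 * 2^k: the 6 comes from [bound], the 2 from splitting the
   difference by [PhiD]. *)
have s0 k : 0 <= 24 * 2 ^+ k :> R by rewrite mulr_ge0 ?exprn_ge0.
pose a k := projT1 (cid (zyg_approx (s0 k) (e0 k) hz)).
have aP k := projT2 (cid (zyg_approx (s0 k) (e0 k) hz)); rewrite -/(a _) in aP.
have a0 k : (a k)`_0 = 0 by have [] := aP k.
have iC k : itg (fun x => - C (a k) x * rho x).
  have [M _ HM] := CS_bounded (a k).
  by apply: (itg_brho (M := M)) => [|x /HM[]]; [apply: mI_N; exact: mI_C|rewrite normrN].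
have dJ k : J (fun x => `|- C (a k.+1) x * rho x - - C (a k) x * rho x|) <= 18 / 2 ^+ k.
  have [_ _ _ i1 J1] := aP k; have [_ _ _ i2 J2] := aP k.+1.
  have k0 : (0 : R) < 2 ^+ k by rewrite exprn_gt0.
  pose d := a k.+1 - a k.
  have d0 : d`_0 = 0 by rewrite coefB !a0 subrr.
  have H := bound d0 k0.
  rewrite (eq_J (g := fun x => `|C d x| * rho x)); last first.
    move=> x Ix; rewrite -mulrBl normrM (ger0_norm (rho_ge0 Ix)) C_B -normrN; congr (`|_| * _).
    by ring.
  rewrite ler_pdivlMr// mulrC (le_trans H)// (_ : 18 = 2 + 16 :> R); last by ring.
  rewrite lerD2r; have i3 := itgD i1 i2.
  have pw x : I x -> Phi (6 * 2 ^+ k * `|S d x|) * rho x <=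
      Phi (24 * 2 ^+ k * `|h x - S (a k) x|) * rho x +
      Phi (24 * 2 ^+ k.+1 * `|h x - S (a k.+1) x|) * rho x.
    move=> Ix; rewrite -mulrDl ler_wpM2r ?rho_ge0//.
    pose A : R := `|h x - S (a k) x|; pose B : R := `|h x - S (a k.+1) x|; rewrite -/A -/B.
    have dAB : `|S d x| <= A + B.
      rewrite S_B /A /B (le_trans (ler_distD (h x) _ _))// addrC lerD// distrC//.
    apply: (@le_trans _ _ (Phi (6 * 2 ^+ k * A + 6 * 2 ^+ k * B))).
      by rewrite le_Phi ?mulr_ge0 ?exprn_ge0// -mulrDr ler_wpM2l// mulr_ge0 ?exprn_ge0.
    have A0 : 0 <= A by exact: normr_ge0.
    have B0 : 0 <= B by exact: normr_ge0.
    have hA : 0 <= 6 * 2 ^+ k * A by rewrite !mulr_ge0 ?exprn_ge0.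
    have hB : 0 <= 6 * 2 ^+ k * B by rewrite !mulr_ge0 ?exprn_ge0.
    apply: (le_trans (PhiD hA hB)); apply: lerD.
      rewrite le_Phi ?mulr_ge0 ?exprn_ge0// !mulrA ler_wpM2r// ler_wpM2r ?exprn_ge0//; lra.
    rewrite le_Phi ?mulr_ge0 ?exprn_ge0// !mulrA ler_wpM2r// exprS mulrA ler_wpM2r ?exprn_ge0//; lra.
  apply: (@le_trans _ _ (1 + 1)); last by lra.
  apply: (@le_trans _ _ (J (fun x => Phi (24 * 2 ^+ k * `|h x - S (a k) x|) * rho x +
      Phi (24 * 2 ^+ k.+1 * `|h x - S (a k.+1) x|) * rho x))).
    apply: J_le => //; apply: itg_le i3; first last.
      by move=> x Ix; rewrite ger0_norm ?pw// mulr_ge0 ?rho_ge0// Phi_ge0// !mulr_ge0 ?exprn_ge0.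
    apply: mI_M => //; apply: mI_Phi; apply: mI_M; first exact: mI_cst.
    by apply: mI_norm; exact: mI_S.
  rewrite JD// lerD//.
    by rewrite (le_trans J1)// invf_le1 ?exprn_gt0// exprn_ege1// ler1n.
  by rewrite (le_trans J2)// invf_le1 ?exprn_gt0// exprn_ege1// ler1n.
have [G iG GJ] := L1_complete iC dJ.
exists (fun x => G x / rho x), a; split => //.
- by apply: mI_M; [exact: itg_m|exact: mI_V].
- by apply: eq_itg iG => x Ix; rewrite divfK// gt_eqF// rho_gt0.
- have cv : ((2 ^+ k)^-1 : R) @[k --> \oo] --> (0 : R).
    rewrite (_ : (fun k => _) = (fun k => (2^-1) ^+ k)); last by apply/funext => k; rewrite exprVn.
    by apply: cvg_expr; rewrite ger0_norm; lra.
  apply: (squeeze_cvgr _ (cvg_cst (0 : R)) cv).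
  near=> k; rewrite J_ge0//=; have [_ _ J1 _ _] := aP k; rewrite (le_trans _ J1)//.
  rewrite le_eqVlt; apply/orP; left; apply/eqP; apply: eq_J => x Ix.
  by rewrite -mulrBl normrM (ger0_norm (rho_ge0 Ix)) distrC.
- rewrite (_ : (fun k => _) = (fun k => J (fun x => `|- C (a k) x * rho x - G x|)))//.
  apply/funext => k; apply: eq_J => x Ix; rewrite divfK ?gt_eqF ?rho_gt0//.
  by rewrite -normrN opprD mulNr.
Unshelve. all: by end_near. Qed.

End weight.

Lemma itg_bM (f g : R -> R) : mI f -> (exists M, forall x, I x -> `|f x| <= M) -> itg g ->
  itg (fun x => f x * g x).
Proof. by move=> mf [M fM] ig; exact: itgM mf fM ig. Qed.

(** The sum of the two integrands is [S (a * b)], whose integral in dx sees only the coefficient of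
    order 1; that vanishes when both constant terms do. *)
Lemma CaSb_parseval a b : a`_0 = 0 -> b`_0 = 0 ->
  J (fun x => C a x * S b x) = - J (fun x => S a x * C b x).
Proof.
move=> a0 b0; have [Ma _ HMa] := CS_bounded a; have [Mb _ HMb] := CS_bounded b.
apply/eqP; rewrite -subr_eq0 opprK -JD.
- apply/eqP; transitivity (J (S (a * b))); first by apply: eq_J => x _; rewrite S_M.
  rewrite J_Sa coefM big_ord_recl big_ord1 /= a0 mul0r add0r /bump /= b0 mulr0 mulr0//.
- by apply: itg_bM; [exact: mI_C|exists Ma => x /HMa[]|exact: itg_S].
- by apply: itg_bM; [exact: mI_S|exists Ma => x /HMa[]|exact: itg_C].
Qed.

(** The difference of the two sides is the mean of [C (a * b)], a multiple of the product of the
    constant terms. *)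
Lemma CaCb_parseval a b : a`_0 = 0 ->
  J (fun x => C a x * C b x / w x) = J (fun x => S a x * S b x / w x).
Proof.
move=> a0; have [Ma _ HMa] := CS_bounded a; have [Mb _ HMb] := CS_bounded b.
apply/eqP; rewrite -subr_eq0 -JB.
- apply/eqP; transitivity (J (fun x => C (a * b) x / w x)).
    by apply: eq_J => x _; rewrite C_M mulrBl.
  by rewrite J_C coefM big_ord1 /= a0 mul0r mulr0.
- apply: (eq_itg (f := fun x => C a x * (C b x / w x))) => [x _|]; first by rewrite mulrA.
  by apply: itg_bM; [exact: mI_C|exists Ma => x /HMa[]|exact: itg_Crw].
- apply: (eq_itg (f := fun x => S a x * (S b x / w x))) => [x _|]; first by rewrite mulrA.
  by apply: itg_bM; [exact: mI_S|exists Ma => x /HMa[]|exact: itg_Srw].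
Qed.

(** Young's inequality for the factors 6 s |h| and |v| / 6, where 6 is the scale at which conjugates
    of functions bounded by 1 are exponentially integrable. *)
Lemma J_young (rho h u v : R -> R) s : 0 < s -> mI rho -> mI h -> mI v ->
  (forall x, I x -> 0 <= rho x) ->
  itg (fun x => Phi (6 * s * `|h x|) * rho x) ->
  itg (fun x => expR (`|v x| / 6) * rho x) ->
  J (fun x => expR (`|v x| / 6) * rho x) <= 16 ->
  itg (fun x => u x * rho x) -> (forall x, I x -> u x <= `|h x| * `|v x|) ->
  s * J (fun x => u x * rho x) <= J (fun x => Phi (6 * s * `|h x|) * rho x) + 16.
Proof.
move=> s0 mrho mh mv rho0 i1 i2 J2 iu uh.
rewrite -JZ//; apply: (@le_trans _ _ (J (fun x => Phi (6 * s * `|h x|) * rho x +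
   expR (`|v x| / 6) * rho x))); last by rewrite JD// lerD2l.
apply: J_le; [exact: itgZ|exact: itgD|move=> x Ix].
rewrite mulrA -mulrDl ler_wpM2r ?rho0//.
have p0 : 0 <= 6 * s * `|h x| by rewrite !mulr_ge0// ltW.
have := young (`|v x| / 6) p0; apply: le_trans.
rewrite (_ : 6 * s * `|h x| * (`|v x| / 6) = s * (`|h x| * `|v x|)); last by field.
by rewrite ler_pM2l// uh.
Qed.

Lemma itg_PhiS (rho : R -> R) a s : 0 <= s -> mI rho -> (forall x, I x -> 0 < rho x) ->
  (forall x, I x -> w x * rho x <= 1) -> itg (fun x => Phi (s * `|S a x|) * rho x).
Proof.
move=> s0 mrho r0 r1; have [M M0 HM] := CS_bounded a.
apply: (itg_brho mrho r0 r1 (f := fun x => Phi (s * `|S a x|)) (M := Phi (s * M))).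
  by apply: mI_Phi; apply: mI_M; [exact: mI_cst|apply: mI_norm; exact: mI_S].
move=> x Ix; rewrite ger0_norm ?Phi_ge0 ?mulr_ge0// le_Phi ?mulr_ge0// ler_wpM2l//.
by case: (HM x Ix).
Qed.

Lemma rho1_w x : I x -> w x * 1 <= 1 :> R.
Proof. by rewrite mulr1 w_le1. Qed.

Lemma rhow_w x : I x -> w x * (w x)^-1 <= 1 :> R.
Proof. by move=> Ix; rewrite divff// w_neq0. Qed.

Lemma rhow_gt0 x : I x -> 0 < (w x)^-1 :> R.
Proof. by move=> Ix; rewrite invr_gt0 w_gt0. Qed.

(* Zygmund's inequality, by duality: a test polynomial p gives a sine polynomial
   [w p = S b] bounded by 1, whose conjugate [C b] is exponentially integrable. *)
Lemma bound_1 a s : a`_0 = 0 -> 0 < s ->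
  s * J (fun x => `|C a x| * 1) <= J (fun x => Phi (6 * s * `|S a x|) * 1) + 16.
Proof.
move=> a0 s0; rewrite mulrC -ler_pdivlMr// (eq_J (g := fun x => `|C a x|)); last by move=> x _; rewrite mulr1.
apply: J_norm_dual_w => [|p p1]; first exact: itg_C.
have [b b0 Sb] := poly_wS p.
have b1 x : I x -> `|S b x| <= 1 by move=> Ix; rewrite Sb// p1.
have [iE JE] := J_exp_C b0 b1.
have iE1 : itg (fun x => expR (`|C b x| / 6) * 1).
  apply: itg_le iE => [|x Ix].
    apply: mI_M; last exact: mI_cst.
    by apply: mI_exp; apply: mI_M; [apply: mI_norm; exact: mI_C|exact: mI_cst].
  rewrite mulr1 ger0_norm ?expR_ge0// -[leLHS]mulr1 ler_wpM2l ?expR_ge0//.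
  by rewrite invf_ge1 ?w_gt0// w_le1.
have JE1 : J (fun x => expR (`|C b x| / 6) * 1) <= 16.
  apply: le_trans JE; apply: J_le => // x Ix; rewrite ler_wpM2l ?expR_ge0//.
  by rewrite invf_ge1 ?w_gt0// w_le1.
have [Mb _ HMb] := CS_bounded b.
rewrite (eq_J (g := fun x => C a x * S b x)); last by move=> x Ix; rewrite Sb// mulrC.
rewrite CaSb_parseval//; have iSC : itg (fun x => S a x * C b x).
  apply: (eq_itg (f := fun x => C b x * S a x)) => [x _|]; first by rewrite mulrC.
  by apply: itg_bM; [exact: mI_C|exists Mb => x /HMb[]|exact: itg_S].
rewrite -JN// ler_pdivlMr// mulrC.
rewrite (eq_J (g := fun x => - (S a x * C b x) * 1)); last by move=> x _; rewrite mulr1.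
have m1 : mI (fun=> 1 : R) by exact: mI_cst.
apply: (J_young (v := C b)) => //.
- exact: mI_S.
- exact: mI_C.
- apply: itg_PhiS => //; first by rewrite mulr_ge0// ltW.
  exact: rho1_w.
- by apply: eq_itg (itgN iSC) => x _; rewrite mulr1.
- by move=> x _; rewrite -normrM -normrN; exact: ler_norm.
Qed.

(** In dtheta the test polynomial is itself a cosine polynomial [C b] bounded by 1, with an
    arbitrary mean; its conjugate [S b] is controlled by [J_exp_S]. *)
Lemma bound_w a s : a`_0 = 0 -> 0 < s ->
  s * J (fun x => `|C a x| * (w x)^-1) <= J (fun x => Phi (6 * s * `|S a x|) * (w x)^-1) + 16.
Proof.
move=> a0 s0; rewrite mulrC -ler_pdivlMr//.
rewrite (eq_J (g := fun x => `|C a x / w x|)); last first.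
  by move=> x Ix; rewrite normrM [`|_^-1|]ger0_norm// invr_ge0 w_ge0.
apply: J_norm_dual => [|p p1]; first exact: itg_Crw.
have [b Cb] := poly_C p.
have b1 x : I x -> `|C b x| <= 1 by move=> Ix; rewrite Cb// p1.
have [iE JE] := J_exp_S b1.
have [Mb _ HMb] := CS_bounded b.
rewrite (eq_J (g := fun x => C a x * C b x / w x)); last first.
  by move=> x Ix; rewrite Cb// mulrA [p.[x] * _]mulrC.
rewrite CaCb_parseval// ler_pdivlMr// mulrC.
apply: (J_young (v := S b)) => //.
- exact: mI_rw.
- exact: mI_S.
- exact: mI_S.
- by move=> x /rhow_gt0/ltW.
- apply: itg_PhiS; [by rewrite mulr_ge0// ltW|exact: mI_rw|exact: rhow_gt0|exact: rhow_w].
- apply: (eq_itg (f := fun x => S b x * (S a x / w x))) => [x _|]; first by ring.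
  by apply: itg_bM; [exact: mI_S|exists Mb => x /HMb[]|exact: itg_Srw].
- by move=> x _; rewrite -normrM ler_norm.
Qed.

(* [conj_pair f G]: G is the finite Hilbert transform of f, tested against the
   functions [S 'X^n = sin (n arccos x)], whose transform is [- cos (n arccos x)]. *)
Definition conj_pair (f G : R -> R) : Prop :=
  [/\ itg f, itg G & forall n, J (fun x => S 'X^(n.+1) x * G x) = J (fun x => C 'X^(n.+1) x * f x)].

Theorem conj_pair_exists f : zyg (fun=> 1) f -> exists G, conj_pair f G.
Proof.
move=> fz; have [mf if1 _] := fz.
have [] := @conjugate_exists (fun=> 1) (mI_cst 1) (fun _ _ => ltr01) (@rho1_w) bound_1 f fz.
move=> G [a [mG iG a0 aS aC]].
have if' : itg f.
  by apply: itg_le if1 => // x _; rewrite mulr1.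
have iG' : itg G by apply: eq_itg iG => x _; rewrite mulr1.
exists G; split => // n.
have SX1 x : I x -> `|S 'X^(n.+1) x| <= 1 :> R by exact: S_le1.
have CX1 x : I x -> `|C 'X^(n.+1) x| <= 1 :> R by exact: C_le1.
have cS : J (fun x => C 'X^(n.+1) x * S (a k) x) @[k --> \oo] --> J (fun x => C 'X^(n.+1) x * f x).
  apply: (J_lim (M := 1)) => //; first by move=> k; exact: itg_S.
    exact: mI_C.
  apply: cvg_trans aS; apply: near_eq_cvg; near=> k.
  by apply: eq_J => x _; rewrite !mulr1.
have cC : J (fun x => S 'X^(n.+1) x * - C (a k) x) @[k --> \oo] --> J (fun x => S 'X^(n.+1) x * G x).
  apply: (J_lim (M := 1)) => //; first by move=> k; apply: itgN; exact: itg_C.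
    exact: mI_S.
  apply: cvg_trans aC; apply: near_eq_cvg; near=> k.
  by apply: eq_J => x _; rewrite !mulr1 -normrN opprD.
apply: (cvg_unique _ cC) => //; apply: cvg_trans cS; apply: near_eq_cvg; near=> k.
have X0 : ('X^(n.+1) : {poly R})`_0 = 0 by rewrite coefXn.
rewrite [RHS](eq_J (g := fun x => - (C (a k) x * S 'X^(n.+1) x))); last by move=> x _; ring.
rewrite JN; last by apply: itg_bM; [exact: mI_C|have [M _ HM] := CS_bounded (a k); exists M => x /HM[]|exact: itg_S].
by rewrite (CaSb_parseval (a0 k) X0) opprK; apply: eq_J => x _; rewrite mulrC.
Unshelve. all: by end_near. Qed.

Theorem conj_exists_w h : zyg (fun x => (w x)^-1) h -> exists G,
  [/\ mI G, itg (fun x => G x / w x) &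
    forall b, J (fun x => C b x * (G x / w x)) = - J (fun x => S b x * (h x / w x))].
Proof.
move=> hz; have [mh ih1 _] := hz.
have [] := @conjugate_exists (fun x => (w x)^-1) mI_rw rhow_gt0 rhow_w bound_w h hz.
move=> G [a [mG iG a0 aS aC]].
have ih : itg (fun x => h x / w x).
  apply: itg_le ih1; first by apply: mI_M => //; exact: mI_rw.
  by move=> x Ix; rewrite normrM [`|_^-1|]ger0_norm// invr_ge0 w_ge0.
exists G; split => // b; have [M _ HM] := CS_bounded b.
have cS : J (fun x => S b x * (S (a k) x / w x)) @[k --> \oo] --> J (fun x => S b x * (h x / w x)).
  apply: (J_lim (M := M)) => //; first by move=> k; exact: itg_Srw.
    exact: mI_S.
  by move=> x /HM[].
have cC : J (fun x => C b x * (- C (a k) x / w x)) @[k --> \oo] --> J (fun x => C b x * (G x / w x)).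
  apply: (J_lim (M := M)) => //.
  - by move=> k; apply: eq_itg (itgN (itg_Crw (a k))) => x _; rewrite mulNr.
  - exact: mI_C.
  - by move=> x /HM[].
  - apply: cvg_trans aC; apply: near_eq_cvg; near=> k.
    by apply: eq_J => x _; rewrite -normrN; congr `|_|; ring.
apply: (cvg_unique _ cC) => //; apply: cvg_trans (cvgN cS); apply: near_eq_cvg; near=> k.
change (- J (fun x => S b x * (S (a k) x / w x)) = J (fun x => C b x * (- C (a k) x / w x))).
rewrite (eq_J (f := fun x => S b x * _) (g := fun x => S (a k) x * S b x / w x)); last by move=> x _; ring.
rewrite -CaCb_parseval// -JN; first by apply: eq_J => x _; ring.
apply: (eq_itg (f := fun x => C b x * (C (a k) x / w x))) => [x _|]; first by ring.
by apply: itg_bM; [exact: mI_C|exists M => x /HM[]|exact: itg_Crw].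
Unshelve. all: by end_near. Qed.

End zygmund.

(** * Lebesgue points and Poisson integrals *)

Section lebesgue_points.
Context {R : realType}.
Implicit Types (f g phi : R -> R) (t x e d r : R).
Local Notation mu := (@lebesgue_measure R).
Local Notation I := (I11 R).

Definition leb_point f t := forall eta, 0 < eta -> exists2 r0, 0 < r0 &
  forall r, 0 < r < r0 -> J (fun x => if `|x - t| < r then `|f x - f t| else 0) <= eta * r.

Lemma mI_dist t : mI (fun x => `|x - t|).
Proof. by apply: mI_norm; apply: mI_B; [exact: mI_id|exact: mI_cst]. Qed.

Lemma ae_leb_point f : itg f -> {ae mu, forall t, I t -> leb_point f t}.
Proof.
move=> fi; pose F := f \_ I.
have iF : mu.-integrable setT (EFin \o F).
  by rewrite /F -restrict_EFin; exact: ((@integrable_mkcond _ _ _ mu I (EFin \o f) measurableI11).1 fi).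
have lF : locally_integrable setT F by apply: open_integrable_locally => //; exact: openT.
have [N [mN N0 sub]] := lebesgue_differentiation lF.
exists N; split=> // t /= nP; apply: sub => /= Lt; apply: nP => It eta eta0 {N mN N0}.
(* The ball has length 2 r, while [leb_point] asks for the bound eta r. *)
have e2 : (0 < (eta / 2)%:E)%E by rewrite lte_fin divr_gt0.
have H : \forall r \near 0^'+, (davg F t r < (eta / 2)%:E)%E.
  apply: (Lt [set y | (y < (eta / 2)%:E)%E]); apply: open_nbhs_nbhs; split=> //.
  exact: open_ereal_lt_ereal.
move: H; rewrite near_withinE => /nbhs_ballP[r0 /= r00 H].
exists r0 => // r /andP[rp rr0].
have {}H : (davg F t r < (eta / 2)%:E)%E.
  by apply: H => //; rewrite /ball /= sub0r normrN gtr0_norm.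
have FE y : I y -> F y = f y by move=> Iy; rewrite /F patchE mem_set.
have mift (g : R -> R) : mI g -> mI (fun x => if `|x - t| < r then g x else 0).
  by move=> mg; apply: mI_iflt => //; [exact: mI_dist|exact: mI_cst|exact: mI_cst].
have ii : itg (fun x => if `|x - t| < r then `|f x - f t| else 0).
  apply: (itg_le (g := fun x => `|f x - f t|)).
  - by apply: mift; apply: mI_norm; apply: mI_B; [exact: itg_m|exact: mI_cst].
  - by move=> x Ix; case: ifP => _; rewrite ?normr_id// normr0.
  - by apply: itg_norm; apply: itgB => //; exact: itg_cst.
rewrite -lee_fin -EFin_J//.
have mB : measurable (ball t r : set R) by exact: measurable_ball.
have mFt : measurable_fun setT (fun y => `|(F y - F t)%:E|%E).
  apply/measurable_EFinP; apply: measurableT_comp => //; apply: measurable_funB => //.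
  by case/integrableP: iF => /measurable_EFinP.
apply: (@le_trans _ _ (\int[mu]_(y in ball t r) `|(F y - F t)%:E|)%E); last first.
  move: H; rewrite /davg /iavg lebesgue_measure_ball; last exact: ltW.
  rewrite inver mulrn_eq0/= (gt_eqF rp).
  move/ltW; rewrite lee_pdivrMl ?mulrn_wgt0// -EFinM => /le_trans; apply.
  by rewrite lee_fin -mulr_natr le_eqVlt; apply/orP; left; apply/eqP; field.
rewrite (_ : (\int[mu]_(x in I) _)%E = (\int[mu]_(y in I `&` ball t r) `|(F y - F t)%:E|)%E).
  have mIB : measurable (I `&` ball t r : set R) by exact: measurableI.
  apply: (@ge0_subset_integral _ _ _ mu _ _ mIB mB) => //.
  exact: measurable_funTS.
rewrite integral_mkcondr; apply: eq_integral => x; rewrite inE => Ix.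
rewrite patchE; case: ifPn => xt.
  by rewrite mem_set ?FE// /ball /= distrC.
rewrite memNset// /ball /= distrC; exact/negP.
Qed.

Lemma J_ball_le t r : 0 < r -> J (fun x => if `|x - t| < r then 1 else 0) <= 2 * r.
Proof.
move=> r0.
have ii : itg (fun x => if `|x - t| < r then 1 else 0).
  apply: (itg_bd (M := 1)) => [|x _]; last by case: ifP; rewrite ?normr1 ?normr0.
  by apply: mI_iflt; [exact: mI_dist|exact: mI_cst|exact: mI_cst|exact: mI_cst].
rewrite -lee_fin -EFin_J//.
rewrite (_ : (\int[mu]_(x in I) _)%E = (\int[mu]_(y in I `&` ball t r) (1 : R)%:E)%E); last first.
  rewrite integral_mkcondr; apply: eq_integral => x _; rewrite patchE; case: ifPn => xt.
    by rewrite mem_set// /ball /= distrC.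
  rewrite memNset// /ball /= distrC; exact/negP.
have mB : measurable (ball t r : set R) by exact: measurable_ball.
have mIB : measurable (I `&` ball t r : set R) by exact: measurableI.
rewrite (@integral_cst _ _ _ mu _ mIB) mul1e.
apply: (@le_trans _ _ (mu (ball t r))).
  by apply: le_measure; rewrite ?inE.
rewrite lebesgue_measure_ball; last exact: ltW.
by rewrite lee_fin mulr_natl.
Qed.

(** The Poisson kernel of the half plane, up to the factor 1 / pi; it dominates all error terms
    below. *)
Definition pker t e x : R := e / ((x - t) ^+ 2 + e ^+ 2).

Lemma pker_den t e x : 0 < e -> 0 < (x - t) ^+ 2 + e ^+ 2.
Proof. by move=> e0; rewrite ltr_wpDl ?sqr_ge0 ?exprn_gt0. Qed.

Lemma pker_ge0 t e x : 0 < e -> 0 <= pker t e x.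
Proof. by move=> e0; rewrite divr_ge0 ?(ltW e0)// ltW// pker_den. Qed.

Lemma pker_le t e x : 0 < e -> pker t e x <= e^-1.
Proof.
by move=> e0; rewrite /pker ler_pdivrMr ?pker_den// mulrC ler_pdivlMr// -expr2 lerDr sqr_ge0.
Qed.

Lemma mI_pker t e : mI (pker t e).
Proof.
apply: mI_M; first exact: mI_cst.
apply: mI_V; apply: mI_D; last exact: mI_cst.
by apply: mI_X; apply: mI_B; [exact: mI_id|exact: mI_cst].
Qed.

(** Where |x - t| lies between 2^(k-1) e and 2^k e, the kernel is at most 4 / (4^k e), so a sum of
    indicators of balls majorizes it. *)
Lemma pker_dyadic t e x n : 0 < e -> `|x - t| < 2 ^+ n * e ->
  pker t e x <= \sum_(k < n.+1) 4 / 4 ^+ k / e * (if `|x - t| < 2 ^+ k * e then 1 else 0).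
Proof.
move=> e0; have e0' : 0 < e^-1 by rewrite invr_gt0.
elim: n => [|n IH] xt.
  rewrite big_ord1 xt expr0 divr1 mulr1 (le_trans (pker_le _ _ e0))// ler_peMl ?(ltW e0')//; lra.
have [xn|xn] := ltP `|x - t| (2 ^+ n * e).
  rewrite big_ord_recr /= (le_trans (IH xn))// lerDl xt mulr1 !divr_ge0 ?exprn_ge0 ?(ltW e0)//.
rewrite big_ord_recr /= xt mulr1 -[leLHS]add0r lerD//.
  rewrite sumr_ge0// => k _; rewrite mulr_ge0 ?divr_ge0 ?exprn_ge0 ?(ltW e0)//.
  by case: ifP.
rewrite /pker ler_pdivrMr ?pker_den// exprS invfM mulrA divff// mul1r.
have n0 : (0 : R) < 4 ^+ n by rewrite exprn_gt0.
rewrite (_ : 4 ^- n / e * ((x - t) ^+ 2 + e ^+ 2) = ((x - t) ^+ 2 + e ^+ 2) / (4 ^+ n * e)); last first.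
  by field; rewrite (gt_eqF e0) (gt_eqF n0).
rewrite ler_pdivlMr ?mulr_gt0//.
have : (2 ^+ n * e) ^+ 2 <= (x - t) ^+ 2.
  rewrite -[leRHS]real_normK ?num_real// lerXn2r ?nnegrE ?mulr_ge0 ?exprn_ge0 ?(ltW e0)//.
rewrite exprMn -exprM mulnC exprM (_ : 2 ^+ 2 = 4 :> R); last by ring.
have : 0 <= e ^+ 2 by rewrite sqr_ge0.
by nra.
Qed.

Lemma itg_pker phi t e : 0 < e -> itg phi -> itg (fun x => phi x * pker t e x).
Proof.
move=> e0 ip; apply: (eq_itg (f := fun x => pker t e x * phi x)) => [x _|]; first by rewrite mulrC.
apply: (itgM (M := e^-1)) => //; first exact: mI_pker.
by move=> x _; rewrite ger0_norm ?pker_ge0// pker_le.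
Qed.

(** The ball of radius 2^k e < r0 contributes (4 / (4^k e)) eta 2^k e = 4 eta / 2^k, in total at
    most 8 eta; beyond r0 / 2 the kernel is at most 4 e / r0^2. *)
Lemma poisson_tail phi t (eta r0 e : R) : itg phi -> (forall x, I x -> 0 <= phi x) ->
  0 <= eta -> 0 < e -> 2 * e < r0 ->
  (forall r, 0 < r < r0 -> J (fun x => if `|x - t| < r then phi x else 0) <= eta * r) ->
  J (fun x => phi x * pker t e x) <= 8 * eta + e * (4 / r0 ^+ 2 * J phi).
Proof.
move=> ip p0 eta0 e0 er0 H.
have r00 : 0 < r0 by apply: lt_trans er0; rewrite mulr_gt0.
have [n [n1 n2]] : exists n, r0 / 2 <= 2 ^+ n * e /\ 2 ^+ n * e < r0.
  have ex : exists n, r0 / 2 <= 2 ^+ n * e.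
    have [N HN] := ex_nat_ge (r0 / 2 / e); exists N.
    rewrite -ler_pdivrMr//; apply: (le_trans (HN N (leqnn N))).
    by rewrite -natrX ler_nat ltnW// ltn_expl.
  exists (ex_minn ex); case: ex_minnP => m Hm Hmin; split=> //.
  case: m Hm Hmin => [|m] Hm Hmin; first by rewrite expr0 mul1r; lra.
  rewrite exprS -mulrA mulrC -ltr_pdivlMr// ltNge; apply/negP => /Hmin.
  by rewrite ltnn.
have mif k : mI (fun x => if `|x - t| < 2 ^+ k * e then phi x else 0).
  by apply: mI_iflt => //; [exact: mI_dist|exact: mI_cst|exact: itg_m|exact: mI_cst].
have iif k : itg (fun x => if `|x - t| < 2 ^+ k * e then phi x else 0).
  apply: itg_le ip => // x Ix; case: ifP => _; rewrite ?normr0 ?p0//.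
  by rewrite ger0_norm ?p0.
pose T x := \sum_(k < n.+1) 4 / 4 ^+ k / e * (if `|x - t| < 2 ^+ k * e then phi x else 0).
have iT : itg T by apply: itg_sum => k; exact: itgZ.
have i1 := itg_pker t e0 ip.
apply: (@le_trans _ _ (J (fun x => T x + e * (4 / r0 ^+ 2 * phi x)))).
  apply: J_le => //; first by apply: itgD => //; do 2 apply: itgZ.
  move=> x Ix; have px := p0 x Ix.
  have T0 : 0 <= T x.
    apply: sumr_ge0 => k _; rewrite mulr_ge0 ?divr_ge0 ?exprn_ge0 ?(ltW e0)//.
    by case: ifP.
  have [xt|xt] := ltP `|x - t| (2 ^+ n * e).
    apply: (@le_trans _ _ (T x)).
      rewrite /T (eq_bigr (fun k : 'I_n.+1 => phi x * (4 / 4 ^+ k / e * (if `|x - t| < 2 ^+ k * e then 1 else 0)))).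
        by rewrite -mulr_sumr ler_wpM2l// pker_dyadic.
      by move=> k _; case: ifP => _; rewrite ?mulr0 ?mulr1// mulrC.
    by rewrite lerDl mulr_ge0 ?(ltW e0)// mulr_ge0// divr_ge0// sqr_ge0.
  rewrite -[leLHS]add0r; apply: lerD => //.
  rewrite (_ : e * (4 / r0 ^+ 2 * phi x) = phi x * (e * (4 / r0 ^+ 2))); last by ring.
  apply: ler_wpM2l => //.
  rewrite /pker; apply: ler_wpM2l; first exact: ltW.
  rewrite -[leRHS]invrK lef_pV2 ?posrE ?pker_den ?invr_gt0 ?divr_gt0 ?exprn_gt0//.
  rewrite invf_div.
  have : (r0 / 2) ^+ 2 <= (x - t) ^+ 2.
    rewrite -[leRHS]real_normK ?num_real// lerXn2r ?nnegrE ?divr_ge0 ?(ltW r00)//.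
    exact: le_trans xt.
  have : 0 <= e ^+ 2 by rewrite sqr_ge0.
  by rewrite expr_div_n (_ : 2 ^+ 2 = 4 :> R); [lra|ring].
rewrite JD//; last by do 2 apply: itgZ.
rewrite !JZ//; last by apply: itgZ.
rewrite lerD2r /T J_sum; last by move=> k; exact: itgZ.
apply: (@le_trans _ _ (\sum_(k < n.+1) 4 * eta * 2^-1 ^+ k)).
  apply: ler_sum => k _; rewrite JZ//.
  have rk : 0 < 2 ^+ k * e < r0.
    rewrite mulr_gt0 ?exprn_gt0//= (le_lt_trans _ n2)// ler_wpM2r ?(ltW e0)//.
    by rewrite ler_weXn2l ?ler1n// -ltnS.
  apply: (@le_trans _ _ (4 / 4 ^+ k / e * (eta * (2 ^+ k * e)))).
    by rewrite ler_wpM2l ?H// !divr_ge0 ?exprn_ge0 ?(ltW e0).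
  rewrite (_ : 4 ^+ k = 2 ^+ k * 2 ^+ k :> R); last by rewrite -exprMn; congr (_ ^+ _); ring.
  rewrite exprVn le_eqVlt; apply/orP; left; apply/eqP; field.
  by rewrite (gt_eqF e0) expf_neq0.
rewrite -mulr_sumr (_ : 8 * eta = 4 * eta * 2); last by ring.
rewrite ler_wpM2l ?mulr_ge0//.
suff -> : \sum_(k < n.+1) (2^-1 : R) ^+ k = 2 - 2 * 2^-1 ^+ n.+1.
  by rewrite gerBl mulr_ge0 ?exprn_ge0.
elim: n.+1 => [|m IHm]; first by rewrite big_ord0 expr0; ring.
by rewrite big_ord_recr /= IHm exprS; field.
Qed.

(* [u e] tends to 0 as e tends to 0 from the right. *)
Definition lim0 (u : R -> R) := forall d, 0 < d -> exists2 e0, 0 < e0 &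
  forall e, 0 < e < e0 -> `|u e| <= d.

Lemma lim0D u v : lim0 u -> lim0 v -> lim0 (fun e => u e + v e).
Proof.
move=> hu hv d d0; have d2 : 0 < d / 2 by rewrite divr_gt0.
have [e1 e10 H1] := hu _ d2; have [e2 e20 H2] := hv _ d2.
exists (Num.min e1 e2) => [|e]; first by rewrite lt_min e10.
rewrite lt_min => /and3P[e0 l1 l2].
by rewrite (le_trans (ler_normD _ _))// [leRHS]splitr lerD ?H1 ?H2 ?e0.
Qed.

Lemma lim0_le u v (M e1 : R) : 0 < e1 -> lim0 v ->
  (forall e, 0 < e < e1 -> `|u e| <= M * `|v e|) -> lim0 u.
Proof.
move=> e10 hv H d d0; have dM : 0 < d / (`|M| + 1) by rewrite divr_gt0// ltr_wpDl.
have [e2 e20 H2] := hv _ dM; exists (Num.min e1 e2) => [|e]; first by rewrite lt_min e10.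
rewrite lt_min => /and3P[e0 l1 l2].
rewrite (le_trans (H e _)) ?e0//; apply: (@le_trans _ _ (`|M| * (d / (`|M| + 1)))).
  apply: (@le_trans _ _ (`|M| * `|v e|)); first by rewrite ler_wpM2r// ler_norm.
  by rewrite ler_wpM2l// H2// e0.
by rewrite mulrCA ler_piMr ?(ltW d0)// ler_pdivrMr ?ltr_wpDl// mul1r lerDl.
Qed.

Lemma lim0Z u (k : R) : lim0 u -> lim0 (fun e => k * u e).
Proof. by move=> hu; apply: (@lim0_le _ _ `|k| 1 _ hu) => // e _; rewrite normrM. Qed.

Lemma lim0_id : lim0 id.
Proof. by move=> d d0; exists d => // e /andP[e0 /ltW]; rewrite gtr0_norm. Qed.

Lemma lim0_pker f t : itg f -> leb_point f t ->
  lim0 (fun e => J (fun x => `|f x - f t| * pker t e x)).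
Proof.
move=> fi Lt d d0; have d16 : 0 < d / 16 by rewrite divr_gt0.
have [r0 r00 H] := Lt _ d16.
have ip : itg (fun x => `|f x - f t|) by apply: itg_norm; apply: itgB => //; exact: itg_cst.
pose K := 4 / r0 ^+ 2 * J (fun x => `|f x - f t|).
have K0 : 0 <= K by rewrite mulr_ge0 ?divr_ge0 ?sqr_ge0// J_ge0.
have e0 : 0 < Num.min (r0 / 2) (d / 2 / (K + 1)).
  by rewrite lt_min !divr_gt0// ltr_wpDl.
exists (Num.min (r0 / 2) (d / 2 / (K + 1))) => // e; rewrite lt_min => /and3P[ep er eK].
have i1 := itg_pker t ep ip.
rewrite ger0_norm; last by apply: J_ge0 => x _; rewrite mulr_ge0 ?pker_ge0.
have er' : 2 * e < r0 by lra.
have := @poisson_tail _ t _ r0 e ip (fun _ _ => normr_ge0 _) (ltW d16) ep er' H.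
move=> /le_trans; apply; rewrite -/K.
move: eK; rewrite ltr_pdivlMr ?ltr_wpDl// => eK.
have : e * K <= d / 2 by nra.
by lra.
Qed.

Lemma J_pker_bounded t : exists2 K, 0 <= K & forall e, 0 < e < 1 / 2 -> J (pker t e) <= K.
Proof.
exists (16 + 4 * J (fun=> 1)); first by rewrite addr_ge0// mulr_ge0// J_ge0.
move=> e /andP[e0 e12].
have e1 : 2 * e < 1 by lra.
have := @poisson_tail (fun=> 1) t 2 1 e (itg_cst 1) (fun _ _ => ler01) (ler0n _ 2) e0 e1.
have E : J (fun x => 1 * pker t e x) = J (pker t e) by apply: eq_J => x _; rewrite mul1r.
rewrite E => H; apply: (le_trans (H _)); first by move=> r /andP[r0 _]; exact: J_ball_le.
have J1 : 0 <= J (fun=> 1 : R) by rewrite J_ge0.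
rewrite expr1n divr1; nra.
Qed.

Lemma lim0_epker t : lim0 (fun e => e * J (pker t e)).
Proof.
have [K K0 H] := J_pker_bounded t.
apply: (@lim0_le _ id K (1 / 2) _ lim0_id) => [|e /andP[e0 e1]]; first by rewrite divr_gt0.
rewrite normrM mulrC ler_wpM2r// ger0_norm ?H ?e0//.
by apply: J_ge0 => x _; exact: pker_ge0.
Qed.

End lebesgue_points.

(** * Closed forms of the Abel-Poisson kernels *)

Section kernels.
Context {R : realType}.
Implicit Types (f G : R -> R) (t x e r s : R).
Local Notation I := (I11 R).

(** Telescoping for a linear recurrence of order two: r^n cos (n phi) and r^n sin (n phi) satisfy it
    with a = r cos phi and rho = r^2, and the left factor is the usual Poisson denominator. *)
Lemma sum_rec2 (u : nat -> R) (a rho : R) :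
  (forall n, u n.+2 = 2 * a * u n.+1 - rho * u n) -> forall N,
  (1 - 2 * a + rho) * \sum_(n < N) u n.+1 = u 1 - rho * u 0 - u N.+1 + rho * u N.
Proof.
move=> H; elim=> [|N IH]; first by rewrite big_ord0; ring.
rewrite big_ord_recr /= mulrDr IH (H N); ring.
Qed.

(* With x = cos theta, t = cos tau and s = 1 or -1: [kp] and [kq] are
   [r^n cos (n (tau + s theta))] and [r^n sin (n (tau + s theta))]; [kA] and [kB]
   below are the closed forms of the sums over n >= 1 of
   [r^n sin (n tau) sin (n theta)] and [r^n sin (n tau) cos (n theta)]. *)
Definition kp s t r n x := r ^+ n * (C 'X^n t * C 'X^n x - s * (S 'X^n t * S 'X^n x)).
Definition kq s t r n x := r ^+ n * (S 'X^n t * C 'X^n x + s * (C 'X^n t * S 'X^n x)).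
Definition ka s t r x := r * (t * x - s * (w t * w x)).
Definition kb s t r x := r * (w t * x + s * (t * w x)).
Definition kd s t r x := 1 - 2 * ka s t r x + r ^+ 2.

Lemma kpS s t r n x : s ^+ 2 = 1 ->
  kp s t r n.+1 x = ka s t r x * kp s t r n x - kb s t r x * kq s t r n x.
Proof. by move=> s1; rewrite /kp /kq /ka /kb !C_Xn !S_Xn exprS; ring: s1. Qed.

Lemma kqS s t r n x : s ^+ 2 = 1 ->
  kq s t r n.+1 x = kb s t r x * kp s t r n x + ka s t r x * kq s t r n x.
Proof. by move=> s1; rewrite /kp /kq /ka /kb !C_Xn !S_Xn exprS; ring: s1. Qed.

Lemma kab s t r x : s ^+ 2 = 1 -> I t -> I x ->
  ka s t r x ^+ 2 + kb s t r x ^+ 2 = r ^+ 2.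
Proof.
move=> s1 /w2 wt /w2 wx; rewrite /ka /kb; ring: s1 wt wx.
Qed.

Lemma kd_gt0 s t r x : s ^+ 2 = 1 -> I t -> I x -> 0 < r < 1 -> 0 < kd s t r x.
Proof.
move=> s1 It Ix /andP[r0 r1]; have h := kab r s1 It Ix.
have : ka s t r x <= r.
  have [//|rk] := leP (ka s t r x) r.
  have : 0 < (ka s t r x - r) * (ka s t r x + r) by rewrite mulr_gt0 ?subr_gt0// addr_gt0// (lt_trans r0).
  have := sqr_ge0 (kb s t r x); nra.
have : 0 < (1 - r) ^+ 2 by rewrite exprn_gt0 ?subr_gt0.
by rewrite /kd; nra.
Qed.

Lemma cvg_geo_bd r (u : nat -> R) (M : R) : 0 < r < 1 ->
  (forall n, `|u n| <= M * r ^+ n) -> u n @[n --> \oo] --> (0 : R).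
Proof.
move=> /andP[r0 r1] H; apply/norm_cvg0P.
have Mr : M * r ^+ n @[n --> \oo] --> (0 : R).
  rewrite -(mulr0 M); apply: cvgM; first exact: cvg_cst.
  by apply: cvg_expr; rewrite gtr0_norm.
apply: (squeeze_cvgr _ (cvg_cst (0 : R)) Mr); apply: nearW => n.
by rewrite normr_ge0 H.
Qed.

Lemma kpq_le s t r n x : `|s| <= 1 -> I t -> I x -> 0 < r ->
  `|kp s t r n x| <= 2 * r ^+ n /\ `|kq s t r n x| <= 2 * r ^+ n.
Proof.
move=> s1 It Ix r0; have rn : 0 <= r ^+ n by rewrite exprn_ge0 ?(ltW r0).
have M (a b : R) : `|a| <= 1 -> `|b| <= 1 -> `|a * b| <= 1.
  by move=> a1 b1; rewrite normrM mulr_ile1.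
have C1 := C_le1 n It; have S1 := S_le1 n It; have C2 := C_le1 n Ix; have S2 := S_le1 n Ix.
split; rewrite /kp /kq normrM (ger0_norm rn) mulrC ler_wpM2r//.
  by rewrite (le_trans (ler_normB _ _))// (_ : 2 = 1 + 1 :> R) ?lerD ?M//; ring.
by rewrite (le_trans (ler_normD _ _))// (_ : 2 = 1 + 1 :> R) ?lerD ?M//; ring.
Qed.

Lemma cvg_sum_rec2 (u : nat -> R) (a rho r M : R) : 0 < r < 1 -> 0 < 1 - 2 * a + rho ->
  (forall n, u n.+2 = 2 * a * u n.+1 - rho * u n) -> (forall n, `|u n| <= M * r ^+ n) ->
  \sum_(n < N) u n.+1 @[N --> \oo] --> (u 1 - rho * u 0) / (1 - 2 * a + rho).
Proof.
move=> r01 d0 H uM.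
rewrite (_ : (fun N => _) = (fun N => (u 1 - rho * u 0 - u N.+1 + rho * u N) / (1 - 2 * a + rho))); last first.
  by apply/funext => N; rewrite -(sum_rec2 H N) mulrAC divff ?mul1r// gt_eqF.
apply: cvgM; last exact: cvg_cst.
have c0 := cvg_geo_bd r01 uM.
rewrite [X in _ --> X](_ : _ = u 1 - rho * u 0 - 0 + rho * 0); last by ring.
apply: cvgD; last by apply: cvgM => //; exact: cvg_cst.
apply: cvgB; first exact: cvg_cst.
by rewrite (cvg_shiftS u).
Qed.

Lemma cvg_kq s t r x : s ^+ 2 = 1 -> `|s| <= 1 -> I t -> I x -> 0 < r < 1 ->
  \sum_(n < N) kq s t r n.+1 x @[N --> \oo] --> kb s t r x / kd s t r x.
Proof.
move=> s1 s1' It Ix r01.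
have q0 : kq s t r 0 x = 0 by rewrite /kq S_1 C_1 S_1; ring.
rewrite (_ : kb s t r x = kq s t r 1 x - r ^+ 2 * kq s t r 0 x); last first.
  by rewrite kqS// q0 /kp C_1 S_1 C_1 S_1; ring.
apply: (@cvg_sum_rec2 (fun n => kq s t r n x) _ _ r 2) => //.
- exact: kd_gt0.
- by move=> n; rewrite -(kab r s1 It Ix) !(kqS,kpS)//; ring.
- by move=> n; case/andP: r01 => r0 _; case: (kpq_le n s1' It Ix r0).
Qed.

Lemma cvg_kp s t r x : s ^+ 2 = 1 -> `|s| <= 1 -> I t -> I x -> 0 < r < 1 ->
  \sum_(n < N) kp s t r n.+1 x @[N --> \oo] --> (ka s t r x - r ^+ 2) / kd s t r x.
Proof.
move=> s1 s1' It Ix r01.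
have p0 : kp s t r 0 x = 1 by rewrite /kp S_1 C_1 S_1 C_1; ring.
rewrite (_ : ka s t r x - r ^+ 2 = kp s t r 1 x - r ^+ 2 * kp s t r 0 x); last first.
  by rewrite kpS// p0 /kq C_1 S_1 C_1 S_1; ring.
apply: (@cvg_sum_rec2 (fun n => kp s t r n x) _ _ r 2) => //.
- exact: kd_gt0.
- by move=> n; rewrite -(kab r s1 It Ix) !(kqS,kpS)//; ring.
- by move=> n; case/andP: r01 => r0 _; case: (kpq_le n s1' It Ix r0).
Qed.

(** The product of the two Poisson denominators, for tau + theta and tau - theta. The square root w
    x cancels in it, so that it is a polynomial in x that can be compared with (x - t)^2 + (1 -
    r)^2. *)
Definition kD t r x := (1 - r ^+ 2) ^+ 2 - 4 * r * (1 + r ^+ 2) * (t * x) + 4 * r ^+ 2 * (x ^+ 2 + t ^+ 2).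
Definition kA t r x := r * (w t * w x) * (1 - r ^+ 2) / kD t r x.
Definition kB t r x := r * w t * ((1 + r ^+ 2) * x - 2 * r * t) / kD t r x.

Lemma kdM t r x : I t -> I x -> kd 1 t r x * kd (-1) t r x = kD t r x.
Proof. by move=> /w2 wt /w2 wx; rewrite /kd /kD /ka; ring: wt wx. Qed.

Lemma kD_gt0 t r x : I t -> I x -> 0 < r < 1 -> 0 < kD t r x.
Proof.
move=> It Ix r01; rewrite -kdM//; apply: mulr_gt0; apply: kd_gt0 => //; ring.
Qed.

Lemma kA_def t r x : I t -> I x -> 0 < r < 1 ->
  kA t r x = ((ka (-1) t r x - r ^+ 2) / kd (-1) t r x - (ka 1 t r x - r ^+ 2) / kd 1 t r x) / 2.
Proof.
move=> It Ix r01; rewrite /kA -kdM//.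
have d1 : 0 < kd 1 t r x by apply: kd_gt0 => //; ring.
have d2 : 0 < kd (-1) t r x by apply: kd_gt0 => //; ring.
rewrite (_ : r * (w t * w x) * (1 - r ^+ 2) = ((ka (-1) t r x - r ^+ 2) * kd 1 t r x -
  (ka 1 t r x - r ^+ 2) * kd (-1) t r x) / 2); last by rewrite /kd /ka; field.
by field; rewrite (gt_eqF d1) (gt_eqF d2).
Qed.

Lemma kB_def t r x : I t -> I x -> 0 < r < 1 ->
  kB t r x = (kb 1 t r x / kd 1 t r x + kb (-1) t r x / kd (-1) t r x) / 2.
Proof.
move=> It Ix r01; rewrite /kB -kdM//.
have d1 : 0 < kd 1 t r x by apply: kd_gt0 => //; ring.
have d2 : 0 < kd (-1) t r x by apply: kd_gt0 => //; ring.
have wx := w2 Ix.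
rewrite (_ : r * w t * ((1 + r ^+ 2) * x - 2 * r * t) = (kb 1 t r x * kd (-1) t r x +
  kb (-1) t r x * kd 1 t r x) / 2); last by rewrite /kd /ka /kb; field: wx.
by field; rewrite (gt_eqF d1) (gt_eqF d2).
Qed.

Definition kk t r n := r ^+ n.+1 * S 'X^(n.+1) t.

Lemma cvg_kA t r x : I t -> I x -> 0 < r < 1 ->
  \sum_(n < N) kk t r n * S 'X^(n.+1) x @[N --> \oo] --> kA t r x.
Proof.
move=> It Ix r01; rewrite kA_def//.
rewrite (_ : (fun N => _) = fun N => (\sum_(n < N) kp (-1) t r n.+1 x - \sum_(n < N) kp 1 t r n.+1 x) / 2).
  apply: cvgM; last exact: cvg_cst.
  by apply: cvgB; apply: cvg_kp => //; rewrite ?normrN ?normr1//; ring.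
apply/funext => N; rewrite -sumrB mulr_suml; apply: eq_bigr => n _.
by rewrite /kk /kp; field.
Qed.

Lemma cvg_kB t r x : I t -> I x -> 0 < r < 1 ->
  \sum_(n < N) kk t r n * C 'X^(n.+1) x @[N --> \oo] --> kB t r x.
Proof.
move=> It Ix r01; rewrite kB_def//.
rewrite (_ : (fun N => _) = fun N => (\sum_(n < N) kq 1 t r n.+1 x + \sum_(n < N) kq (-1) t r n.+1 x) / 2).
  apply: cvgM; last exact: cvg_cst.
  by apply: cvgD; apply: cvg_kq => //; rewrite ?normrN ?normr1//; ring.
apply/funext => N; rewrite -big_split /= mulr_suml; apply: eq_bigr => n _.
by rewrite /kk /kq; field.
Qed.

Lemma kk_sum_le t r N (c : nat -> R) : I t -> 0 < r < 1 -> (forall n, `|c n| <= 1) ->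
  `|\sum_(n < N) kk t r n * c n| <= (1 - r)^-1.
Proof.
move=> It /andP[r0 r1] c1; apply: (le_trans (ler_norm_sum _ _ _)).
have r10 : 0 < 1 - r by rewrite subr_gt0.
apply: (@le_trans _ _ (\sum_(n < N) r ^+ n.+1)).
  apply: ler_sum => n _; rewrite /kk !normrM normrX (gtr0_norm r0) -mulrA ler_piMr//.
    by rewrite exprn_ge0 ?(ltW r0).
  by rewrite mulr_ile1 ?S_le1.
have -> : \sum_(n < N) r ^+ n.+1 = (r - r ^+ N.+1) / (1 - r).
  elim: N => [|N IH]; first by rewrite big_ord0; field; rewrite gt_eqF.
  by rewrite big_ord_recr /= IH [r ^+ N.+2]exprS; field; rewrite gt_eqF.
rewrite ler_piMl ?invr_ge0 ?(ltW r10)//.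
have : 0 <= r ^+ N.+1 by rewrite exprn_ge0 ?(ltW r0).
lra.
Qed.

Lemma cvg_J_kk t r (c : nat -> R -> R) (k f : R -> R) : I t -> 0 < r < 1 -> itg f ->
  (forall n, mI (c n)) -> (forall n x, I x -> `|c n x| <= 1) ->
  (forall x, I x -> \sum_(n < N) kk t r n * c n x @[N --> \oo] --> k x) ->
  \sum_(n < N) kk t r n * J (fun x => c n x * f x) @[N --> \oo] --> J (fun x => k x * f x).
Proof.
move=> It r01 fi mc c1 ck.
pose F N x := (\sum_(n < N) kk t r n * c n x) * f x.
have mF N : mI (F N).
  apply: mI_M (itg_m fi); apply: mI_sum => n; apply: mI_M => //; exact: mI_cst.
have iF n : itg (fun x => c n x * f x) by apply: (itgM (M := 1)) => //; exact: c1.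
have -> : (fun N => \sum_(n < N) kk t r n * J (fun x => c n x * f x)) = fun N => J (F N).
  apply/funext => N; transitivity (J (fun x => \sum_(n < N) kk t r n * (c n x * f x))).
    rewrite J_sum => [|n]; last exact: itgZ.
    by apply: eq_bigr => n _; rewrite JZ.
  by apply: eq_J => x _; rewrite /F mulr_suml; apply: eq_bigr => n _; rewrite mulrA.
apply: (J_dct (g := fun x => (1 - r)^-1 * `|f x|)) => //.
- have mk : mI k.
    apply: (measurable_fun_cvg (h := fun N x => \sum_(n < N) kk t r n * c n x)) => //.
      by move=> N; apply: mI_sum => n; apply: mI_M => //; exact: mI_cst.
  by apply: mI_M mk (itg_m fi).
- by move=> x Ix; apply: cvgM; [exact: ck|exact: cvg_cst].
- by apply: itgZ; exact: itg_norm.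
- by move=> N x Ix; rewrite /F normrM ler_wpM2r// (@kk_sum_le t r N (c ^~ x))// => n; exact: c1.
Qed.

Lemma conj_pair_kernel f G t r : conj_pair f G -> I t -> 0 < r < 1 ->
  J (fun x => kA t r x * G x) = J (fun x => kB t r x * f x).
Proof.
move=> [fi Gi fG] It r01.
have HA := cvg_J_kk It r01 Gi (fun n => mI_S 'X^(n.+1)) (fun n x => @S_le1 R n.+1 x) (fun x Ix => cvg_kA It Ix r01).
have HB := cvg_J_kk It r01 fi (fun n => mI_C 'X^(n.+1)) (fun n x => @C_le1 R n.+1 x) (fun x Ix => cvg_kB It Ix r01).
apply: (norm_cvg_unique HA); rewrite (_ : (fun N => _) =
  fun N => \sum_(n < N) kk t r n * J (fun x => C 'X^(n.+1) x * f x))//.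
by apply/funext => N; apply: eq_bigr => n _; rewrite fG.
Qed.

(** Termwise integration leaves the first term only, as the other sines have integral 0 in dx. *)
Lemma J_kA t r : I t -> 0 < r < 1 -> J (kA t r) = pi / 2 * (r * w t).
Proof.
move=> It r01.
have HA := cvg_J_kk It r01 (itg_cst 1) (fun n => mI_S 'X^(n.+1)) (fun n x => @S_le1 R n.+1 x) (fun x Ix => cvg_kA It Ix r01).
rewrite (eq_J (g := fun x => kA t r x * 1)); last by move=> x _; rewrite mulr1.
apply: (norm_cvg_unique HA); apply: (cvg_eventually (N := 1)) => -[//|N _].
rewrite big_ord_recl big1 => [|n _].
  rewrite (eq_J (g := S 'X^1)); last by move=> x _; rewrite mulr1.
  rewrite J_S /= /kk S_X; ring.
rewrite (eq_J (g := S 'X^(n.+2))); last by move=> x _; rewrite mulr1.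
by rewrite J_S /= !mulr0.
Qed.

End kernels.

(** * Convergence of the truncated integrals at Lebesgue points *)

Section principal_value.
Context {R : realType}.
Implicit Types (f G : R -> R) (t x e r s : R).
Local Notation mu := (@lebesgue_measure R).
Local Notation I := (I11 R).

(** The constant K lifts the logarithmic derivative above 0, where [improper_FTC] applies, and is
    removed afterwards. *)
Lemma int_dlog (p : {poly R}) (a b s K : R) : a < b ->
  (forall x, a <= x <= b -> 0 < p.[x]) ->
  (forall x, a < x < b -> 0 <= s * (p^`().[x] / p.[x]) + K) ->
  (\int[mu]_(x in `]a, b[) (s * (p^`().[x] / p.[x]) + K)%:E =
   (s * (ln p.[b] - ln p.[a]) + K * (b - a))%:E)%E.
Proof.
move=> ab p0 f0.
have cF x : a <= x <= b -> {for x, continuous (fun x => s * ln p.[x] + K * x)}.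
  move=> xab; apply: cvgD; last by apply: cvgM; [exact: cvg_cst|exact: cvg_id].
  apply: cvgM; first exact: cvg_cst.
  apply: continuous_comp; first exact: continuous_horner.
  exact: continuous_ln (p0 _ xab).
rewrite (_ : s * _ + _ = (s * ln p.[b] + K * b) - (s * ln p.[a] + K * a)); last by ring.
apply: (@improper_FTC _ _ (fun x => s * ln p.[x] + K * x)) => //.
- move=> x /andP[/ltW ax /ltW xb]; have px : 0 < p.[x] by rewrite p0// ax.
  apply: cvgD; last exact: cvg_cst.
  apply: cvgM; first exact: cvg_cst.
  apply: cvgM; first exact: continuous_horner.
  by apply: cvgV; [rewrite gt_eqF|exact: continuous_horner].
- move=> x /andP[/ltW ax /ltW xb]; have px : 0 < p.[x] by rewrite p0// ax.
  have h1 := is_derive1_comp (is_derive1_ln px) (is_derive_poly p x).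
  have h2 := is_deriveZ s h1.
  have h3 := is_deriveZ K (is_derive_id x 1).
  have := is_deriveD h2 h3.
  by rewrite /GRing.scale /= mulr1 [_^-1 * _]mulrC; apply.
- by apply: cvg_at_right_filter; apply: cF; rewrite lexx ltW.
- by apply: cvg_at_left_filter; apply: cF; rewrite lexx ltW.
Qed.

Lemma int_I_sub f (a b : R) : -1 <= a -> b <= 1 ->
  (\int[mu]_(x in I) (if a < x < b then f x else 0)%:E = \int[mu]_(x in `]a, b[) (f x)%:E)%E.
Proof.
move=> a1 b1; rewrite integral_mkcond [RHS]integral_mkcond; apply: eq_integral => x _.
rewrite !patchE; case: ifPn => [/set_mem/I11P Ix|/negP Ix].
  case: ifPn => xab; first by rewrite mem_set//= in_itv.
  by rewrite memNset//= in_itv; exact/negP.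
rewrite memNset//= in_itv /= => /andP[ax xb]; apply: Ix; apply/mem_set/I11P.
by rewrite (le_lt_trans a1)// (lt_le_trans xb).
Qed.

Definition kt t e x := if e < `|x - t| then (x - t)^-1 else 0.

Lemma kt_le t e x : 0 < e -> `|kt t e x| <= e^-1.
Proof.
move=> e0; rewrite /kt; case: ifPn => h; last by rewrite normr0 invr_ge0 ltW.
by rewrite normfV lef_pV2 ?posrE// ?ltW// (lt_trans e0).
Qed.

Lemma mI_kt t e : mI (kt t e).
Proof.
apply: mI_iflt; [exact: mI_cst|exact: mI_dist| |exact: mI_cst].
by apply: mI_V; apply: mI_B; [exact: mI_id|exact: mI_cst].
Qed.

Lemma J_kt t e : 0 < e < 1 - `|t| -> J (kt t e) = ln (1 - t) - ln (1 + t).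
Proof.
move=> /andP[e0 e1].
have t1 : t <= `|t| by exact: ler_norm.
have t2 : - t <= `|t| by rewrite -normrN ler_norm.
pose kp x := if t + e < x < 1 then 1 * (('X - t%:P)^`().[x] / ('X - t%:P).[x]) + 0 else 0.
pose km x := if -1 < x < t - e then -1 * ((t%:P - 'X)^`().[x] / (t%:P - 'X).[x]) + 0 else 0.
have dp : ('X - t%:P)^`() = 1 by rewrite poly.derivB derivX derivC subr0.
have dm : (t%:P - 'X)^`() = -1 by rewrite poly.derivB derivX derivC sub0r.
have ep x : 1 * (('X - t%:P)^`().[x] / ('X - t%:P).[x]) + 0 = (x - t)^-1.
  by rewrite dp !hornerE.
have em x : -1 * ((t%:P - 'X)^`().[x] / (t%:P - 'X).[x]) + 0 = (t - x)^-1.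
  by rewrite dm hornerN hornerD hornerN hornerX !hornerC mulrA mulrNN mul1r addr0 mul1r.
have Hp : (\int[mu]_(x in I) (kp x)%:E = (ln (1 - t) - ln e)%:E)%E.
  rewrite int_I_sub//; last by lra.
  rewrite int_dlog ?hornerE.
  - by rewrite (_ : t + e - t = e)//; ring.
  - by lra.
  - by move=> x /andP[x1 x2]; rewrite !hornerE; lra.
  - move=> x /andP[x1 x2]; rewrite ep invr_ge0; lra.
have Hm : (\int[mu]_(x in I) (km x)%:E = (ln (1 + t) - ln e)%:E)%E.
  rewrite int_I_sub//; last by lra.
  rewrite int_dlog ?hornerE.
  - by rewrite (_ : t - (t - e) = e) ?[t - -1]addrC ?opprK; [congr (_%:E)|]; ring.
  - by lra.
  - by move=> x /andP[x1 x2]; rewrite !hornerE; lra.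
  - move=> x /andP[x1 x2]; rewrite em invr_ge0; lra.
have mp : mI kp.
  rewrite /kp; apply: (eq_mI (f := fun x => if t + e < x then (x - t)^-1 else 0)).
    move=> x /I11P/andP[_ ->]; rewrite andbT; case: ifP => // _; rewrite ep.
  apply: mI_iflt; [exact: mI_cst|exact: mI_id| |exact: mI_cst].
  by apply: mI_V; apply: mI_B; [exact: mI_id|exact: mI_cst].
have mm : mI km.
  rewrite /km; apply: (eq_mI (f := fun x => if x < t - e then (t - x)^-1 else 0)).
    move=> x /I11P/andP[-> _] /=; case: ifP => // _; rewrite em.
  apply: mI_iflt; [exact: mI_id|exact: mI_cst| |exact: mI_cst].
  by apply: mI_V; apply: mI_B; [exact: mI_cst|exact: mI_id].
have ip : itg kp.
  apply: itg_ge0P => //; last by rewrite Hp ltry.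
  move=> x _; rewrite /kp; case: ifP => // /andP[x1 x2].
  rewrite ep invr_ge0; lra.
have im : itg km.
  apply: itg_ge0P => //; last by rewrite Hm ltry.
  move=> x _; rewrite /km; case: ifP => // /andP[x1 x2].
  rewrite em invr_ge0; lra.
transitivity (J kp - J km).
  rewrite -JB//; apply: eq_J => x /I11P/andP[x1 x2]; rewrite /kt /kp /km x1 x2 andbT /=.
  rewrite ep em real_ltr_normr ?num_real//.
  have [h|h] := ltP (t + e) x.
    have -> : x < t - e = false by apply/negbTE; rewrite -leNgt; lra.
    by rewrite (_ : e < x - t); [rewrite /= subr0|lra].
  have -> : e < x - t = false by apply/negbTE; rewrite -leNgt; lra.
  rewrite /= (_ : (e < - (x - t)) = (x < t - e)); last by apply/idP/idP; lra.
  case: ifP => _; last by rewrite subr0.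
  by rewrite sub0r -[t - x]opprB invrN opprK.
by rewrite /J /Rintegral Hp Hm /=; ring.
Qed.

(** [kD] equals 4 r^2 (x - t)^2 + (1 - r)^2 ((1 + r)^2 - 4 r t x). For r >= 1 / 2 the first
    coefficient is at least 1, and the bracket is at least 4 r (1 - |t|). Hence kernels over [kD]
    are controlled by [pker] with e = 1 - r. *)
Lemma kD_low t r x : I t -> I x -> 1 / 2 <= r <= 1 ->
  (1 - `|t|) * ((x - t) ^+ 2 + (1 - r) ^+ 2) <= kD t r x.
Proof.
move=> /I11P/andP[t0 t1] /I11P/andP[x0 x1] /andP[r0 r1].
have nt : `|t| <= 1 by rewrite ler_norml; lra.
have tx : t * x <= `|t|.
  by rewrite (le_trans (ler_norm _))// normrM ler_piMr// ler_norml; lra.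
have n0 := normr_ge0 t; set c := 1 - `|t|.
have c0 : 0 <= c by rewrite subr_ge0.
have tc : t * x <= 1 - c by rewrite /c; lra.
have -> : kD t r x = 4 * r ^+ 2 * (x - t) ^+ 2 + (1 - r) ^+ 2 * ((1 + r) ^+ 2 - 4 * r * (t * x)).
  by rewrite /kD; ring.
rewrite mulrDr; apply: lerD.
  by rewrite ler_wpM2r ?sqr_ge0//; rewrite /c; nra.
rewrite mulrC ler_wpM2l ?sqr_ge0//.
have := sqr_ge0 (1 - r); nra.
Qed.

Lemma ratio_pker (N D c K e t x : R) : 0 < e -> 0 < c -> `|N| <= K * e ->
  c * ((x - t) ^+ 2 + e ^+ 2) <= D -> `|N / D| <= K / c * pker t e x.
Proof.
move=> e0 c0 NK cD; have p0 := pker_den t x e0.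
have D0 : 0 < D by apply: lt_le_trans cD; rewrite mulr_gt0.
rewrite normrM normfV (gtr0_norm D0) /pker ler_pdivrMr//.
apply: (le_trans NK).
rewrite (_ : K / c * _ * D = K * e * (D / (c * ((x - t) ^+ 2 + e ^+ 2)))); last first.
  by field; rewrite (gt_eqF p0) (gt_eqF c0).
rewrite ler_peMr//; first exact: le_trans (normr_ge0 _) NK.
by rewrite ler_pdivlMr ?mulr_gt0// mul1r.
Qed.

Lemma kA_le t e x : I t -> I x -> 0 < e <= 1 / 2 ->
  `|kA t (1 - e) x| <= 2 / (1 - `|t|) * pker t e x.
Proof.
move=> It Ix /andP[e0 e1].
have c0 : 0 < 1 - `|t| by rewrite subr_gt0 ltr_norml; exact/I11P.
apply: ratio_pker => //; last first.
  rewrite {1}(_ : e = 1 - (1 - e)); last by ring.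
  by apply: kD_low => //; lra.
have ww : 0 <= w t * w x <= 1.
  by rewrite mulr_ge0 ?w_ge0//= mulr_ile1 ?w_ge0 ?w_le1.
rewrite ger0_norm; last by rewrite !mulr_ge0 ?w_ge0//; nra.
rewrite -mulrA mulrCA; apply: (@le_trans _ _ (1 * ((1 - e) * (1 - (1 - e) ^+ 2)))).
  by case/andP: ww => w0 w1; rewrite ler_wpM2r//; nra.
nra.
Qed.

(** At r = 1 the kernel [kB] is exactly w t / (2 (x - t)), which explains the factor w t / 2. For |x
    - t| <= e the numerator of [kB] is O(e) and the truncated kernel is 0; outside, the difference
    has a numerator O(e^2 / |x - t|), which is O(e) again. *)
Lemma kB_kt_le t e x : I t -> I x -> 0 < e <= 1 / 2 ->
  `|kB t (1 - e) x - w t / 2 * kt t e x| <= 14 / (1 - `|t|) * pker t e x.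
Proof.
move=> It Ix /andP[e0 e1].
have c0 : 0 < 1 - `|t| by rewrite subr_gt0 ltr_norml; exact/I11P.
have D1 : (1 - `|t|) * ((x - t) ^+ 2 + e ^+ 2) <= kD t (1 - e) x.
  rewrite {1}(_ : e = 1 - (1 - e)); last by ring.
  by apply: kD_low => //; lra.
have w0 := w_ge0 t; have w1 := w_le1 t.
have [/andP[t0 t1] /andP[x0 x1]] : -1 < t < 1 /\ -1 < x < 1 by split; apply/I11P.
pose y := x - t; have xy : x = t + y by rewrite /y; ring.
have D0 : 0 < kD t (1 - e) x by apply: kD_gt0 => //; lra.
rewrite /kt; case: ifPn => [h|]; last first.
  rewrite -leNgt ler_norml => /andP[y0 y1]; rewrite mulr0 subr0.
  apply: ratio_pker => //.
  rewrite !normrM [`|w t|]ger0_norm// [`|1 - e|]ger0_norm; last by lra.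
  have h : `|(1 + (1 - e) ^+ 2) * x - 2 * (1 - e) * t| <= 14 * e.
    rewrite (_ : _ - _ = (1 + (1 - e) ^+ 2) * y + e ^+ 2 * t); last by rewrite xy; ring.
    rewrite -/y in y0 y1; rewrite ler_norml; nra.
  by rewrite -[leRHS]mul1r ler_pM ?mulr_ge0// ?mulr_ile1//; lra.
have y0 : y != 0 by apply/eqP => y0; move: h; rewrite -/y y0 normr0; lra.
(* Over the common denominator the terms of order lower than e^2 cancel; the polynomial that is left
   is at most 28 in modulus, and the 2 in 2 y halves this to 14. *)
have -> : kB t (1 - e) x - w t / 2 * (x - t)^-1 = w t * e ^+ 2 * (2 * (1 - e) * y ^+ 2 +
    6 * (1 - e) * t * y - (2 - e) ^+ 2 + 4 * (1 - e) * t ^+ 2) / (2 * y) / kD t (1 - e) x.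
  rewrite -/y /kB {1 3}xy; move: (D0); rewrite /kD => D0'.
  rewrite /kD xy in D0' *.
  by field; rewrite y0 (gt_eqF D0').
apply: ratio_pker => //.
rewrite normrM normfV ler_pdivrMr ?normr_gt0 ?mulf_neq0//.
rewrite [`|2 * y|]normrM (ger0_norm (ler0n _ 2)).
rewrite 2!normrM (ger0_norm w0) (ger0_norm (sqr_ge0 e)).
set P := (X in _ * `|X|).
have hP : `|P| <= 28.
  have : -2 < y < 2 by rewrite /y; lra.
  have : -1 <= (1 - e) * t <= 1 by nra.
  rewrite /P ler_norml; nra.
apply: (@le_trans _ _ (1 * e ^+ 2 * 28)).
  by apply: ler_pM => //; [rewrite mulr_ge0 ?sqr_ge0|apply: ler_wpM2r => //; exact: sqr_ge0].
rewrite -/y in h; nra.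
Qed.

Lemma mI_kD t r : mI (fun x => (kD t r x)^-1).
Proof.
apply: mI_V; rewrite /kD; apply: mI_D.
  apply: mI_B; first exact: mI_cst.
  by apply: mI_M; [exact: mI_cst|apply: mI_M; [exact: mI_cst|exact: mI_id]].
apply: mI_M; first exact: mI_cst.
by apply: mI_D; [apply: mI_X; exact: mI_id|exact: mI_cst].
Qed.

Lemma kD_quot_le t r x (y M : R) : I t -> I x -> 1 / 2 <= r < 1 -> `|y| <= M ->
  `|y / kD t r x| <= M / ((1 - `|t|) * (1 - r) ^+ 2).
Proof.
move=> It Ix /andP[r0 r1] yM.
have c0 : 0 < 1 - `|t| by rewrite subr_gt0 ltr_norml; exact/I11P.
have e0 : 0 < (1 - r) ^+ 2 by rewrite exprn_gt0 ?subr_gt0.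
have D0 : 0 < kD t r x by apply: kD_gt0 => //; lra.
rewrite normrM normfV (gtr0_norm D0); apply: ler_pM => //; first by rewrite invr_ge0 ltW.
rewrite lef_pV2 ?posrE//; last exact: mulr_gt0.
apply: (@le_trans _ _ ((1 - `|t|) * ((x - t) ^+ 2 + (1 - r) ^+ 2))); last first.
  by apply: kD_low => //; lra.
by apply: ler_wpM2l; [exact: ltW|rewrite lerDr sqr_ge0].
Qed.

Lemma itg_kD t r (h : R -> R) (M : R) : I t -> 1 / 2 <= r < 1 -> mI h ->
  (forall x, I x -> `|h x| <= M) -> itg (fun x => h x / kD t r x).
Proof.
move=> It r01 mh hM; apply: itg_bd => [|x Ix].
  by apply: mI_M => //; exact: mI_kD.
by apply: kD_quot_le => //; exact: hM.
Qed.

Lemma J_dlog_kD t r : I t -> 1 / 2 <= r < 1 ->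
  J (fun x => (8 * r ^+ 2 * x - 4 * r * (1 + r ^+ 2) * t) / kD t r x) =
  2 * (ln (1 + r ^+ 2 - 2 * r * t) - ln (1 + r ^+ 2 + 2 * r * t)).
Proof.
move=> It /andP[r0 r1]; case/I11P/andP: (It) => t0 t1.
pose p : {poly R} := (4 * r ^+ 2) *: 'X^2 - (4 * r * (1 + r ^+ 2) * t) *: 'X +
  ((1 - r ^+ 2) ^+ 2 + 4 * r ^+ 2 * t ^+ 2)%:P.
have pE x : p.[x] = kD t r x by rewrite /p /kD !(hornerD, hornerN, hornerZ, hornerXn, hornerX, hornerC); ring.
have dpE x : p^`().[x] = 8 * r ^+ 2 * x - 4 * r * (1 + r ^+ 2) * t.
  by rewrite /p poly.derivD poly.derivB !derivZ derivXn derivX derivC mulr2n !(hornerD, hornerN, hornerZ, hornerXn, hornerX, hornerC) expr1; ring.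
have c0 : 0 < 1 - `|t| by rewrite subr_gt0 ltr_norml t0 t1.
have D1 : kD t r 1 = (1 + r ^+ 2 - 2 * r * t) ^+ 2 by rewrite /kD; ring.
have D2 : kD t r (-1) = (1 + r ^+ 2 + 2 * r * t) ^+ 2 by rewrite /kD; ring.
have q1 : 0 < 1 + r ^+ 2 - 2 * r * t by have := sqr_ge0 (1 - r); nra.
have q2 : 0 < 1 + r ^+ 2 + 2 * r * t by have := sqr_ge0 (1 - r); nra.
have bd x : I x -> `|8 * r ^+ 2 * x - 4 * r * (1 + r ^+ 2) * t| <= 16.
  move=> /I11P/andP[x0 x1].
  have h1 : -1 <= r * x <= 1 by nra.
  have h2 : -1 <= r * (r * x) <= 1 by nra.
  have h3 : 0 <= r * (1 + r ^+ 2) <= 2 by nra.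
  have h4 : -2 <= r * (1 + r ^+ 2) * t <= 2 by nra.
  by rewrite ler_norml; lra.
have ii := itg_kD It (M := 16).
have i1 : itg (fun x => (8 * r ^+ 2 * x - 4 * r * (1 + r ^+ 2) * t) / kD t r x).
  apply: ii => //; first by rewrite r0.
  by apply: mI_B; [apply: mI_M; [exact: mI_cst|exact: mI_id]|exact: mI_cst].
pose K : R := 16 / ((1 - `|t|) * (1 - r) ^+ 2).
have K0 x : I x -> `|(8 * r ^+ 2 * x - 4 * r * (1 + r ^+ 2) * t) / kD t r x| <= K.
  by move=> Ix; apply: kD_quot_le => //; [rewrite r0|exact: bd].
have H : (\int[mu]_(x in I) (1 * (p^`().[x] / p.[x]) + K)%:E = (1 * (ln p.[1] - ln p.[-1]) + K * (1 - -1))%:E)%E.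
  apply: int_dlog; first by lra.
    move=> x /andP[]; rewrite pE le_eqVlt => /orP[/eqP<-|x0]; first by rewrite D2 exprn_gt0.
    rewrite le_eqVlt => /orP[/eqP->|x1]; first by rewrite D1 exprn_gt0.
    by apply: kD_gt0 => //; [apply/I11P; rewrite x0|lra].
  move=> x /I11P Ix; rewrite dpE pE mul1r; have := K0 x Ix; rewrite ler_norml; lra.
have i2 : itg (fun=> K) by exact: itg_cst.
have E : J (fun x => (8 * r ^+ 2 * x - 4 * r * (1 + r ^+ 2) * t) / kD t r x + K) =
    1 * (ln p.[1] - ln p.[-1]) + K * (1 - -1).
  by rewrite (eq_J (g := fun x => 1 * (p^`().[x] / p.[x]) + K)) => [|x _];
    [rewrite /J /Rintegral H|rewrite dpE pE mul1r].
have JK : J (fun=> K) = K * (1 - -1).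
  pose q : {poly R} := 1%:P.
  have qE x : 1 * (q^`().[x] / q.[x]) + K = K.
    by rewrite /q poly.derivC !hornerC mul0r mulr0 add0r.
  have H2 : (\int[mu]_(x in I) (1 * (q^`().[x] / q.[x]) + K)%:E =
      (1 * (ln q.[1] - ln q.[-1]) + K * (1 - -1))%:E)%E.
    apply: int_dlog; first by lra.
      by move=> x _; rewrite /q hornerC.
    by move=> x _; rewrite qE divr_ge0// mulr_ge0 ?(ltW c0) ?sqr_ge0.
  rewrite (eq_J (g := fun x => 1 * (q^`().[x] / q.[x]) + K)) => [|x _]; last by rewrite qE.
  by rewrite /J /Rintegral H2 /= /q !hornerC subrr mulr0 add0r.
move: E; rewrite JD// JK => /addIr ->; rewrite !pE D1 D2 mul1r !lnXn//.
ring.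
Qed.

Lemma lim0_cont (u : R -> R) : {for 0, continuous u} -> lim0 (fun e => u e - u 0).
Proof.
move=> /cvgrPdist_le cu d d0; have /nbhs_ballP[e0 /= e00 H] := cu d d0.
exists e0 => // e /andP[ep ee0]; rewrite distrC; apply: H.
by rewrite /ball /= sub0r normrN gtr0_norm.
Qed.

(** Euclidean division of the numerator by the derivative of [kD]: a logarithmic derivative, with an
    explicit integral, and a remainder with numerator (1 - r^2)^2 = O(e^2). *)
Lemma kB_decomp t r x : 1 / 2 <= r < 1 -> 0 < kD t r x ->
  kB t r x = w t * (1 + r ^+ 2) / (8 * r) *
      ((8 * r ^+ 2 * x - 4 * r * (1 + r ^+ 2) * t) / kD t r x) +
    w t * t / 2 * ((1 - r ^+ 2) ^+ 2 / kD t r x).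
Proof.
move=> /andP[r0 r1] D0; rewrite /kB; field.
by rewrite (gt_eqF D0) gt_eqF//; lra.
Qed.

(** By [kB_decomp], the logarithmic part U is continuous up to e = 0, where it is w t / 2 times the
    principal value integral of 1 / (x - t), and the remainder is O(e) times a Poisson integral. *)
Lemma lim0_J_kB t : I t ->
  lim0 (fun e => J (kB t (1 - e)) - w t / 2 * (ln (1 - t) - ln (1 + t))).
Proof.
move=> It; case/I11P/andP: (It) => t0 t1.
have c0 : 0 < 1 - `|t| by rewrite subr_gt0 ltr_norml t0 t1.
pose U e := w t * (1 + (1 - e) ^+ 2) / (8 * (1 - e)) *
  (2 * (ln (1 + (1 - e) ^+ 2 - 2 * (1 - e) * t) - ln (1 + (1 - e) ^+ 2 + 2 * (1 - e) * t))).
have U0 : U 0 = w t / 2 * (ln (1 - t) - ln (1 + t)).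
  rewrite /U subr0 expr1n (_ : 1 + 1 - 2 * 1 * t = 2 * (1 - t)); last by ring.
  rewrite (_ : 1 + 1 + 2 * 1 * t = 2 * (1 + t)); last by ring.
  rewrite !lnM ?posrE//; [|lra|lra].
  by field.
have cU : {for 0, continuous U}.
  have c1 : {for 0, continuous (fun e : R => 1 - e)}.
    by apply: cvgB; [exact: cvg_cst|exact: cvg_id].
  have c2 : {for 0, continuous (fun e : R => 1 + (1 - e) ^+ 2)}.
    by apply: cvgD; [exact: cvg_cst|exact: cvgM].
  have c3 : {for 0, continuous (fun e : R => 2 * (1 - e) * t)}.
    by apply: cvgM; [apply: cvgM => //|]; exact: cvg_cst.
  apply: cvgM.
    apply: cvgM; first by apply: cvgM => //; exact: cvg_cst.
    apply: cvgV; first by rewrite subr0 mulr1.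
    by apply: cvgM => //; exact: cvg_cst.
  apply: cvgM; first exact: cvg_cst.
  apply: cvgB; (apply: continuous_comp; [|apply: continuous_ln; rewrite subr0 expr1n; lra]).
    exact: cvgB.
  exact: cvgD.
have h1 := lim0_cont cU; rewrite U0 in h1.
suff h3 : lim0 (fun e => J (kB t (1 - e)) - U e).
  move=> d d0; have [e0 e00 H] := lim0D h1 h3 d0; exists e0 => // e /H.
  by rewrite addrC addrA subrK.
apply: (@lim0_le _ _ _ (`|w t * t / 2| * (4 / (1 - `|t|))) (1 / 2) _ (lim0_epker t)) => //.
move=> e /andP[e0 e1].
have r01 : 1 / 2 <= 1 - e < 1 by lra.
have D0 x : I x -> 0 < kD t (1 - e) x by move=> Ix; apply: kD_gt0 => //; lra.
have i1 : itg (fun x => (8 * (1 - e) ^+ 2 * x - 4 * (1 - e) * (1 + (1 - e) ^+ 2) * t) / kD t (1 - e) x).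
  apply: (itg_kD (M := 16)) => //.
    by apply: mI_B; [apply: mI_M; [exact: mI_cst|exact: mI_id]|exact: mI_cst].
  move=> x /I11P/andP[x0 x1].
  have h4 : -1 <= (1 - e) * x <= 1 by nra.
  have h5 : -1 <= (1 - e) * ((1 - e) * x) <= 1 by nra.
  have h6 : 0 <= (1 - e) * (1 + (1 - e) ^+ 2) <= 2 by nra.
  have h7 : -2 <= (1 - e) * (1 + (1 - e) ^+ 2) * t <= 2 by nra.
  by rewrite ler_norml; lra.
have i2 : itg (fun x => (1 - (1 - e) ^+ 2) ^+ 2 / kD t (1 - e) x).
  by apply: (itg_kD (h := fun=> _) (M := `|(1 - (1 - e) ^+ 2) ^+ 2|)) => //; exact: mI_cst.
have -> : J (kB t (1 - e)) - U e = w t * t / 2 * J (fun x => (1 - (1 - e) ^+ 2) ^+ 2 / kD t (1 - e) x).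
  rewrite (eq_J (f := kB t (1 - e)) (fun x Ix => kB_decomp r01 (D0 x Ix))).
  rewrite JD; [|exact: itgZ|exact: itgZ].
  by rewrite (JZ _ i1) (JZ _ i2) J_dlog_kD// /U; ring.
rewrite normrM -[leRHS]mulrA; apply: ler_wpM2l => //.
have ip : itg (pker t e) by apply: eq_itg (itg_pker t e0 (itg_cst 1)) => x _; rewrite mul1r.
apply: (le_trans (le_normJ i2)); rewrite normrM (gtr0_norm e0) (ger0_norm (J_ge0 (fun x _ => pker_ge0 t x e0))).
rewrite mulrA -JZ//; apply: J_le => [| |x Ix]; [exact: itg_norm|exact: itgZ|].
rewrite [4 / _ * e]mulrAC; apply: ratio_pker => //.
  by rewrite ger0_norm ?sqr_ge0//; nra.
rewrite {1}(_ : e = 1 - (1 - e)); last by ring.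
by apply: kD_low => //; lra.
Qed.

Definition pvtrunc f t e := J (fun x => if e < `|x - t| then f x / (x - t) else 0).

Lemma trunc_kt f t e : pvtrunc f t e = J (fun x => kt t e x * f x).
Proof. by apply: eq_J => x _; rewrite /kt; case: ifP => _; rewrite ?mul0r// mulrC. Qed.

(** In the kernel identity int kA G = int kB f, the values f t and G t are subtracted. The
    deviations are bounded by Poisson integrals that vanish at Lebesgue points, also after [kB] is
    replaced by w t / 2 times the truncated Cauchy kernel; the means of [kA], [kB] and of the Cauchy
    kernel are known. Division by w t / 2 leaves pi G t. *)
Lemma lim0_trunc f G t : conj_pair f G -> I t -> leb_point f t -> leb_point G t ->
  lim0 (fun e => pvtrunc f t e - pi * G t).
Proof.
move=> fG It Lf LG; have [fi Gi _] := fG.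
have c0 : 0 < 1 - `|t| by rewrite subr_gt0 ltr_norml; exact/I11P.
have w0 := w_gt0 It.
have mA e : 0 < e < 1 / 2 -> mI (kA t (1 - e)).
  move=> e01; apply: mI_M; last exact: mI_kD.
  apply: mI_M; last exact: mI_cst.
  by apply: mI_M; [exact: mI_cst|apply: mI_M; [exact: mI_cst|exact: mI_w]].
have mB e : 0 < e < 1 / 2 -> mI (kB t (1 - e)).
  move=> e01; apply: mI_M; last exact: mI_kD.
  apply: mI_M; first exact: mI_cst.
  by apply: mI_B; [apply: mI_M; [exact: mI_cst|exact: mI_id]|exact: mI_cst].
have bA e x : 0 < e < 1 / 2 -> I x -> `|kA t (1 - e) x| <= 2 / (1 - `|t|) * e^-1.
  move=> /andP[e0 e1] Ix; apply: (le_trans (kA_le It Ix _)); first by rewrite e0 ltW.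
  by rewrite ler_wpM2l ?pker_le// divr_ge0// ltW.
have dB e x : 0 < e < 1 / 2 -> I x ->
    `|kB t (1 - e) x - w t / 2 * kt t e x| <= 14 / (1 - `|t|) * pker t e x.
  by move=> /andP[e0 e1] Ix; apply: kB_kt_le => //; rewrite e0 ltW.
have dBe e x : 0 < e < 1 / 2 -> I x ->
    `|kB t (1 - e) x - w t / 2 * kt t e x| <= 14 / (1 - `|t|) * e^-1.
  move=> e01 Ix; case/andP: (e01) => e0 e1; apply: (le_trans (dB _ _ e01 Ix)).
  by rewrite ler_wpM2l ?pker_le// divr_ge0// ltW.
have mdB e : 0 < e < 1 / 2 -> mI (fun x => kB t (1 - e) x - w t / 2 * kt t e x).
  by move=> e01; apply: mI_B; [exact: mB|apply: mI_M; [exact: mI_cst|exact: mI_kt]].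
have ik e (h : R -> R) : 0 < e < 1 / 2 -> itg h -> itg (fun x => kt t e x * h x).
  move=> /andP[e0 _] ih; apply: (itgM (M := e^-1)) => //; [exact: mI_kt|by move=> x _; exact: kt_le].
have idB e (h : R -> R) : 0 < e < 1 / 2 -> itg h ->
    itg (fun x => (kB t (1 - e) x - w t / 2 * kt t e x) * h x).
  by move=> e01 ih; apply: (itgM (M := 14 / (1 - `|t|) * e^-1)) => //; [exact: mdB|move=> x; exact: dBe].
have iA e (h : R -> R) : 0 < e < 1 / 2 -> itg h -> itg (fun x => kA t (1 - e) x * h x).
  by move=> e01 ih; apply: (itgM (M := 2 / (1 - `|t|) * e^-1)) => //; [exact: mA|move=> x; exact: bA].
have idist (h : R -> R) (M e : R) (k : R -> R) : 0 < e < 1 / 2 -> itg h ->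
    mI k -> (forall x, I x -> `|k x| <= M * pker t e x) -> 0 <= M ->
    `|J (fun x => k x * (h x - h t))| <= M * J (fun x => `|h x - h t| * pker t e x).
  move=> e01 ih mk kM M0; case/andP: (e01) => e0 e1.
  have ih' : itg (fun x => h x - h t) by apply: itgB => //; exact: itg_cst.
  have ik' : itg (fun x => k x * (h x - h t)).
    apply: (itgM (M := M * e^-1)) => // x Ix; apply: (le_trans (kM x Ix)).
    by rewrite ler_wpM2l// pker_le.
  have ip := itg_pker t e0 (itg_norm ih').
  apply: (le_trans (le_normJ ik')); rewrite -JZ//; apply: J_le => [| |x Ix]; [exact: itg_norm|exact: itgZ|].
  by rewrite normrM [leLHS]mulrC mulrCA ler_wpM2l// kM.
have ec e : 0 < e < 1 - `|t| -> J (kt t e) = ln (1 - t) - ln (1 + t) by exact: J_kt.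
have H1 : lim0 (fun e => J (fun x => kA t (1 - e) x * (G x - G t))).
  apply: (@lim0_le _ _ _ (2 / (1 - `|t|)) (1 / 2) _ (lim0_pker Gi LG)) => // e e01.
  rewrite [`|J (fun x => `|_| * _)|]ger0_norm; last first.
    by apply: J_ge0 => x _; rewrite mulr_ge0 ?pker_ge0//; case/andP: e01.
  apply: idist => //; [exact: mA| |by rewrite divr_ge0// ltW].
  by move=> x Ix; apply: kA_le => //; case/andP: e01 => -> /ltW.
have H2 : lim0 (fun e => J (fun x => (kB t (1 - e) x - w t / 2 * kt t e x) * (f x - f t))).
  apply: (@lim0_le _ _ _ (14 / (1 - `|t|)) (1 / 2) _ (lim0_pker fi Lf)) => // e e01.
  rewrite [`|J (fun x => `|_| * _)|]ger0_norm; last first.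
    by apply: J_ge0 => x _; rewrite mulr_ge0 ?pker_ge0//; case/andP: e01.
  apply: idist => //; [exact: mdB| |by rewrite divr_ge0// ltW].
  by move=> x Ix; apply: dB.
have H3 := lim0Z (f t) (lim0_J_kB It).
(* The mean of [kA] is (pi / 2) (1 - e) w t; its deviation from the limit is this multiple of e. *)
have H4 := lim0Z (- (pi / 2 * w t * G t)) lim0_id.
have H5 := lim0Z (2 / w t) (lim0D H1 (lim0D H4 (lim0D (lim0Z (-1) H2) (lim0Z (-1) H3)))).
move=> d d0; have [e0 e00 H] := H5 d d0.
exists (Num.min e0 (Num.min (1 / 2) (1 - `|t|))) => [|e]; first by rewrite !lt_min e00 c0 andbT/=; lra.
rewrite !lt_min => /and4P[ep ee0 e2 et].
have e01 : 0 < e < 1 / 2 by rewrite ep.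
have r01 : 0 < 1 - e < 1 by lra.
have ei : 0 < e < e0 by rewrite ep.
have := H e ei; congr (`|_| <= _).
have E1 : J (fun x => kA t (1 - e) x * (G x - G t)) =
    J (fun x => kA t (1 - e) x * G x) - G t * (pi / 2 * ((1 - e) * w t)).
  rewrite -J_kA// -JZ; last by apply: eq_itg (iA e _ e01 (itg_cst 1)) => x _; rewrite mulr1.
  rewrite -JB; [|exact: iA|].
    by apply: eq_J => x _; rewrite mulrBr [kA _ _ _ * G t]mulrC.
  by apply: itgZ; apply: eq_itg (iA e _ e01 (itg_cst 1)) => x _; rewrite mulr1.
have iB : itg (fun x => kB t (1 - e) x).
  have h1 := idB e _ e01 (itg_cst 1); have h2 := itgZ (w t / 2) (ik e _ e01 (itg_cst 1)).
  by apply: eq_itg (itgD h1 h2) => x _; ring.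
have iBf : itg (fun x => kB t (1 - e) x * f x).
  have h1 := idB e _ e01 fi; have h2 := itgZ (w t / 2) (ik e _ e01 fi).
  by apply: eq_itg (itgD h1 h2) => x _; ring.
have ikt : itg (kt t e) by apply: eq_itg (ik e _ e01 (itg_cst 1)) => x _; rewrite mulr1.
have E2 : J (fun x => (kB t (1 - e) x - w t / 2 * kt t e x) * (f x - f t)) =
    J (fun x => kB t (1 - e) x * f x) - w t / 2 * pvtrunc f t e -
    f t * (J (kB t (1 - e)) - w t / 2 * (ln (1 - t) - ln (1 + t))).
  rewrite -(@ec e) ?ep// trunc_kt -JZ; last exact: ik.
  rewrite -(JZ (w t / 2) ikt) -JB//; last by apply: itgZ; exact: ik.
  rewrite -JB//; last exact: itgZ.
  rewrite -JZ; last by apply: itgB => //; exact: itgZ.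
  rewrite -JB; last 2 first.
  - by apply: itgB => //; apply: itgZ; exact: ik.
  - by apply: itgZ; apply: itgB => //; exact: itgZ.
  by apply: eq_J => x _; ring.
rewrite E1 E2 (conj_pair_kernel fG It r01); field.
by rewrite gt_eqF.
Qed.

Theorem ae_lim0_trunc f G : conj_pair f G ->
  {ae mu, forall t, I t -> lim0 (fun e => pvtrunc f t e - pi * G t)}.
Proof.
move=> fG; have [fi Gi _] := fG.
have [N1 [m1 N10 s1]] := ae_leb_point fi; have [N2 [m2 N20 s2]] := ae_leb_point Gi.
exists (N1 `|` N2); split; first exact: measurableU.
  by rewrite measureU0.
move=> t /= nP.
case: (pselect (N1 t)) => [|n1]; first by left.
right; apply: contrapT => n2; apply: nP => It.
apply: (lim0_trunc fG It).
  by apply: contrapT => L; apply: n1; apply: s1 => /= h; apply: L; exact: h.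
by apply: contrapT => L; apply: n2; apply: s2 => /= h; apply: L; exact: h.
Qed.

End principal_value.

(** * The Poincare-Bertrand identity on moments *)

Section uniqueness.
Context {R : realType}.
Implicit Types (f g h u : R -> R) (a b p : {poly R}) (s e x : R).

(** Multiplying by sin theta shifts frequencies by one up and down, so the identities for v w follow
    from those for v at the neighbouring frequencies. The constant J f / pi stems from the lowest
    case alone, where the frequency 0 of f appears without a partner. *)
Lemma conj_pair_mulw f v : conj_pair f v ->
  conj_pair (fun x => v x * w x) (fun x => J f / pi - w x * f x).
Proof.
move=> [fi vi H].
have iw h : itg h -> itg (fun x => w x * h x).
  move=> ih; apply: (itgM (M := 1)) => //; first exact: mI_w.
  by move=> x _; rewrite ger0_norm ?w_ge0 ?w_le1.
have i1 : itg (fun x => v x * w x) by apply: eq_itg (iw _ vi) => x _; rewrite mulrC.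
have i2 : itg (fun x => J f / pi - w x * f x) by apply: itgB; [exact: itg_cst|exact: iw].
split=> // n.
have iC k : itg (fun x => C 'X^k x * f x).
  by apply: (itgM (M := 1)) => //; [exact: mI_C|exact: C_le1].
have iS k : itg (fun x => S 'X^k x * v x).
  by apply: (itgM (M := 1)) => //; [exact: mI_S|exact: S_le1].
have iSw k : itg (fun x => S 'X^k x * (w x * f x)).
  by apply: (itgM (M := 1)) => //; [exact: mI_S|exact: S_le1|exact: iw].
have iS0 k : itg (fun x => S 'X^k x * (J f / pi)).
  by apply: (itgM (M := 1)); [exact: mI_S|exact: S_le1|exact: itg_cst].
rewrite (eq_J (g := fun x => S 'X^(n.+1) x * (J f / pi) - S 'X^(n.+1) x * (w x * f x))); last by move=> x _; ring.
rewrite JB// (eq_J (f := fun x => S 'X^(n.+1) x * (J f / pi)) (g := fun x => J f / pi * S 'X^(n.+1) x)); last by move=> x _; ring.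
rewrite JZ; last exact: itg_S.
rewrite J_S.
have E1 : J (fun x => S 'X^(n.+1) x * (w x * f x)) =
    2^-1 * (J (fun x => C 'X^n x * f x) - J (fun x => C 'X^(n.+2) x * f x)).
  rewrite -JB// -JZ; last exact: itgB.
  apply: eq_J => x Ix; have wx := w2 Ix.
  by rewrite !(C_Xn, S_Xn); field: wx.
have E2 : J (fun x => C 'X^(n.+1) x * (v x * w x)) =
    2^-1 * (J (fun x => S 'X^(n.+2) x * v x) - J (fun x => S 'X^n x * v x)).
  rewrite -JB// -JZ; last exact: itgB.
  apply: eq_J => x Ix; have wx := w2 Ix.
  by rewrite !(C_Xn, S_Xn); field: wx.
rewrite E1 E2 H.
case: n {E1 E2} => [|n]; last first.
  by rewrite H /= mulr0 mulr0 sub0r; ring.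
rewrite (eq_J (f := fun x => C 'X^0 x * f x) (g := f)); last by move=> x _; rewrite C_1 mul1r.
rewrite (eq_J (f := fun x => S 'X^0 x * v x) (g := fun=> 0)); last by move=> x _; rewrite S_1 mul0r.
rewrite J0 (_ : (1%N == 1)%:R = 1 :> R)// mulr1 mulrA divfK; last by rewrite gt_eqF ?pi_gt0.
by ring.
Qed.

End uniqueness.

(** * Conjugation maps L(log L)^2 to L log L in dtheta *)

Section levels.
Context {R : realType}.
Implicit Types (f g h u : R -> R) (a b p : {poly R}) (s e x : R).
Local Notation I := (I11 R).

Lemma ln2_bounds : 1 / 2 <= ln (2 : R) <= 1.
Proof.
have h1 : ln (1 + 1) <= 1 :> R by apply: le_ln1Dx; lra.
have h2 : ln (1 + - (1 / 2)) <= - (1 / 2) :> R by apply: le_ln1Dx; lra.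
move: h2; rewrite (_ : 1 + - (1 / 2) = 2^-1); last by field.
rewrite lnV ?posrE// lerN2 => ->/=.
by rewrite (_ : 2 = 1 + 1 :> R)//; ring.
Qed.

(* The sums of [lev] over k < N are comparable to a truncated logarithm: summing
   over k a weak-type splitting at height [2 ^+ k] costs one power of log. *)
Definition lev x k : R := if 2 ^+ k < x then 1 else 0.

Lemma lev_sum_ge x N : 0 <= x ->
  Num.min (lnp x) (N%:R * ln 2) <= \sum_(k < N) lev x k.
Proof.
move=> x0; elim: N => [|N IH]; first by rewrite big_ord0 mul0r ge_min lexx orbT.
have /andP[l1 l2] := @ln2_bounds.
rewrite !big_ord_recr /= [lev x N]/lev; case: ifPn => h.
  move: IH; rewrite -[N.+1%:R]natr1 mulrDl mul1r !minEle.
  case: ifP => h1; case: ifP => h2 => IH; lra.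
rewrite addr0; apply: le_trans IH.
suff : lnp x <= N%:R * ln 2.
  by move=> h1; rewrite (min_l h1) ge_min lexx.
rewrite -leNgt in h; have [x1|x1] := leP x 1.
  by rewrite lnp_le1// mulr_ge0//; lra.
rewrite (_ : N%:R * ln 2 = ln (2 ^+ N)); last by rewrite lnXn// mulr_natl.
rewrite lnp_ge1; last exact: ltW.
by rewrite ler_ln ?posrE ?exprn_gt0// (lt_trans _ x1).
Qed.

Lemma lev_sum_le x N : \sum_(k < N) lev x k <= 1 + 2 * lnp x.
Proof.
have /andP[l1 l2] := @ln2_bounds.
have : \sum_(k < N) lev x k <= N%:R /\ \sum_(k < N) lev x k <= 1 + 2 * lnp x; last by case.
elim: N => [|N [IH1 IH2]].
  by rewrite big_ord0 lexx; split=> //; have := lnp_ge0 x; lra.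
rewrite !big_ord_recr /= [lev x N]/lev; case: ifPn => h; last by rewrite addr0 IH2 (le_trans IH1)// ler_nat.
rewrite -[N.+1%:R]natr1; split; first by rewrite lerD.
have x1 : 1 <= x by apply: le_trans (ltW h); rewrite exprn_ege1// ler1n.
have : N%:R * ln 2 <= lnp x.
  rewrite lnp_ge1// mulr_natl -lnXn// ler_ln ?posrE ?exprn_gt0// ?ltW//.
  exact: lt_le_trans x1.
have : 0 <= N%:R :> R by [].
nra.
Qed.

Lemma low_sum_le x N : 0 <= x ->
  \sum_(k < N) (if x <= 2 ^+ k then x / 2 ^+ k else 0) <= 2.
Proof.
move=> x0; pose T N := \sum_(k < N) (if x <= 2 ^+ k then x / 2 ^+ k else 0).
suff : (x <= 2 ^+ N -> T N + 2 * x / 2 ^+ N <= 2) /\ (2 ^+ N < x -> T N = 0).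
  move=> [h1 h2]; rewrite -/(T N); have [h|h] := leP x (2 ^+ N); last by rewrite h2.
  by apply: le_trans (h1 h); rewrite lerDl divr_ge0 ?mulr_ge0 ?exprn_ge0.
elim: N => [|N [IH1 IH2]].
  rewrite /T big_ord0 expr0; split=> //; lra.
have p0 : 0 < (2 : R) ^+ N by rewrite exprn_gt0.
have TS : T N.+1 = T N + (if x <= 2 ^+ N then x / 2 ^+ N else 0) by rewrite /T big_ord_recr.
rewrite TS exprS; have [h|h] := leP x (2 ^+ N).
  split; last by move=> h'; exfalso; lra.
  move=> _; apply: le_trans (IH1 h); rewrite le_eqVlt; apply/orP; left; apply/eqP.
  by field; rewrite gt_eqF.
rewrite IH2// addr0; split=> // h'; rewrite add0r.
by rewrite ler_pdivrMr ?mulr_gt0//; lra.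
Qed.

(** The inequality [bound_w] for a conjugate given only by its moments, by the same duality; this
    lets it be applied to truncations. *)
Lemma L1_bound_w h G s : 0 < s -> zyg (fun x => (w x)^-1) h -> mI G -> itg (fun x => G x / w x) ->
  (forall b, J (fun x => C b x * (G x / w x)) = - J (fun x => S b x * (h x / w x))) ->
  s * J (fun x => `|G x| / w x) <= J (fun x => Phi (6 * s * `|h x|) / w x) + 16.
Proof.
move=> s0 hz mG iG H; have [mh ih _] := hz.
rewrite mulrC -ler_pdivlMr//.
rewrite (eq_J (g := fun x => `|G x / w x|)); last first.
  by move=> x Ix; rewrite normrM [`|_^-1|]ger0_norm// invr_ge0 w_ge0.
apply: J_norm_dual => // p p1; have [b Cb] := poly_C p.
have b1 x : I x -> `|C b x| <= 1 by move=> Ix; rewrite Cb// p1.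
have [iE JE] := J_exp_S b1.
have ihw : itg (fun x => h x / w x).
  apply: itg_le ih; first by apply: mI_M => //; exact: mI_rw.
  by move=> x Ix; rewrite normrM [`|_^-1|]ger0_norm// invr_ge0 w_ge0.
have [M _ HM] := CS_bounded b.
have iS : itg (fun x => S b x * (h x / w x)).
  by apply: itg_bM; [exact: mI_S|exists M => x /HM[]|].
rewrite (eq_J (g := fun x => C b x * (G x / w x))); last by move=> x Ix; rewrite Cb.
rewrite H -JN// ler_pdivlMr// mulrC.
rewrite (eq_J (g := fun x => - (S b x * h x) / w x)); last by move=> x _; rewrite mulrA mulNr.
apply: (J_young (v := S b)) => //.
- exact: mI_rw.
- exact: mI_S.
- by move=> x Ix; rewrite invr_ge0 w_ge0.
- by apply: zyg_scale hz; [exact: mI_rw|exact: rhow_gt0|rewrite mulr_ge0// ltW].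
- by apply: eq_itg (itgN iS) => x _; rewrite mulNr mulrA.
- by move=> x _; rewrite -normrM [h x * _]mulrC -normrN; exact: ler_norm.
Qed.

(** Duality again: C b is traded for S b, the product is split as half the sum of squares, and
    [J_S2_le] returns to C b. *)
Lemma L2_bound_w h G : mI h -> itg (fun x => h x ^+ 2 / w x) -> itg (fun x => h x / w x) ->
  mI G -> itg (fun x => G x / w x) ->
  (forall b, J (fun x => C b x * (G x / w x)) = - J (fun x => S b x * (h x / w x))) ->
  itg (fun x => G x ^+ 2 / w x) /\ J (fun x => G x ^+ 2 / w x) <= J (fun x => h x ^+ 2 / w x).
Proof.
move=> mh ih2 ih mG iG H; apply: J_sqr_dual => // p; have [b Cb] := poly_C p.
have [M M0 HM] := CS_bounded b.
have iS : itg (fun x => S b x * (h x / w x)).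
  by apply: itg_bM; [exact: mI_S|exists M => x /HM[]|].
rewrite (eq_J (g := fun x => C b x * (G x / w x))); last by move=> x Ix; rewrite Cb.
have b2 (k : R -> R) : mI k -> (forall x, I x -> `|k x| <= M) -> itg (fun x => k x ^+ 2 / w x).
  move=> mk kM; apply: (itg_b_rw (M := M ^+ 2)); first exact: mI_X.
  by move=> x Ix; rewrite normrX lerXn2r ?nnegrE ?kM.
have iS2 : itg (fun x => S b x ^+ 2 / w x) by apply: b2; [exact: mI_S|move=> x /HM[]].
have iC2 : itg (fun x => C b x ^+ 2 / w x) by apply: b2; [exact: mI_C|move=> x /HM[]].
rewrite H -JN//; apply: (@le_trans _ _ (J (fun x => 2^-1 * (h x ^+ 2 / w x) + 2^-1 * (S b x ^+ 2 / w x)))).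
  apply: J_le; [exact: itgN|by apply: itgD; apply: itgZ|move=> x Ix].
  rewrite mulrA -mulNr !mulrA -mulrDl ler_wpM2r ?invr_ge0 ?w_ge0//.
  have := sqr_ge0 (h x + S b x); nra.
rewrite JD ?JZ//; [|exact: itgZ|exact: itgZ].
rewrite (eq_J (f := fun x => p.[x] ^+ 2 / w x) (g := fun x => C b x ^+ 2 / w x)); last by move=> x Ix; rewrite Cb.
have := J_S2_le b; lra.
Qed.

Definition trunc_hi h k x := if 2 ^+ k < `|h x| then h x else 0.
Definition trunc_lo h k x := if 2 ^+ k < `|h x| then 0 else h x.

(** Each level below |h| costs at most 12 |h| (5 + 2 log^+ |h|), and there are O(1 + log^+ |h|) of
    them, which produces the squared logarithm; the levels above |h| form a geometric series. *)
Lemma level_bound h N x :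
  \sum_(k < N) (2 * (Phi (6 * 2 ^+ k * `|trunc_hi h k x|) / 2 ^+ k) +
    4 / 2 ^+ k * trunc_lo h k x ^+ 2) <= 200 * `|h x| * (1 + lnp `|h x| ^+ 2).
Proof.
have h0 := normr_ge0 (h x); set y := `|h x| in h0 *; set L := lnp y.
have L0 : 0 <= L by exact: lnp_ge0.
have H k : 2 * (Phi (6 * 2 ^+ k * `|trunc_hi h k x|) / 2 ^+ k) + 4 / 2 ^+ k * trunc_lo h k x ^+ 2 <=
    12 * y * (5 + 2 * L) * lev y k + 4 * y * (if y <= 2 ^+ k then y / 2 ^+ k else 0).
  have p0 : 0 < (2 : R) ^+ k by rewrite exprn_gt0.
  rewrite /trunc_hi /trunc_lo /lev -/y; case: ifPn => hk; last first.
    rewrite -leNgt in hk; rewrite hk normr0 mulr0 /Phi mul0r mul0r !mulr0 !add0r.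
    rewrite -[h x ^+ 2]real_normK ?num_real// -/y expr2.
    by rewrite le_eqVlt; apply/orP; left; apply/eqP; field; rewrite gt_eqF.
  have -> : (y <= 2 ^+ k) = false by apply/negbTE; rewrite -ltNge.
  rewrite expr0n /= !mulr0 !addr0 mulr1 -/y /Phi.
  rewrite (_ : 2 * _ = 12 * y * lnp (6 * 2 ^+ k * y)); last by field; rewrite gt_eqF.
  apply: ler_wpM2l; first by rewrite mulr_ge0.
  have l6 : lnp (6 : R) <= 5.
    by rewrite lnp_ge1 ?ler1n//; have := @le_ln1Dx R 5; rewrite (_ : 1 + 5 = 6 :> R); [apply; lra|ring].
  have lk : lnp (2 ^+ k) <= L by apply: le_lnp; exact: ltW.
  have l1 := @lnpM R (6 * 2 ^+ k) y.
  have l2 := @lnpM R 6 (2 ^+ k).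
  apply: (le_trans (l1 _ _)) => //.
  apply: (@le_trans _ _ (lnp 6 + lnp (2 ^+ k) + L)); last by lra.
  by rewrite lerD2r l2// ltW.
apply: (le_trans (ler_sum _ (fun (k : 'I_N) _ => H k))).
rewrite big_split /= -!mulr_sumr.
have s1 := lev_sum_le y N; have s2 := low_sum_le N h0.
have s1' : 0 <= \sum_(k < N) lev y k by apply: sumr_ge0 => k _; rewrite /lev; case: ifP.
apply: (@le_trans _ _ (12 * y * (5 + 2 * L) * (1 + 2 * L) + 4 * y * 2)).
  by rewrite lerD// ler_wpM2l// ?mulr_ge0//; lra.
rewrite (_ : 12 * y * (5 + 2 * L) * (1 + 2 * L) + 4 * y * 2 = y * (68 + 144 * L + 48 * L ^+ 2)); last by ring.
rewrite (_ : 200 * y * (1 + L ^+ 2) = y * (200 + 200 * L ^+ 2)); last by ring.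
by rewrite ler_wpM2l//; have := sqr_ge0 (L - 1); nra.
Qed.

(** Interpolation between the L^1 bound at scale 2^k and the L^2 bound: h is cut at height 2^k, the
    integral of |G| over {|G| > 2^k} is estimated through both pieces, and summing over k restores
    the logarithm in [Phi |G|]. *)
Theorem conj_LlogL2_w h : mI h -> itg (fun x => h x / w x) ->
  itg (fun x => `|h x| * lnp `|h x| ^+ 2 / w x) -> exists G,
  [/\ mI G, itg (fun x => G x / w x), itg (fun x => Phi `|G x| / w x) &
    forall b, J (fun x => C b x * (G x / w x)) = - J (fun x => S b x * (h x / w x))].
Proof.
move=> mh ih ih2.
have wi0 x : 0 <= (w x)^-1 by rewrite invr_ge0 w_ge0.
have ihn : itg (fun x => `|h x| / w x).
  by apply: eq_itg (itg_norm ih) => x _; rewrite normrM [`|_^-1|]ger0_norm.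
have hz : zyg (fun x => (w x)^-1) h.
  split=> //; apply: itg_le (itgD ihn ih2).
    by apply: mI_M; [apply: mI_Phi; exact: mI_norm|exact: mI_rw].
  move=> x _; rewrite -mulrDl normrM [`|_^-1|]ger0_norm// [`|Phi _|]ger0_norm ?Phi_ge0//.
  apply: ler_wpM2r => //.
  rewrite /Phi; have := lnp_ge0 `|h x|; have := normr_ge0 (h x).
  by have := sqr_ge0 (lnp `|h x| - 1); nra.
have [G [mG iG HG]] := conj_exists_w hz; exists G; split=> //.
have mhi k : mI (trunc_hi h k).
  by apply: mI_iflt => //; [exact: mI_cst|exact: mI_norm|exact: mI_cst].
have mlo k : mI (trunc_lo h k).
  by apply: mI_iflt => //; [exact: mI_cst|exact: mI_norm|exact: mI_cst].
have hiz k : zyg (fun x => (w x)^-1) (trunc_hi h k).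
  apply: zyg_le hz; [exact: mI_rw|exact: rhow_gt0|exact: mhi|move=> x Ix].
  by rewrite /trunc_hi; case: ifP; rewrite ?normr0.
have ihi k : itg (fun x => trunc_hi h k x / w x).
  apply: itg_le ihn; first by apply: mI_M => //; exact: mI_rw.
  move=> x _; rewrite normrM [`|_^-1|]ger0_norm// ler_wpM2r//.
  by rewrite /trunc_hi; case: ifP; rewrite ?normr0.
have ilo k : itg (fun x => trunc_lo h k x / w x).
  apply: itg_le ihn; first by apply: mI_M => //; exact: mI_rw.
  move=> x _; rewrite normrM [`|_^-1|]ger0_norm// ler_wpM2r//.
  by rewrite /trunc_lo; case: ifP; rewrite ?normr0.
have ilo2 k : itg (fun x => trunc_lo h k x ^+ 2 / w x).
  apply: (itg_b_rw (M := (2 ^+ k) ^+ 2)); first exact: mI_X.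
  move=> x _; rewrite normrX lerXn2r ?nnegrE ?exprn_ge0//.
  by rewrite /trunc_lo; case: ifPn => hk; rewrite ?normr0 ?exprn_ge0// leNgt.
have key k : J (fun x => (if 2 ^+ k < `|G x| then `|G x| else 0) / w x) <=
    J (fun x => (2 * (Phi (6 * 2 ^+ k * `|trunc_hi h k x|) / 2 ^+ k) +
      4 / 2 ^+ k * trunc_lo h k x ^+ 2) / w x) + 32 / 2 ^+ k.
  have p0 : 0 < (2 : R) ^+ k by rewrite exprn_gt0.
  have [Gh [mGh iGh HGh]] := conj_exists_w (hiz k).
  (* The low part is defined as a difference, so that G is split exactly; by linearity it has the
     moments of the conjugate of [trunc_lo h k]. *)
  pose Gl x := G x - Gh x.
  have mGl : mI Gl by exact: mI_B.
  have iGl : itg (fun x => Gl x / w x).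
    by apply: eq_itg (itgB iG iGh) => x _; rewrite mulrBl.
  have HGl b : J (fun x => C b x * (Gl x / w x)) = - J (fun x => S b x * (trunc_lo h k x / w x)).
    have [M _ HM] := CS_bounded b.
    have iC g : itg g -> itg (fun x => C b x * g x).
      by move=> ig; apply: itg_bM => //; [exact: mI_C|exists M => x /HM[]].
    have iS g : itg g -> itg (fun x => S b x * g x).
      by move=> ig; apply: itg_bM => //; [exact: mI_S|exists M => x /HM[]].
    rewrite (eq_J (g := fun x => C b x * (G x / w x) - C b x * (Gh x / w x))); last first.
      by move=> x _; rewrite /Gl; ring.
    rewrite JB; [|exact: iC|exact: iC].
    rewrite HG HGh -opprD; congr (- _).
    rewrite -JB; [|exact: iS|exact: iS].
    apply: eq_J => x _; rewrite /trunc_hi /trunc_lo; case: ifP => _; ring.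
  have [iG2 J2] := L2_bound_w (mlo k) (ilo2 k) (ilo k) mGl iGl HGl.
  have J1 := L1_bound_w p0 (hiz k) mGh iGh HGh.
  have iP : itg (fun x => Phi (6 * 2 ^+ k * `|trunc_hi h k x|) / w x).
    apply: zyg_scale (hiz k); [exact: mI_rw|exact: rhow_gt0|].
    by rewrite mulr_ge0// ltW.
  have iGhn : itg (fun x => `|Gh x| / w x).
    by apply: eq_itg (itg_norm iGh) => x _; rewrite normrM [`|_^-1|]ger0_norm.
  have iGn : itg (fun x => `|G x| / w x).
    by apply: eq_itg (itg_norm iG) => x _; rewrite normrM [`|_^-1|]ger0_norm.
  (* Where |Gl| <= |Gh|, |G| is at most 2 |Gh|. Otherwise |G| <= 2 |Gl|, and since |G| > 2^k also
     |G| <= |G|^2 / 2^k <= 4 |Gl|^2 / 2^k. *)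
  apply: (@le_trans _ _ (J (fun x => 2 * (`|Gh x| / w x) + 4 / 2 ^+ k * (Gl x ^+ 2 / w x)))).
    apply: J_le; last first.
    - move=> x _; rewrite (mulrA 2) (mulrA (4 / 2 ^+ k) (Gl x ^+ 2)) -mulrDl ler_wpM2r//.
      have q0 : 0 <= 4 / 2 ^+ k * Gl x ^+ 2 by rewrite mulr_ge0 ?sqr_ge0 ?divr_ge0 ?(ltW p0).
      case: ifPn => hk; last by rewrite addr_ge0// mulr_ge0.
      have tri : `|G x| <= `|Gh x| + `|Gl x|.
        by apply: le_trans (ler_normD _ _); rewrite /Gl addrC subrK.
      have := normr_ge0 (Gh x); have := normr_ge0 (Gl x) => l0 h0.
      have [hl|hl] := leP `|Gl x| `|Gh x|.
        by rewrite -[leLHS]addr0 lerD//; lra.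
      apply: (@le_trans _ _ (4 / 2 ^+ k * Gl x ^+ 2)); last by rewrite lerDr mulr_ge0.
      rewrite -[Gl x ^+ 2]real_normK ?num_real// mulrAC ler_pdivlMr//.
      apply: (@le_trans _ _ (`|G x| * `|G x|)); first by rewrite ler_wpM2l// ltW.
      nra.
    - by apply: itgD; apply: itgZ.
    - apply: itg_le iGn; last first.
        move=> x _; case: ifP => _; first by rewrite normrM normr_id [`|_^-1|]ger0_norm.
        by rewrite mul0r normr0 mulr_ge0.
      apply: mI_M; last exact: mI_rw.
      by apply: mI_iflt; [exact: mI_cst|exact: mI_norm|exact: mI_norm|exact: mI_cst].
  rewrite JD; [|exact: itgZ|exact: itgZ].
  rewrite JZ// JZ//.
  rewrite (eq_J (f := fun x => (_ + _) / w x) (g := fun x => 2 / 2 ^+ k * (Phi (6 * 2 ^+ k * `|trunc_hi h k x|) / w x) +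
    4 / 2 ^+ k * (trunc_lo h k x ^+ 2 / w x))); last by move=> x _; ring.
  rewrite JD; [|exact: itgZ|exact: itgZ].
  rewrite JZ// JZ// addrAC lerD//; last by rewrite ler_wpM2l// divr_ge0// ltW.
  rewrite (_ : 2 / 2 ^+ k * _ + 32 / 2 ^+ k = 2 * ((J (fun x => Phi (6 * 2 ^+ k * `|trunc_hi h k x|) / w x) + 16) / 2 ^+ k)); last first.
    by field; rewrite gt_eqF.
  by rewrite ler_wpM2l// ler_pdivlMr// mulrC.
(* With finitely many levels only a logarithm cut at N ln 2 is recovered; Fatou's lemma removes the
   cut. The 64 in B is the sum of the additive terms 32 / 2^k. *)
pose F N x := `|G x| * Num.min (lnp `|G x|) (N%:R * ln 2) / w x.
have F0 N x : 0 <= F N x.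
  have /andP[l1 l2] := @ln2_bounds.
  rewrite /F !mulr_ge0// le_min lnp_ge0 mulr_ge0//; lra.
have iGn : itg (fun x => `|G x| / w x).
  by apply: eq_itg (itg_norm iG) => x _; rewrite normrM [`|_^-1|]ger0_norm.
have mF N : mI (F N).
  apply: mI_M; last exact: mI_rw.
  apply: mI_M; first exact: mI_norm.
  by apply: mI_min; [apply: mI_lnp; exact: mI_norm|exact: mI_cst].
have iF N : itg (F N).
  apply: itg_le (itgZ (N%:R * ln 2) iGn) => // x _; rewrite ger0_norm// /F [`|G x| * _]mulrC -[leLHS]mulrA.
  by rewrite ler_wpM2r ?mulr_ge0// ge_min lexx orbT.
pose B := 200 * (J (fun x => `|h x| / w x) + J (fun x => `|h x| * lnp `|h x| ^+ 2 / w x)) + 64.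
have JF N : J (F N) <= B.
  pose T k x := (if 2 ^+ k < `|G x| then `|G x| else 0) / w x.
  have iT k : itg (T k).
    apply: itg_le iGn; last first.
      move=> x _; rewrite /T; case: ifP => _; first by rewrite normrM normr_id [`|_^-1|]ger0_norm.
      by rewrite mul0r normr0 mulr_ge0.
    apply: mI_M; last exact: mI_rw.
    by apply: mI_iflt; [exact: mI_cst|exact: mI_norm|exact: mI_norm|exact: mI_cst].
  apply: (@le_trans _ _ (J (fun x => \sum_(k < N) T k x))).
    apply: J_le => //; first exact: itg_sum.
    move=> x _; rewrite /T /F -mulr_suml ler_wpM2r//.
    have := lev_sum_ge N (normr_ge0 (G x)).
    move=> /(ler_wpM2l (normr_ge0 (G x))) /le_trans; apply.
    by rewrite mulr_sumr ler_sum// => k _; rewrite /lev; case: ifP; rewrite ?mulr1 ?mulr0.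
  rewrite J_sum//; apply: (le_trans (ler_sum _ (fun (k : 'I_N) _ => key k))).
  rewrite big_split /= -J_sum; last first.
    move=> k; have p0 : 0 < (2 : R) ^+ k by rewrite exprn_gt0.
    have iP : itg (fun x => Phi (6 * 2 ^+ k * `|trunc_hi h k x|) / w x).
      apply: zyg_scale (hiz k); [exact: mI_rw|exact: rhow_gt0|].
      by rewrite mulr_ge0// ltW.
    apply: eq_itg (itgD (itgZ (2 / 2 ^+ k) iP) (itgZ (4 / 2 ^+ k) (ilo2 k))) => x _; ring.
  apply: lerD.
    rewrite -JD//; rewrite -JZ; last exact: itgD.
    apply: J_le; [|by apply: itgZ; exact: itgD|].
      apply: itg_sum => k; have p0 : 0 < (2 : R) ^+ k by rewrite exprn_gt0.
      have iP : itg (fun x => Phi (6 * 2 ^+ k * `|trunc_hi h k x|) / w x).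
        apply: zyg_scale (hiz k); [exact: mI_rw|exact: rhow_gt0|].
        by rewrite mulr_ge0// ltW.
      apply: eq_itg (itgD (itgZ (2 / 2 ^+ k) iP) (itgZ (4 / 2 ^+ k) (ilo2 k))) => x _; ring.
    move=> x _; rewrite -mulr_suml; apply: (le_trans (ler_wpM2r (wi0 x) (level_bound h N x))).
    by rewrite le_eqVlt; apply/orP; left; apply/eqP; ring.
  rewrite -mulr_sumr (_ : 64 = 32 * 2); last by ring.
  rewrite ler_wpM2l//.
  suff -> : \sum_(k < N) ((2 : R) ^+ k)^-1 = 2 - 2 * 2^-1 ^+ N.
    by rewrite gerBl mulr_ge0 ?exprn_ge0.
  elim: (N) => [|m IHm]; first by rewrite big_ord0 expr0; ring.
  by rewrite big_ord_recr /= IHm exprS exprVn; field; rewrite expf_neq0.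
have [] // := @J_fatou R F (fun x => Phi `|G x| / w x) B iF (fun N x _ => F0 N x) JF.
  by apply: mI_M; [apply: mI_Phi; exact: mI_norm|exact: mI_rw].
move=> x _; have [N0 HN0] := ex_nat_ge (2 * lnp `|G x|).
apply: (cvg_eventually (N := N0)) => N hN; rewrite /F /Phi; congr (_ * _ / _).
have /andP[l1 l2] := @ln2_bounds; have := HN0 N hN; have := lnp_ge0 `|G x|.
by move=> a1 a2; apply/min_idPl; nra.
Qed.

End levels.

(** * Inversion of the transform on L(log L)^2 *)

Section range_LlogL2.
Context {R : realType}.
Implicit Types (f g h u : R -> R) (a b p : {poly R}) (s e x : R).
Local Notation mu := (@lebesgue_measure R).
Local Notation I := (I11 R).

Lemma itg_root34 s : `|s| = 1 -> itg (fun x => (sqrtr (1 - s * x) * sqrtr (sqrtr (1 - s * x)))^-1).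
Proof.
move=> s1.
have pos x : -1 < x < 1 -> 0 < 1 - s * x.
  move=> x1; rewrite subr_gt0 (le_lt_trans (ler_norm _))// normrM s1 mul1r.
  by rewrite ltr_norml.
have s2 : s ^+ 2 = 1 by rewrite -[s ^+ 2]real_normK ?num_real// s1 expr1n.
pose F x := - (4 * s * sqrtr (sqrtr (1 - s * x))).
have c1 : continuous (fun x => 1 - s * x).
  by move=> x; apply: cvgB; [exact: cvg_cst|apply: cvgM; [exact: cvg_cst|exact: cvg_id]].
have c2 : continuous (fun x => sqrtr (1 - s * x)).
  by move=> x; apply: continuous_comp; [exact: c1|exact: sqrt_continuous].
have c3 : continuous (fun x => sqrtr (sqrtr (1 - s * x))).
  by move=> x; apply: continuous_comp; [exact: c2|exact: sqrt_continuous].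
have cF : continuous F.
  by move=> x; apply: cvgN; apply: cvgM; [exact: cvg_cst|exact: c3].
have H : (\int[mu]_(x in I) ((sqrtr (1 - s * x) * sqrtr (sqrtr (1 - s * x)))^-1)%:E = (F 1 - F (-1))%:E)%E.
  apply: (@improper_FTC R (fun x => (sqrtr (1 - s * x) * sqrtr (sqrtr (1 - s * x)))^-1) F (-1) 1 (F (-1)) (F 1)).
  - by lra.
  - by move=> x _; rewrite invr_ge0 mulr_ge0 ?sqrtr_ge0.
  - move=> x /pos x0; apply: cvgV; first by rewrite mulf_neq0// gt_eqF ?sqrtr_gt0.
    by apply: cvgM; [exact: c2|exact: c3].
  - move=> x /pos x0.
    have d1 : is_derive x 1 (fun x => 1 - s * x) (- s).
      have := is_deriveB (@is_derive_cst _ _ R^o (1 : R) x 1) (is_deriveZ s (is_derive_id x 1)).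
      by rewrite /GRing.scale /= mulr1 sub0r.
    have d2 := @is_derive1_comp _ sqrtr (fun x => 1 - s * x) x _ _ (is_derive1_sqrt x0) d1.
    have y0 : 0 < sqrtr (1 - s * x) by rewrite sqrtr_gt0.
    have d3 := @is_derive1_comp _ sqrtr (fun x => sqrtr (1 - s * x)) x _ _ (is_derive1_sqrt y0) d2.
    have d4 := is_deriveZ (- (4 * s)) d3.
    rewrite (_ : (sqrtr (1 - s * x) * sqrtr (sqrtr (1 - s * x)))^-1 =
      - (4 * s) *: ((2 * sqrtr (sqrtr (1 - s * x)))^-1 * ((2 * sqrtr (1 - s * x))^-1 * - s))).
      rewrite (_ : F = - (4 * s) \*: (sqrtr \o (fun x => sqrtr (1 - s * x))))//.
      by apply/funext => y; rewrite /F -mulNr.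
    rewrite /GRing.scale /=; field: s2.
    by rewrite !gt_eqF ?sqrtr_gt0.
  - by apply: cvg_at_right_filter; exact: cF.
  - by apply: cvg_at_left_filter; exact: cF.
apply: itg_ge0P => [|x _|]; last by rewrite H ltry.
  by apply: mI_V; apply: mI_M; apply: mI_cont.
by rewrite invr_ge0 mulr_ge0 ?sqrtr_ge0.
Qed.

(** Since w^2 = (1 - x) (1 + x), the function w^(-3/2) is a product of powers -3/4, and on each half
    of the interval one of the two factors is at most 1. *)
Lemma itg_w32 : itg (fun x : R => (w x * sqrtr (w x))^-1).
Proof.
have n1 : `|1| = 1 :> R by rewrite normr1.
have n2 : `|-1| = 1 :> R by rewrite normrN normr1.
apply: itg_le (itgD (itg_root34 n1) (itg_root34 n2)).
  apply: mI_V; apply: mI_M; first exact: mI_w.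
  apply: mI_cont => x; apply: continuous_comp; [exact: continuous_w|exact: sqrt_continuous].
move=> x /I11P/andP[x0 x1].
rewrite mul1r mulN1r opprK; pose A : R := 1 - x; pose B : R := 1 + x; rewrite -/A -/B.
have A0 : 0 < A by rewrite /A; lra.
have B0 : 0 < B by rewrite /B; lra.
have wE : w x = sqrtr A * sqrtr B.
  by rewrite -sqrtrM ?(ltW A0)// /w; congr sqrtr; rewrite /A /B; ring.
have sA : 0 < sqrtr A by rewrite sqrtr_gt0.
have sB : 0 < sqrtr B by rewrite sqrtr_gt0.
have ssA : 0 < sqrtr (sqrtr A) by rewrite sqrtr_gt0.
have ssB : 0 < sqrtr (sqrtr B) by rewrite sqrtr_gt0.
rewrite wE sqrtrM ?(ltW sA)// ger0_norm; last first.
  by rewrite invr_ge0 !mulr_ge0// ltW.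
have one (D : R) : 1 <= D -> (sqrtr D * sqrtr (sqrtr D))^-1 <= 1.
  move=> C1; have sC : 1 <= sqrtr D by rewrite -sqrtr1 ler_wsqrtr.
  by rewrite invf_le1 ?mulr_ege1// ?mulr_gt0 ?sqrtr_gt0 ?(lt_le_trans _ C1) ?(lt_le_trans _ sC)// -sqrtr1 ler_wsqrtr.
rewrite (_ : (_ * _ * (_ * _))^-1 = (sqrtr A * sqrtr (sqrtr A))^-1 * (sqrtr B * sqrtr (sqrtr B))^-1); last first.
  by field; rewrite !gt_eqF.
have pA : 0 <= (sqrtr A * sqrtr (sqrtr A))^-1 by rewrite invr_ge0 mulr_ge0 ?sqrtr_ge0.
have pB : 0 <= (sqrtr B * sqrtr (sqrtr B))^-1 by rewrite invr_ge0 mulr_ge0 ?sqrtr_ge0.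
have [xl|xl] := leP 0 x.
  have B1 : 1 <= B by rewrite /B; lra.
  by have := one B B1; nra.
have A1 : 1 <= A by rewrite /A; lra.
by have := one A A1; nra.
Qed.

(** For h = w g the measure h dtheta is g dx, so hypotheses in dx become hypotheses in dtheta. Going
    back, [Phi] of |G| / w picks up a term |G| log (1 / w) / w, which Young's inequality dominates
    by [Phi |G| / w] and w^(-3/2). *)
Theorem conj_pair_onto g : mI g -> itg g -> itg (fun x => `|g x| * lnp `|g x| ^+ 2) ->
  exists2 f, zyg (fun=> 1) f & conj_pair f g.
Proof.
move=> mg ig ig2.
have wi0 x : 0 <= (w x)^-1 by rewrite invr_ge0 w_ge0.
pose h x := g x * w x.
have mh : mI h by apply: mI_M => //; exact: mI_w.
have hw x : I x -> h x / w x = g x by move=> Ix; rewrite /h mulfK// w_neq0.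
have ih : itg (fun x => h x / w x) by apply: eq_itg ig => x Ix; rewrite hw.
have ih2 : itg (fun x => `|h x| * lnp `|h x| ^+ 2 / w x).
  apply: itg_le ig2.
    apply: mI_M; last exact: mI_rw.
    apply: mI_M; first exact: mI_norm.
    by apply: mI_X; apply: mI_lnp; exact: mI_norm.
  move=> x Ix; rewrite ger0_norm; last by rewrite mulr_ge0 ?wi0// mulr_ge0// sqr_ge0.
  rewrite /h normrM (ger0_norm (w_ge0 x)).
  rewrite mulrAC mulfK ?w_neq0// ler_wpM2l// lerXn2r ?nnegrE ?lnp_ge0//.
  by apply: le_lnp; rewrite ler_piMr// w_le1.
have [G [mG iG iPG HG]] := conj_LlogL2_w mh ih ih2.
pose f x := - (G x / w x).
have fi : itg f by exact: itgN.
have mf : mI f by exact: itg_m.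
exists f; last first.
  split=> // n; rewrite [RHS](eq_J (g := fun x => - (C 'X^(n.+1) x * (G x / w x)))) ?JN.
  - by rewrite HG opprK; apply: eq_J => x Ix; rewrite hw.
  - by apply: (itgM (M := 1)) => //; [exact: mI_C|exact: C_le1].
  - by move=> x _; rewrite /f; ring.
split=> //; first by apply: eq_itg (itg_norm fi) => x _; rewrite mulr1.
apply: itg_le (itgD (itgZ 3 iPG) (itgZ 2 itg_w32)).
  by apply: mI_M; [apply: mI_Phi; exact: mI_norm|exact: mI_cst].
move=> x Ix; have w0 := w_gt0 Ix; have w1 := w_le1 x.
rewrite mulr1 ger0_norm ?Phi_ge0// /f normrN normrM (ger0_norm (wi0 x)).
set y := `|G x|; have y0 : 0 <= y by exact: normr_ge0.
(* Young's inequality at ln (1 / v) costs 1 / v, and 1 / (v w) is integrable; at ln (1 / w) it would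
   cost 1 / w^2, which is not. *)
pose v := sqrtr (w x); have v0 : 0 < v by rewrite sqrtr_gt0.
have wv : w x = v ^+ 2 by rewrite sqr_sqrtr// ltW.
have v1 : v <= 1 by rewrite -sqrtr1 ler_wsqrtr.
have E : lnp (w x)^-1 = 2 * ln v^-1.
  rewrite lnp_ge1; last by rewrite invf_ge1.
  by rewrite wv -exprVn lnXn ?invr_gt0// mulr_natl.
have yg : y * ln v^-1 <= Phi y + v^-1.
  by have := @young R y (ln v^-1) y0; rewrite lnK ?posrE ?invr_gt0.
rewrite /Phi; apply: (@le_trans _ _ (y / w x * (lnp y + lnp (w x)^-1))).
  by apply: ler_wpM2l; [exact: mulr_ge0|apply: lnpM].
rewrite E (_ : y / w x * (lnp y + 2 * ln v^-1) = (y * lnp y + 2 * (y * ln v^-1)) / w x); last by ring.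
rewrite (_ : 3 * (y * lnp y / w x) + _ = (3 * Phi y + 2 * v^-1) / w x); last first.
  by rewrite /Phi -/v; field; rewrite !gt_eqF.
by apply: ler_wpM2r => //; rewrite /Phi in yg *; lra.
Qed.

End range_LlogL2.

(** * A function of L log L whose transform leaves L log L *)

Section counterexample.
Context {R : realType}.
Implicit Types (f g h u : R -> R) (a b p : {poly R}) (s e x y t : R).
Local Notation mu := (@lebesgue_measure R).
Local Notation I := (I11 R).

Definition ell x : R := (- ln x)^-1.
(* [x^-1 |ln x|^-3] is in L log L, but its transform is at least a multiple of
   [|t|^-1 |ln |t||^-2] at the left of 0, which is not. *)
Definition cex x : R := if 0 < x < expR (-1) then ell x ^+ 3 / x else 0.

Lemma expRN1_le : expR (-1) <= 1 / 2 :> R.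
Proof.
rewrite expRN div1r lef_pV2 ?posrE ?expR_gt0//.
by have := @expR_ge1Dx R 1; rewrite (_ : 1 + 1 = 2 :> R)//; ring.
Qed.

Lemma Nln_gt1 x : 0 < x < expR (-1) -> 1 < - ln x.
Proof.
by move=> /andP[x0 x1]; rewrite ltrNr -[ltRHS]expRK ltr_ln ?posrE ?expR_gt0.
Qed.

Lemma ell_gt0 x : 0 < x < 1 -> 0 < ell x.
Proof. by move=> x01; rewrite /ell invr_gt0 oppr_gt0 ln_lt0. Qed.

Lemma ell_lt1 x : 0 < x < expR (-1) -> 0 < ell x < 1.
Proof.
move=> x01; have h := Nln_gt1 x01.
by rewrite /ell invr_gt0 invf_lt1 ?h (lt_trans _ h).
Qed.

Lemma is_derive_ell x : 0 < x < 1 -> is_derive x 1 ell (ell x ^+ 2 / x).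
Proof.
move=> x01; case/andP: (x01) => x0 x1.
have l0 : - ln x != 0 by rewrite gt_eqF// oppr_gt0 ln_lt0.
have d1 := is_deriveN (is_derive1_ln x0).
have := @is_deriveV _ (fun y => - ln y) x _ 1 l0 d1.
by congr is_derive; rewrite /ell /GRing.scale /= mulrNN exprVn.
Qed.

Lemma continuous_ell x : 0 < x < 1 -> {for x, continuous ell}.
Proof.
move=> /andP[x0 x1]; apply: cvgV; first by rewrite gt_eqF// oppr_gt0 ln_lt0 ?x0.
by apply: cvgN; exact: continuous_ln.
Qed.

Lemma cvg_ell0 : ell x @[x --> 0^'+] --> 0.
Proof.
apply/cvgrPdist_le => e e0; near=> x.
have x0 : 0 < x by near: x; exact: nbhs_right_gt.
have x1 : x < expR (-1) by near: x; apply: nbhs_right_lt; exact: expR_gt0.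
have x2 : x < expR (- e^-1) by near: x; apply: nbhs_right_lt; exact: expR_gt0.
have /andP[l0 _] : 0 < ell x < 1 by apply: ell_lt1; rewrite x0.
rewrite sub0r normrN gtr0_norm// /ell -[leRHS]invrK lef_pV2 ?posrE ?invr_gt0//.
  by rewrite lerNr -[leRHS]expRK ler_ln ?posrE ?expR_gt0// ltW.
by move: l0; rewrite /ell invr_gt0.
Unshelve. all: by end_near. Qed.

Lemma int_ell2 y : 0 < y < 1 ->
  (\int[mu]_(x in `]0%R, y[) (ell x ^+ 2 / x)%:E = (ell y)%:E)%E.
Proof.
move=> y01; case/andP: (y01) => y0 y1.
rewrite (_ : ell y = ell y - 0); last by rewrite subr0.
apply: (@improper_FTC R (fun x => ell x ^+ 2 / x) ell 0 y 0 (ell y)) => //.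
- by move=> x /andP[x0 _]; rewrite divr_ge0 ?sqr_ge0// ltW.
- move=> x /andP[x0 xy]; have x1 : 0 < x < 1 by rewrite x0 (lt_trans xy).
  have cl := continuous_ell x1.
  apply: cvgM; first by apply: cvgM.
  by apply: cvgV; [rewrite gt_eqF|exact: cvg_id].
- by move=> x /andP[x0 xy]; apply: is_derive_ell; rewrite x0 (lt_trans xy).
- exact: cvg_ell0.
- by apply: cvg_at_left_filter; exact: continuous_ell.
Qed.

Lemma int_ell3 y : 0 < y < 1 ->
  (\int[mu]_(x in `]0%R, y[) (ell x ^+ 3 / x)%:E = (ell y ^+ 2 / 2)%:E)%E.
Proof.
move=> y01; case/andP: (y01) => y0 y1.
rewrite (_ : ell y ^+ 2 / 2 = 2^-1 * (ell y * ell y) - 0); last by rewrite subr0; ring.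
apply: (@improper_FTC R (fun x => ell x ^+ 3 / x) (fun x => 2^-1 * (ell x * ell x)) 0 y 0 (2^-1 * (ell y * ell y))) => //.
- move=> x /andP[x0 xy]; have x1 : 0 < x < 1 by rewrite x0 (lt_trans xy).
  by rewrite divr_ge0 ?exprn_ge0// ltW// ell_gt0.
- move=> x /andP[x0 xy]; have x1 : 0 < x < 1 by rewrite x0 (lt_trans xy).
  have cl := continuous_ell x1.
  apply: cvgM; first by apply: cvgM => //; apply: cvgM.
  by apply: cvgV; [rewrite gt_eqF|exact: cvg_id].
- move=> x /andP[x0 xy]; have x1 : 0 < x < 1 by rewrite x0 (lt_trans xy).
  have d := is_derive_ell x1.
  have := is_deriveZ 2^-1 (is_deriveM d d).
  by congr is_derive; rewrite /GRing.scale /=; field; rewrite gt_eqF.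
- rewrite [X in _ --> X](_ : _ = 2^-1 * (0 * 0)); last by rewrite !mulr0.
  apply: cvgM; first exact: cvg_cst.
  by apply: cvgM; exact: cvg_ell0.
- apply: cvg_at_left_filter; apply: cvgM; first exact: cvg_cst.
  by apply: cvgM; exact: continuous_ell.
Qed.

Lemma mI_ell : mI ell.
Proof. by apply: mI_V; apply: mI_N; apply: mI_ln; exact: mI_id. Qed.

Lemma mI_if01 f (c d : R) : mI f -> mI (fun x => if c < x < d then f x else 0).
Proof.
move=> mf; apply: (eq_mI (f := fun x => if c < x then (if x < d then f x else 0) else 0)).
  by move=> x _; case: ifP.
apply: mI_iflt; [exact: mI_cst|exact: mI_id| |exact: mI_cst].
by apply: mI_iflt => //; [exact: mI_id|exact: mI_cst|exact: mI_cst].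
Qed.

Lemma mI_cex : mI cex.
Proof.
apply: mI_if01; apply: mI_M; last by apply: mI_V; exact: mI_id.
by apply: mI_X; exact: mI_ell.
Qed.

Lemma cex_ge0 x : 0 <= cex x.
Proof.
rewrite /cex; case: ifPn => // x01; case/andP: (x01) => x0 _.
by rewrite divr_ge0 ?exprn_ge0// ltW//; case/andP: (ell_lt1 x01).
Qed.

Lemma expRN1_lt1 : expR (-1) < 1 :> R.
Proof. by have := expRN1_le; lra. Qed.

Lemma zyg_cex : zyg (fun=> 1) cex.
Proof.
have e1 := expRN1_lt1; have e0 := expR_gt0 (-1 : R).
pose k x := if 0 < x < expR (-1) then ell x ^+ 2 / x else 0.
have mk : mI k.
  apply: mI_if01; apply: mI_M; last by apply: mI_V; exact: mI_id.
  by apply: mI_X; exact: mI_ell.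
have ik : itg k.
  apply: itg_ge0P => //.
    move=> x _; rewrite /k; case: ifP => // /andP[x0 _].
    by rewrite divr_ge0 ?sqr_ge0// ltW.
  by rewrite int_I_sub ?int_ell2 ?ltry ?(ltW e1) ?lerN10// e0.
have le x : cex x <= k x /\ Phi (cex x) <= k x.
  rewrite /cex /k; case: ifPn => x01; last by rewrite /Phi mul0r lexx.
  case/andP: (x01) => x0 x1; have /andP[l0 l1] := ell_lt1 x01.
  have lx := Nln_gt1 x01.
  have lE : ell x * - ln x = 1 by rewrite mulVf// gt_eqF// (lt_trans _ lx).
  have xi0 : 0 <= x^-1 by rewrite invr_ge0 ltW.
  have l3 : 0 <= ell x ^+ 3 <= 1 by rewrite exprn_ge0 ?exprn_ile1 ?(ltW l0) ?(ltW l1).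
  case/andP: l3 => l30 l31.
  have h : lnp (ell x ^+ 3 / x) <= - ln x.
    rewrite -lnV ?posrE//; apply: (@le_trans _ _ (lnp x^-1)).
      by apply: le_lnp; rewrite ler_piMl.
    rewrite lnp_ge1// invf_ge1//; apply: ltW; apply: lt_trans x1 _; exact: e1.
  split; first by rewrite ler_wpM2r// exprS ler_piMl ?sqr_ge0// ltW.
  rewrite /Phi; apply: (@le_trans _ _ (ell x ^+ 3 / x * - ln x)).
    by rewrite ler_wpM2l// mulr_ge0.
  rewrite (_ : ell x ^+ 3 / x * - ln x = ell x ^+ 2 / x * (ell x * - ln x)); last by ring.
  by rewrite lE mulr1.
have c0 := cex_ge0.
split; first exact: mI_cex.
  apply: itg_le ik => [|x _]; last by rewrite mulr1 normr_id ger0_norm//; case: (le x).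
  by apply: mI_M; [apply: mI_norm; exact: mI_cex|exact: mI_cst].
apply: itg_le ik => [|x _].
  by apply: mI_M; [apply: mI_Phi; apply: mI_norm; exact: mI_cex|exact: mI_cst].
by rewrite mulr1 (ger0_norm (c0 x)) ger0_norm ?Phi_ge0//; case: (le x).
Qed.

Lemma Phi_ell_ge (c0 : R) : 0 < c0 -> exists2 L0 : R, 1 <= L0 & forall y, 0 < y < expR (- L0) ->
  c0 / 2 * (ell y / y) <= Phi (c0 * (ell y ^+ 2 / y)).
Proof.
move=> c00; pose A := 2 * ln 16 - ln c0.
(* With L = - ln y, the logarithm of the argument of Phi is at least L - 2 (L / 16 + ln 16) + ln c0
   = 7 L / 8 - A, which is at least L / 2 once L >= 8 A / 3. *)
exists (1 + 3 * `|A|) => [|y /andP[y0 y1]]; first by rewrite lerDl mulr_ge0.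
pose L := - ln y.
have LL : 1 + 3 * `|A| < L by rewrite /L ltrNr -[ltRHS]expRK ltr_ln ?posrE ?expR_gt0.
have A0 := normr_ge0 A; have A1 := ler_norm A.
have L0 : 0 < L by lra.
have lE : ell y = L^-1 by [].
have z0 : 0 < c0 * (ell y ^+ 2 / y) by rewrite lE mulr_gt0// divr_gt0// exprn_gt0// invr_gt0.
have lnz : ln (c0 * (ell y ^+ 2 / y)) = ln c0 - 2 * ln L + L.
  rewrite lE lnM ?posrE ?divr_gt0 ?exprn_gt0 ?invr_gt0//.
  rewrite lnM ?posrE ?exprn_gt0 ?invr_gt0// exprVn !lnV ?posrE ?exprn_gt0//.
  by rewrite lnXn// -mulr_natl /L; ring.
have lnL : ln L <= L / 16 + ln 16.
  have L16 : 0 < L / 16 by rewrite divr_gt0.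
  have h1 : -1 < L / 16 - 1 by lra.
  by have := le_ln1Dx h1; rewrite addrC subrK ln_div ?posrE//; lra.
have h : L / 2 <= ln (c0 * (ell y ^+ 2 / y)).
  rewrite lnz; rewrite /A in A1 LL; lra.
rewrite /Phi; apply: (@le_trans _ _ (c0 * (ell y ^+ 2 / y) * (L / 2))).
  by rewrite lE le_eqVlt; apply/orP; left; apply/eqP; field; rewrite !gt_eqF.
by rewrite ler_wpM2l ?(ltW z0)//; apply: le_trans h (ln_le_lnp z0).
Qed.

Lemma int_ell_neg (c d : R) : 0 < c < d -> d < expR (-1) ->
  (\int[mu]_(x in `](- d)%R, (- c)%R[) (ell (- x) / (- x))%:E = (ln (- ln c) - ln (- ln d))%:E)%E.
Proof.
move=> /andP[c0 cd] d1; have e1 := expRN1_lt1.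
have pos x : - d <= x <= - c -> 0 < - x < 1 /\ 0 < - ln (- x).
  move=> /andP[x0 x1]; have h : 0 < - x < expR (-1) by lra.
  by split; [lra|rewrite (lt_trans _ (Nln_gt1 h))].
have cN x : {for x, continuous (fun x : R => - x)} by apply: cvgN; exact: cvg_id.
have cL x : - d <= x <= - c -> {for x, continuous (fun x => - ln (- x))}.
  move=> /pos[/andP[x0 _] l0].
  by apply: cvgN; exact: (continuous_comp (cN x) (continuous_ln x0)).
have cF x : - d <= x <= - c -> {for x, continuous (fun x => ln (- ln (- x)))}.
  move=> xcd; have [_ l0] := pos x xcd.
  exact: (continuous_comp (cL x xcd) (continuous_ln l0)).
rewrite -{2}(opprK c) -{2}(opprK d).
apply: (@improper_FTC R (fun x => ell (- x) / (- x)) (fun x => ln (- ln (- x))) (- d) (- c)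
  (ln (- ln (- - d))) (ln (- ln (- - c)))).
- by rewrite ltrN2.
- move=> x /andP[/ltW x0 /ltW x1]; have [/andP[y0 y1] l0] : 0 < - x < 1 /\ 0 < - ln (- x).
    by apply: pos; rewrite x0.
  by rewrite divr_ge0 ?(ltW y0)// ltW// ell_gt0// y0.
- move=> x /andP[/ltW x0 /ltW x1]; have [y01 l0] : 0 < - x < 1 /\ 0 < - ln (- x).
    by apply: pos; rewrite x0.
  apply: cvgM; first exact: (continuous_comp (cN x) (continuous_ell y01)).
  apply: (cvgV _ (cN x)); by rewrite gt_eqF//; case/andP: y01.
- move=> x /andP[/ltW x0 /ltW x1]; have [/andP[y0 y1] l0] : 0 < - x < 1 /\ 0 < - ln (- x).
    by apply: pos; rewrite x0.
  have d1' : is_derive x 1 (fun x : R => - x) (-1) by have := is_deriveN (is_derive_id x 1).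
  have d2 := @is_derive1_comp _ (@ln R) (fun x => - x) x _ _ (is_derive1_ln y0) d1'.
  have d3 := is_deriveN d2.
  rewrite (_ : ell (- x) / - x = (- ln (- x))^-1 * - ((- x)^-1 * -1)); last by rewrite /ell; ring.
  exact: (@is_derive1_comp _ (@ln R) (fun x => - ln (- x)) x _ _ (is_derive1_ln l0) d3).
- by apply: cvg_at_right_filter; apply: cF; rewrite lexx lerN2 ltW.
- by apply: cvg_at_left_filter; apply: cF; rewrite lexx lerN2 ltW.
Qed.

(** Only 0 < x < y is kept, where 1 / (x + y) >= 1 / (2 y) and m >= 1 / 4; with the integral of
    [int_ell3], ell^2 / 2, this makes the factor 1 / 16. *)
Lemma cex_kernel_lower (m : R -> R) y : mI m -> (forall x, I x -> 0 <= m x <= 1) ->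
  (forall x, 0 < x < 1 / 2 -> 1 / 4 <= m x) -> 0 < y < expR (-1) ->
  ell y ^+ 2 / y / 16 <= J (fun x => m x * cex x / (x + y)).
Proof.
move=> mm m01 m4 y1; case/andP: (y1) => y0 yl; have e1 := expRN1_le.
have y2 : 0 < y < 1 by rewrite y0; lra.
have mk : mI (fun x => if 0 < x < y then ell x ^+ 3 / x else 0).
  apply: mI_if01; apply: mI_M; last by apply: mI_V; exact: mI_id.
  by apply: mI_X; exact: mI_ell.
have k0 x : 0 <= (if 0 < x < y then ell x ^+ 3 / x else 0).
  case: ifP => // /andP[x0 xy]; rewrite divr_ge0 ?exprn_ge0 ?(ltW x0)//.
  by apply/ltW/ell_gt0; rewrite x0; lra.
have Hk : (\int[mu]_(x in I) (if 0 < x < y then ell x ^+ 3 / x else 0)%:E = (ell y ^+ 2 / 2)%:E)%E.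
  by rewrite int_I_sub ?int_ell3//; lra.
have ik : itg (fun x => if 0 < x < y then ell x ^+ 3 / x else 0).
  by apply: itg_ge0P => //; rewrite Hk ltry.
have Jk : J (fun x => if 0 < x < y then ell x ^+ 3 / x else 0) = ell y ^+ 2 / 2.
  by rewrite /J /Rintegral Hk.
have [_ ic1 _] := zyg_cex.
have ic : itg cex.
  by apply: itg_le ic1 => [|x _]; [exact: mI_cex|rewrite mulr1].
have im : itg (fun x => m x * cex x / (x + y)).
  apply: itg_le (itgZ y^-1 ic) => [|x Ix].
    apply: mI_M; first by apply: mI_M => //; exact: mI_cex.
    by apply: mI_V; apply: mI_D; [exact: mI_id|exact: mI_cst].
  have /andP[mx0 mx1] := m01 x Ix.
  rewrite /cex; case: ifPn => x1; last by rewrite !(mulr0, mul0r) normr0.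
  have c0 : 0 <= ell x ^+ 3 / x by have := cex_ge0 x; rewrite /cex x1.
  case/andP: x1 => x0 _.
  have xy0 : 0 < x + y by rewrite addr_gt0.
  rewrite ger0_norm; last by rewrite divr_ge0 ?(ltW xy0)// mulr_ge0.
  rewrite mulrC; apply: ler_pM; [|exact: mulr_ge0| |by rewrite ler_piMl].
    by rewrite invr_ge0 ltW.
  by rewrite lef_pV2 ?posrE ?addr_gt0// lerDr ltW.
rewrite (_ : ell y ^+ 2 / y / 16 = (8 * y)^-1 * (ell y ^+ 2 / 2)); last by field; rewrite gt_eqF.
rewrite -Jk -JZ//; apply: J_le => //; first exact: itgZ.
move=> x Ix; have /andP[mx0 mx1] := m01 x Ix.
have c0 := cex_ge0 x; case: ifPn => [/andP[x0 xy]|_]; last first.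
  rewrite mulr0; have [x0|x0] := ltP 0 x; first by rewrite divr_ge0 ?mulr_ge0//; lra.
  rewrite /cex; case: ifPn; last by rewrite mulr0 mul0r.
  by move=> /andP[x0' _]; lra.
have x1 : 0 < x < expR (-1) by rewrite x0 (lt_trans xy).
rewrite /cex x1 in c0 *.
have mx4 : 1 / 4 <= m x by apply: m4; rewrite x0; lra.
rewrite (_ : (8 * y)^-1 * (ell x ^+ 3 / x) = (1 / 4) * (ell x ^+ 3 / x) / (2 * y)); last by field; rewrite !gt_eqF.
apply: ler_pM; [by apply: mulr_ge0|by rewrite invr_ge0 mulr_ge0 ?(ltW y0)|by rewrite ler_wpM2r|].
by rewrite lef_pV2 ?posrE ?mulr_gt0 ?addr_gt0//; lra.
Qed.

Lemma J_ae_le f g : itg f -> itg g -> (forall x, I x -> 0 <= f x) -> (forall x, I x -> 0 <= g x) ->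
  {ae mu, forall x, I x -> f x <= g x} -> J f <= J g.
Proof.
move=> fi gi f0 g0 [N [mN N0 sN]].
rewrite -lee_fin -!EFin_J//; apply: ae_ge0_le_integral => //.
- exact: measurableI11.
- by apply/measurable_EFinP; exact: itg_m.
- by apply/measurable_EFinP; exact: itg_m.
- by exists N; split=> // x /= nu; apply: sN => /= hu; apply: nu => Ix; rewrite lee_fin hu.
Qed.

(** To the left of 0 the transform is an ordinary integral of a nonnegative function, bounded below
    by [cex_kernel_lower]. Then [Phi |G|] exceeds a multiple of 1 / (|t| |ln |t||), whose integrals
    up to -c grow as ln |ln c| when c tends to 0. *)
Theorem cex_not_LlogL (m G : R -> R) : mI m -> (forall x, I x -> 0 <= m x <= 1) ->
  (forall x, 0 < x < 1 / 2 -> 1 / 4 <= m x) -> conj_pair (fun x => m x * cex x) G ->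
  ~ itg (fun x => Phi `|G x|).
Proof.
move=> mm m01 m4 cG iP.
have e1 := expRN1_le.
pose c0 : R := (16 * pi)^-1; have c00 : 0 < c0 by rewrite invr_gt0 mulr_gt0 ?pi_gt0.
have [L0 L01 HL0] := Phi_ell_ge c00.
have [N [mN N0 sN]] := ae_lim0_trunc cG.
have lower : {ae mu, forall t, I t -> 0 < - t < expR (- L0) ->
    c0 / 2 * (ell (- t) / (- t)) <= Phi `|G t|}.
  exists N; split=> // t /= nP; apply: sN => /= Ht; apply: nP => It tL.
  have {}Ht := Ht It.
  apply: (le_trans (HL0 _ tL)); case/andP: (tL) => t0 t1.
  have tl : 0 < - t < expR (-1) by rewrite t0 (lt_le_trans t1)// ler_expR lerN2.
  apply: le_Phi; first by rewrite mulr_ge0 ?(ltW c00)// divr_ge0 ?(ltW t0)// sqr_ge0.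
  have E : J (fun x => m x * cex x / (x - t)) = pi * G t.
    apply/eqP; rewrite -subr_eq0 -normr_le0; apply: le_of_eps => d d0; rewrite add0r.
    (* For e < -t the excised interval lies to the left of 0, where [cex] vanishes, so truncation
       changes nothing. *)
    have [e0 e00 He] := Ht d d0; pose e := Num.min e0 (- t) / 2.
    have h0 : 0 < Num.min e0 (- t) by rewrite lt_min e00.
    have hm : e < Num.min e0 (- t) by rewrite /e; lra.
    move: hm; rewrite lt_min => /andP[he1 he2].
    have := He e; rewrite divr_gt0// he1 => /(_ isT); congr (`|_ - _| <= _).
    apply: eq_J => x Ix; case: ifPn => //; rewrite -leNgt => h.
    rewrite /cex; case: ifPn => [/andP[x0 _]|_]; last by rewrite mulr0 mul0r.
    by move: h; rewrite ger0_norm; lra.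
  rewrite -(ler_pM2l (pi_gt0 R)).
  have K := cex_kernel_lower mm m01 m4 tl; rewrite E in K.
  apply: (@le_trans _ _ (pi * G t)); last by rewrite ler_wpM2l ?pi_ge0// ler_norm.
  apply: le_trans K; rewrite le_eqVlt; apply/orP; left; apply/eqP.
  have hp : pi * c0 = 16^-1 by rewrite /c0 invfM mulrCA divff ?mulr1// gt_eqF ?pi_gt0.
  by rewrite (mulrA pi) hp mulrC.
pose K := J (fun x => Phi `|G x|).
have K0 : 0 <= K by apply: J_ge0 => x _; rewrite Phi_ge0.
pose d : R := expR (- L0 - 1).
have d0 : 0 < d by exact: expR_gt0.
have lnd : - ln d = L0 + 1 by rewrite /d expRK; ring.
(* Chosen so that the lower bound c0 / 2 (ln E - ln (L0 + 1)) equals K + c0 / 2, which exceeds K. *)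
pose E : R := expR (2 * K / c0 + ln (L0 + 1) + 1).
have L10 : 0 < L0 + 1 by lra.
have EL : L0 + 1 < E.
  rewrite -[ltLHS]lnK ?posrE// ltr_expR.
  have : 0 <= 2 * K / c0 by rewrite divr_ge0 ?mulr_ge0 ?(ltW c00).
  lra.
pose c : R := expR (- E).
have lnc : - ln c = E by rewrite /c expRK opprK.
have cd : 0 < c < d by rewrite expR_gt0 ltr_expR; lra.
have d1 : d < expR (-1) by rewrite ltr_expR; lra.
have dL : d < expR (- L0) by rewrite ltr_expR; lra.
pose q x := if - d < x < - c then ell (- x) / (- x) else 0.
have Hq : (\int[mu]_(x in I) (q x)%:E = (ln E - ln (L0 + 1))%:E)%E.
  rewrite int_I_sub ?int_ell_neg// ?lnc ?lnd//; have := expRN1_lt1; case/andP: cd => a1 a2 a3; lra.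
have mq : mI q.
  apply: mI_if01; apply: mI_M; last by apply: mI_V; apply: mI_N; exact: mI_id.
  by apply: mI_V; apply: mI_N; apply: mI_ln; apply: mI_N; exact: mI_id.
have q0 x : 0 <= q x.
  rewrite /q; case: ifP => // /andP[x0 x1]; case/andP: cd => c1 cd1.
  have := expRN1_lt1 => e2; rewrite divr_ge0//; last by lra.
  by apply/ltW/ell_gt0; apply/andP; split; lra.
have iq : itg q by apply: itg_ge0P => //; rewrite Hq ltry.
have Jq : J q = ln E - ln (L0 + 1) by rewrite /J /Rintegral Hq.
have : J (fun x => c0 / 2 * q x) <= K.
  apply: J_ae_le => //; first exact: itgZ.
  - by move=> x _; rewrite mulr_ge0// divr_ge0// ltW.
  - by move=> x _; rewrite Phi_ge0.
  have [N' [mN' N0' sN']] := lower; exists N'; split=> // x /= nu; apply: sN' => /= hu; apply: nu => Ix.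
  rewrite /q; case: ifP => [/andP[x0 x1]|_]; last by rewrite mulr0 Phi_ge0.
  by apply: hu => //; case/andP: cd => c1 cd1; apply/andP; split; lra.
rewrite JZ// Jq /E expRK (_ : c0 / 2 * _ = K + c0 / 2); last by field; rewrite gt_eqF.
by lra.
Qed.

End counterexample.

(** * From the complete Lebesgue sigma-algebra to the Borel one *)

Section completion.
Context {R : realType}.
Implicit Types (A B D N : set R).
Local Notation lambda := (@lebesgue_measure R).
Local Notation cmu := (@completed_lebesgue_measure R).
Local Notation borel A := (measurable (A : set (measurableTypeR R))).
Local Notation I := (I11 R).

Lemma leb_of_borel A : borel A -> measurable (A : set (leb R)).
Proof. exact: sub_caratheodory. Qed.

Lemma leb_split A : measurable (A : set (leb R)) ->
  exists B N, [/\ borel B, borel N, lambda N = 0, B `<=` A & A `<=` B `|` N].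
Proof.
move=> mA.
have : (completed_algebra_gen lambda).-sigma.-measurable A.
  by rewrite completed_caratheodory_measurable.
rewrite g_sigma_completed_algebra_genE => -[B mB [M [N [mN N0 MN]]] <-].
by exists B, N; split=> //; exact: setUS.
Qed.

Lemma negligible_leb A : cmu.-negligible A <-> lambda.-negligible A.
Proof.
split=> [[A' [/leb_split[B [N [mB mN N0 BA AB]]] A0 AA]]|[N [mN N0 AN]]].
  exists (B `|` N); split; first exact: measurableU.
    apply/eqP; rewrite -measure_le0; apply: le_trans (measureU2 _ _ _) _ => //.
    rewrite [X in (_ + X)%E]N0 adde0.
    by rewrite -A0; exact: (@le_outer_measure _ _ (mu_ext (@wlength R idfun))).
  exact: subset_trans AB.
by exists N; split=> //; exact: leb_of_borel.
Qed.

Lemma ae_leb (P : R -> Prop) : {ae cmu, forall x, P x} <-> {ae lambda, forall x, P x}.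
Proof. exact: negligible_leb. Qed.

Lemma mfun_leb d (T : measurableType d) D (f : R -> T) : borel D ->
  measurable_fun (D : set (measurableTypeR R)) f -> measurable_fun (D : set (leb R)) f.
Proof. by move=> mD mf _ B mB; apply: leb_of_borel; exact: mf. Qed.

(** The identity map pushes the completed measure forward to the Lebesgue measure on Borel sets. *)
Lemma int_leb D (f : R -> \bar R) : borel D -> measurable_fun (D : set (measurableTypeR R)) f ->
  (\int[cmu]_(x in D) f x = \int[lambda]_(x in D) f x)%E.
Proof.
move=> mD mf.
have mid : measurable_fun [set: leb R] (id : leb R -> measurableTypeR R).
  by move=> _ B mB; rewrite setTI; exact: leb_of_borel.
have ge0 (g : R -> \bar R) : measurable_fun (D : set (measurableTypeR R)) g -> (forall x, (0 <= g x)%E) ->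
    (\int[cmu]_(x in D) g x = \int[lambda]_(x in D) g x)%E.
  move=> mg g0.
  have := @ge0_integral_pushforward _ _ (leb R) (measurableTypeR R) R id mid cmu D g mD mg (fun x _ => g0 x).
  move=> H; rewrite -[LHS]H.
  exact: eq_measure_integral.
rewrite integralE [RHS]integralE; congr (_ - _)%E; apply: ge0 => //.
  exact: measurable_funepos.
exact: measurable_funeneg.
Qed.

(** For every rational q the set {f > q} is Borel up to a Borel null set; setting f to 0 on the
    countable union N of these null sets makes all level sets Borel. *)
Lemma borel_rep (f : R -> R) : measurable_fun (I : set (leb R)) f ->
  exists2 g, mI g & {ae lambda, forall x, I x -> f x = g x}.
Proof.
move=> mf.
have mA (q : rat) : measurable (I `&` f @^-1` `]ratr q, +oo[ : set (leb R)).
  by apply: mf => //; apply: leb_of_borel; exact: measurableI11.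
have /choice[B] : forall q : rat, exists BN : set R * set R,
    [/\ borel BN.1, borel BN.2, lambda BN.2 = 0, BN.1 `<=` I `&` f @^-1` `]ratr q, +oo[ &
      I `&` f @^-1` `]ratr q, +oo[ `<=` BN.1 `|` BN.2].
  by move=> q; have [B [N H]] := leb_split (mA q); exists (B, N).
move=> HB.
pose N := \bigcup_(q : rat) (B q).2.
have mN : borel N by apply: bigcupT_measurable_rat => q; have [] := HB q.
have N0 : lambda N = 0.
  pose F (n : nat) := oapp (fun q : rat => (B q).2) set0 (unpickle n).
  have sub : N `<=` \bigcup_n F n.
    by move=> x [q _ Bx]; exists (pickle q); [exact: Logic.I|rewrite /F pickleK; exact: Bx].
  have [] // := @negligibleP _ _ _ lambda N mN => + _; apply.
  have [A [mA' A0 sA]] : lambda.-negligible (\bigcup_n F n).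
    apply: negligible_bigcup => n.
    rewrite /F; case: unpickle => [q|] /=; last by exists set0; split=> //; rewrite measure0.
    have [_ m2 z2 _ _] := HB q; exists (B q).2; split=> //; exact: subset_refl.
  by exists A; split=> //; exact: subset_trans sA.
exists (f \_ (I `\` N)); last first.
  exists N; split=> // x /= nx; apply: contrapT => Nx; apply: nx => Ix.
  by rewrite patchE mem_set.
apply: mI_T; apply/(measurable_restrictT f); first by apply: measurableD => //; exact: measurableI11.
apply: (measurability _ (RGenOInfty.measurableE R)).
move=> _ [_ [x ->] <-].
rewrite (_ : _ `&` _ = \bigcup_(q : rat) (if x <= ratr q then (B q).1 `\` N else set0)).
  apply: bigcupT_measurable_rat => q; case: ifP => // _.
  by apply: measurableD => //; have [] := HB q.
apply/seteqP; split=> y /=.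
  move=> [[Iy Ny]]; rewrite in_itv /= andbT => xy.
  have [q] := rat_in_itvoo xy; rewrite in_itv /= => /andP[xq qy].
  exists q; first exact: Logic.I.
  rewrite (ltW xq); split=> //.
  have [_ _ _ _ H] := HB q; have [] // : ((B q).1 `|` (B q).2) y.
    by apply: H; split=> //=; rewrite in_itv /= qy.
  by move=> By; exfalso; apply: Ny; exists q.
move=> [q _]; case: ifPn => // xq [By Ny].
have [_ _ _ H _] := HB q; have [Iy] := H y By.
rewrite /= in_itv /= andbT => qy; split; first by split.
by rewrite in_itv /= andbT (le_lt_trans xq).
Qed.

End completion.

(** * Equal distribution functions give equal integrals *)

Section equimeasurable.
Context {R : realType}.
Implicit Types (A B D N : set R) (f g h r : R -> R) (l t : R).
Local Notation mu := (@lebesgue_measure R).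

(** The image measures of f1 and f2 agree on the half-lines, a generating family stable under
    intersection, hence on all Borel sets; h is integrated against them. *)
Lemma equimeasurable D1 D2 f1 f2 (h : R -> \bar R) : measurable D1 -> measurable D2 ->
  measurable_fun D1 f1 -> measurable_fun D2 f2 ->
  (forall x, D1 x -> 0 <= f1 x) -> (forall x, D2 x -> 0 <= f2 x) ->
  (mu D1 < +oo)%E -> mu D1 = mu D2 ->
  (forall l, 0 <= l -> mu (D1 `&` [set x | l < f1 x]) = mu (D2 `&` [set x | l < f2 x])) ->
  measurable_fun [set: R] h -> (forall x, (0 <= h x)%E) ->
  (\int[mu]_(x in D1) h (f1 x) = \int[mu]_(x in D2) h (f2 x))%E.
Proof.
move=> mD1 mD2 mf1 mf2 p1 p2 D1oo D12 dist mh h0.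
(* The value -1 off D keeps the complement of D, possibly of infinite measure, away from [0, +oo[,
   to which the image measures are restricted. *)
pose phi D f x := if x \in D then f x else (-1 : R).
pose E : set R := `[0, +oo[%classic.
have mE : measurable E by exact: measurable_itv.
have preE D f A : (forall x, D x -> 0 <= f x) -> phi D f @^-1` (A `&` E) = D `&` f @^-1` A.
  move=> p; apply/seteqP; split=> x /=; rewrite /phi /E /= in_itv /= andbT.
    case: ifPn => [/set_mem Dx|_] [Ax]; first by [].
    by rewrite leNgt ltrN10.
  by move=> [Dx Ax]; rewrite mem_set//; split=> //; exact: p.
have mphi D f : measurable D -> measurable_fun D f -> measurable_fun [set: R] (phi D f).
  move=> mD mf; have mb : measurable_fun [set: R] (fun x => x \in D).
    apply: (measurable_fun_bool true); rewrite setTI (_ : _ @^-1` _ = D)//.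
    by apply/seteqP; split=> x /=; [move/set_mem|move/mem_set].
  apply: measurable_fun_if => //.
  rewrite setTI (_ : _ @^-1` _ = D)//.
  by apply/seteqP; split=> x /=; [move/set_mem|move/mem_set].
have int D f (mD : measurable D) (mf : measurable_fun D f) : (forall x, D x -> 0 <= f x) ->
    (\int[mu]_(x in D) h (f x) = \int[pushforward mu (phi D f)]_(y in E) h y)%E.
  move=> p; rewrite ge0_integral_pushforward//; last 2 first.
  - exact: mphi.
  - exact: measurable_funTS.
  have := preE D f setT p; rewrite setTI preimage_setT setIT => ->.
  by apply: eq_integral => x Dx /=; rewrite /phi Dx.
rewrite (int D1 f1)// (int D2 f2)//.
pose M1 := @isMeasurableFun.Build _ _ (measurableTypeR R) (measurableTypeR R) (phi D1 f1) (mphi _ _ mD1 mf1).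
pose F1 : {mfun measurableTypeR R >-> measurableTypeR R} := MeasurableFun.Pack (MeasurableFun.Class M1).
pose M2 := @isMeasurableFun.Build _ _ (measurableTypeR R) (measurableTypeR R) (phi D2 f2) (mphi _ _ mD2 mf2).
pose F2 : {mfun measurableTypeR R >-> measurableTypeR R} := MeasurableFun.Pack (MeasurableFun.Class M2).
apply: eq_measure_integral; [exact (mphi D2 f2 mD2 mf2)|exact (mphi D1 f1 mD1 mf1)|move=> q2 q1 A mA AE].
have AEE : A `&` E = A by exact/setIidl.
have r1 B : mrestr (pushforward mu F1) mE B = mu (D1 `&` f1 @^-1` B).
  exact: (congr1 mu (preE D1 f1 B p1)).
have r2 B : mrestr (pushforward mu F2) mE B = mu (D2 `&` f2 @^-1` B).
  exact: (congr1 mu (preE D2 f2 B p2)).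
rewrite -AEE.
have := @measure_unique _ R (measurableTypeR R) (@RGenOInfty.G R) (fun n => `](- n%:R)%R, +oo[%classic)
  (RGenOInfty.measurableE R) _ _ _ (mrestr (pushforward mu F1) mE) (mrestr (pushforward mu F2) mE) _ _ A mA.
apply.
- move=> _ _ [x ->] [y ->]; exists (Num.max x y).
  apply/seteqP; split=> z /=; rewrite !in_itv /= !andbT.
    by case=> ? ?; rewrite gt_max; apply/andP.
  by rewrite gt_max => /andP.
- by move=> n; exists (- n%:R).
- apply/seteqP; split=> // x _; have [n Hn] := ex_nat_ge (`|x| + 1).
  exists n => //=; rewrite in_itv /= andbT; have := Hn n (leqnn n).
  by have := ler_norm (- x); rewrite normrN; lra.
- move=> _ [x ->]; refine (etrans (r1 _) (etrans _ (esym (r2 _)))).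
  have [x0|x0] := leP 0 x.
    have := dist x x0; congr (mu (_ `&` _) = mu (_ `&` _)); apply/seteqP; split=> y /=; by rewrite in_itv /= andbT.
  have full D f : (forall x, D x -> 0 <= f x) -> D `&` f @^-1` `]x, +oo[ = D.
    move=> p; apply/setIidl => y Dy /=; rewrite in_itv /= andbT; exact: lt_le_trans (p y Dy).
  by rewrite !full.
- move=> n; refine (eq_ind_r (fun z => (z < +oo)%E) _ (r1 _)).
  apply: le_lt_trans D1oo; apply: le_measure; rewrite ?inE//.
  exact (mf1 mD1 _ (measurable_itv _)).
Qed.

End equimeasurable.

(** * The rearrangement norm compared with the modular of Phi *)

Section rearrangement.
Context {R : realType}.
Implicit Types (A B D N : set R) (f g h r : R -> R) (l t : R).
Local Notation mu := (@lebesgue_measure R).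
Local Notation I := (I11 R).

Definition dist r l := mu [set x | I x /\ l < r x].

Definition rearr r t : \bar R :=
  ereal_inf [set l%:E | l in [set l : R | 0 <= l /\ (dist r l <= t%:E)%E]].

Variable r : R -> R.
Hypotheses (mr : mI r) (r0 : forall x, I x -> 0 <= r x).

Lemma measurable_dist l : measurable [set x | I x /\ l < r x].
Proof.
have := mr measurableI11 (measurable_itv `]l, +oo[); congr measurable.
by apply/seteqP; split=> x /=; rewrite in_itv /= andbT.
Qed.

Lemma muI : mu I = 2%:E.
Proof.
rewrite /I11 lebesgue_measure_itv /= lte_fin; case: ifPn => [_|/negP[]]; last by lra.
by rewrite -EFinB; congr (_%:E); ring.
Qed.

Lemma dist_le2 l : (dist r l <= 2%:E)%E.
Proof.
by rewrite -muI; apply: le_measure; rewrite ?inE; [exact: measurable_dist|exact: measurableI11|move=> x []].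
Qed.

Lemma le_dist l l' : l <= l' -> (dist r l' <= dist r l)%E.
Proof.
move=> ll; apply: le_measure; rewrite ?inE; [exact: measurable_dist|exact: measurable_dist|].
by move=> x /= [Ix xl]; split=> //; exact: le_lt_trans xl.
Qed.

(** Right continuity of the distribution function, by continuity of the measure from below. It turns
    the infimum in [rearr] into the exact equivalence [rs_gt]. *)
Lemma dist_right l t : (t%:E < dist r l)%E -> exists2 l', l < l' & (t%:E < dist r l')%E.
Proof.
move=> tl.
pose F (n : nat) := [set x | I x /\ l + n.+1%:R^-1 < r x].
have FU : \bigcup_n F n = [set x | I x /\ l < r x].
  apply/seteqP; split=> x /=.
    by move=> [n _ [Ix lx]]; split=> //; apply: lt_trans lx; rewrite ltrDl.
  move=> [Ix lx]; have lx' : 0 < r x - l by rewrite subr_gt0.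
  have [n Hn] := ex_nat_ge ((r x - l)^-1 + 1).
  exists n => //; split=> //; rewrite -ltrBrDl -[ltRHS]invrK ltf_pV2 ?posrE ?invr_gt0//.
  have := Hn n.+1 (leqnSn n); lra.
have cF : mu (F n) @[n --> \oo] --> dist r l.
  rewrite /dist -FU; apply: nondecreasing_cvg_mu.
  - by move=> n; exact: measurable_dist.
  - by rewrite FU; exact: measurable_dist.
  - move=> m n mn; apply/subsetPset => x /= [Ix lx]; split=> //.
    by apply: le_lt_trans lx; rewrite lerD2l lef_pV2 ?posrE// ler_nat.
have H : \forall n \near \oo, (t%:E < mu (F n))%E.
  apply: (cF [set y | (t%:E < y)%E]); apply: open_nbhs_nbhs; split=> //.
  exact: open_ereal_gt_ereal.
have [N _ HN] := H; exists (l + N.+1%:R^-1); first by rewrite ltrDl.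
exact: HN (leqnn N).
Qed.

Lemma dist_small t : 0 < t -> exists2 l, 0 <= l & (dist r l <= t%:E)%E.
Proof.
move=> t0; pose F (n : nat) := [set x | I x /\ n%:R < r x].
have FI : \bigcap_n F n = set0.
  apply/seteqP; split=> x //= Fx; have [n Hn] := ex_nat_ge (r x).
  by have [_] := Fx n Logic.I; rewrite ltNge Hn.
have cF : mu (F n) @[n --> \oo] --> 0%E.
  rewrite -(measure0 mu) -FI; apply: nonincreasing_cvg_mu.
  - by apply: le_lt_trans (dist_le2 _) _; rewrite ltry.
  - by move=> n; exact: measurable_dist.
  - by rewrite FI.
  - move=> m n mn; apply/subsetPset => x /= [Ix lx]; split=> //.
    by apply: le_lt_trans lx; rewrite ler_nat.
have H : \forall n \near \oo, (mu (F n) < t%:E)%E.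
  apply: (cF [set y | (y < t%:E)%E]); apply: open_nbhs_nbhs; split=> //.
    exact: open_ereal_lt_ereal.
have [N _ HN] := H; exists N%:R => //.
by apply: ltW; exact: HN (leqnn N).
Qed.

Lemma rearr_ge0 t : (0 <= rearr r t)%E.
Proof. by apply: le_ereal_inf_tmp => _ [l [l0 _] <-]; rewrite lee_fin. Qed.

Lemma rearr_fin t : 0 < t -> rearr r t \is a fin_num.
Proof.
move=> t0; have [l l0 dl] := dist_small t0.
rewrite ge0_fin_numE ?rearr_ge0//; apply: (@le_lt_trans _ _ l%:E); last by rewrite ltry.
by apply: ereal_inf_lbound; exists l.
Qed.

Definition rs t := fine (rearr r t).

Lemma rs_ge0 t : 0 <= rs t.
Proof. by rewrite /rs fine_ge0// rearr_ge0. Qed.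

Lemma rs_gt l t : 0 <= l -> 0 < t -> (l < rs t) = (t%:E < dist r l)%E.
Proof.
move=> l0 t0; rewrite -lte_fin fineK ?rearr_fin//; apply/idP/idP.
  move=> h; rewrite ltNge; apply/negP => dl; move: h; rewrite ltNge; apply/negP/negPn.
  by apply: ereal_inf_lbound; exists l.
move=> /dist_right[l' ll' tl']; apply: (@lt_le_trans _ _ l'%:E); first by rewrite lte_fin.
apply: le_ereal_inf_tmp => _ [m [m0 dm] <-]; rewrite lee_fin leNgt; apply/negP => /ltW/le_dist.
by apply/negP; rewrite -ltNge; exact: le_lt_trans tl'.
Qed.

Local Notation D2 := (`]0%R, 2%R[%classic : set R).

Lemma rs_set l : 0 <= l -> D2 `&` [set t | l < rs t] = `]0, fine (dist r l)[%classic.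
Proof.
move=> l0; have dfin : dist r l \is a fin_num.
  rewrite ge0_fin_numE ?measure_ge0//; apply: le_lt_trans (dist_le2 l) _; exact: ltry.
have d2 : fine (dist r l) <= 2 by rewrite -lee_fin fineK// dist_le2.
apply/seteqP; split=> t /=; rewrite !in_itv /=.
  by move=> [/andP[t0 _]]; rewrite rs_gt// t0 /= -{1}(fineK dfin) lte_fin.
move=> /andP[t0 td]; rewrite t0 (lt_le_trans td)//; split=> //.
by rewrite rs_gt// -(fineK dfin) lte_fin.
Qed.

Lemma measurable_rs : measurable_fun D2 rs.
Proof.
apply: (measurability _ (RGenOInfty.measurableE R)) => _ [_ [x ->] <-].
have [x0|x0] := leP 0 x.
  have := rs_set x0; rewrite (_ : [set t | x < rs t] = rs @^-1` `]x, +oo[); last first.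
    by apply/seteqP; split=> y /=; rewrite in_itv /= andbT.
  by move=> ->; exact: measurable_itv.
rewrite (_ : _ `&` _ = D2); first exact: measurable_itv.
apply/setIidl => t _ /=; rewrite in_itv /= andbT; exact: lt_le_trans (rs_ge0 t).
Qed.

Lemma int_rs (h : R -> \bar R) : measurable_fun [set: R] h -> (forall x, (0 <= h x)%E) ->
  (\int[mu]_(x in I) h (r x) = \int[mu]_(t in D2) h (rs t))%E.
Proof.
move=> mh h0; apply: equimeasurable => //.
- exact: measurable_rs.
- by move=> t _; exact: rs_ge0.
- by rewrite muI ltry.
- rewrite muI lebesgue_measure_itv /= lte_fin; case: ifPn => [_|/negP[]]; last by lra.
  by rewrite -EFinB subr0.
move=> l l0; rewrite rs_set// lebesgue_measure_itv /= lte_fin.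
have dE : mu (I `&` [set x | l < r x]) = dist r l by [].
have dfin : dist r l \is a fin_num.
  rewrite ge0_fin_numE ?measure_ge0//; apply: le_lt_trans (dist_le2 l) _; exact: ltry.
rewrite dE; case: ifPn => [_|]; first by rewrite -EFinB subr0 fineK.
rewrite -leNgt => d0; apply/eqP; rewrite eq_le.
by rewrite measure_ge0 andbT -(fineK dfin) lee_fin.
Qed.

Definition llog t : R := ln (2 * expR 1 / t).

Lemma llog_ge1 t : D2 t -> 1 <= llog t.
Proof.
rewrite /= in_itv /= => /andP[t0 t2].
have e0 := expR_gt0 (1 : R).
rewrite /llog -{1}[1](expRK 1) ler_ln ?posrE ?divr_gt0 ?mulr_gt0//.
by rewrite ler_pdivlMr// mulrC ler_wpM2r ?(ltW e0)// ltW.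
Qed.

Lemma measurable_llog : measurable_fun D2 llog.
Proof.
apply: measurableT_comp; first exact: measurable_ln.
by apply: measurable_funM => //; apply: measurableT_comp; [exact: measurable_invr|].
Qed.

(** Markov's inequality at the level (J r + 1) / t; the 1 keeps this level positive even when r
    vanishes a.e. *)
Lemma rs_le t : itg r -> D2 t -> rs t <= (J r + 1) / t.
Proof.
move=> ir; rewrite /= in_itv /= => /andP[t0 t2].
have N0 : 0 <= J r by apply: J_ge0.
pose l := (J r + 1) / t; have l0 : 0 < l by rewrite divr_gt0// ltr_wpDl.
rewrite leNgt; apply/negP; rewrite -/l rs_gt ?(ltW l0)// => td.
have mA := measurable_dist l.
have : (l%:E * dist r l <= (J r)%:E)%E.
  rewrite -(@integral_cst _ _ _ mu _ mA) -EFin_J//.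
  apply: (@le_trans _ _ (\int[mu]_(x in [set x | I x /\ (l < r x)%R]) (r x)%:E)%E).
    apply: ge0_le_integral => //.
    - by move=> x _; rewrite lee_fin ltW.
    - by apply/measurable_EFinP; apply: measurable_funS mr => //; [exact: measurableI11|move=> x []].
    - by move=> x [_ /ltW]; rewrite lee_fin.
  apply: ge0_subset_integral => //; [exact: measurableI11| |by move=> x []].
  exact/measurable_EFinP.
apply/negP; rewrite -ltNge; apply: (@lt_trans _ _ (l%:E * t%:E)%E); last first.
  by rewrite lte_pmul2l// lte_fin.
by rewrite -EFinM lte_fin divfK ?gt_eqF// ltrDl.
Qed.

(** By [rs_le] the logarithm of the rearrangement at t is at most K times log (2 e / t), so the
    weighted integral dominates the modular, which is invariant under rearrangement. *)
Lemma norm_lower n : (\int[mu]_(t in D2) (rs t * llog t ^+ n)%:E < +oo)%E ->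
  itg r /\ itg (fun x => r x * lnp (r x) ^+ n).
Proof.
move=> H; have mD2 : measurable D2 by exact: measurable_itv.
have mrs := measurable_rs.
have mW : measurable_fun D2 (fun t => rs t * llog t ^+ n).
  by apply: measurable_funM => //; apply: measurable_funX; exact: measurable_llog.
have ir : itg r.
  apply: itg_ge0P => //.
  have -> : (\int[mu]_(x in I) (r x)%:E = \int[mu]_(x in I) (Num.max 0 (r x))%:E)%E.
    by apply: eq_integral => x /set_mem Ix; rewrite max_r// r0.
  rewrite (@int_rs (fun y => (Num.max 0 y)%:E)); last 2 first.
  - by apply/measurable_EFinP; apply: measurable_maxr.
  - by move=> x; rewrite lee_fin le_max lexx.
  apply: le_lt_trans H; apply: ge0_le_integral => //.
  - by move=> t _; rewrite lee_fin le_max lexx.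
  - by apply/measurable_EFinP; apply: measurable_maxr.
  - exact/measurable_EFinP.
  move=> t Dt; rewrite lee_fin max_r ?rs_ge0// ler_peMr ?rs_ge0//.
  by rewrite exprn_ege1// llog_ge1.
split=> //; have N0 : 0 <= J r by apply: J_ge0.
pose K : R := 1 + lnp (J r + 1).
have K0 : 0 <= K by rewrite addr_ge0// lnp_ge0.
pose h (y : R) := (Num.max 0 y * lnp y ^+ n)%:E.
have mh : measurable_fun [set: R] h.
  apply/measurable_EFinP; apply: measurable_funM; first exact: measurable_maxr.
  apply: measurable_funX; apply: measurableT_comp; first exact: measurable_ln.
  exact: measurable_maxr.
have h0 y : (0 <= h y)%E.
  by rewrite lee_fin mulr_ge0 ?exprn_ge0 ?lnp_ge0// le_max lexx.
apply: itg_ge0P.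
- by apply: mI_M => //; apply: mI_X; exact: mI_lnp.
- by move=> x Ix; rewrite mulr_ge0 ?r0// exprn_ge0 ?lnp_ge0.
have -> : (\int[mu]_(x in I) (r x * lnp (r x) ^+ n)%:E = \int[mu]_(x in I) h (r x))%E.
  by apply: eq_integral => x /set_mem Ix; rewrite /h max_r// r0.
rewrite (int_rs mh h0).
apply: (@le_lt_trans _ _ (\int[mu]_(t in D2) ((K ^+ n)%:E * (rs t * llog t ^+ n)%:E))%E).
  apply: ge0_le_integral => //.
  - by apply: measurableT_comp mh _; exact: mrs.
  - by apply: measurable_funeM; exact/measurable_EFinP.
  move=> t Dt; rewrite -EFinM lee_fin max_r ?rs_ge0// mulrCA ler_wpM2l ?rs_ge0//.
  have W1 := llog_ge1 Dt; have rl := rs_le ir Dt.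
  move: Dt; rewrite /= in_itv /= => /andP[t0 t2].
  rewrite -exprMn lerXn2r ?nnegrE ?lnp_ge0 ?mulr_ge0//; first by lra.
  have e0 := expR_gt0 (1 : R).
  have e1 : 1 <= expR 1 :> R by have := @expR_ge1Dx R 1; lra.
  apply: (@le_trans _ _ (lnp ((J r + 1) * (2 * expR 1 / t)))).
    apply: le_lnp; apply: (le_trans rl); rewrite ler_wpM2l//; first by lra.
    rewrite -[leLHS]mul1r ler_wpM2r ?invr_ge0 ?(ltW t0)//; nra.
  have p0 : 0 < 2 * expR 1 / t by rewrite divr_gt0 ?mulr_gt0.
  apply: (le_trans (lnpM _ (ltW p0))); first by lra.
  rewrite (_ : lnp (2 * expR 1 / t) = llog t); last first.
    by rewrite lnp_ge1// ler_pdivlMr//; nra.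
  by rewrite /K; have := lnp_ge0 (J r + 1); nra.
rewrite ge0_integralZl//.
- by rewrite lte_mul_pinfty// lee_fin exprn_ge0.
- exact/measurable_EFinP.
- by move=> t Dt; rewrite lee_fin mulr_ge0 ?rs_ge0// exprn_ge0//; have := llog_ge1 Dt; lra.
- by rewrite lee_fin exprn_ge0.
Qed.

Lemma int_rsqrt : (\int[mu]_(t in D2) ((sqrtr t)^-1)%:E = (2 * sqrtr 2)%:E)%E.
Proof.
rewrite (_ : 2 * sqrtr 2 = 2 * sqrtr 2 - 2 * sqrtr 0 :> R); last by rewrite sqrtr0 mulr0 subr0.
have cs (x : R) : {for x, continuous (fun t : R => 2 * sqrtr t)}.
  by apply: cvgM; [exact: cvg_cst|exact: sqrt_continuous].
apply: (@improper_FTC R (fun t => (sqrtr t)^-1) (fun t => 2 * sqrtr t) 0 2 (2 * sqrtr 0) (2 * sqrtr 2)).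
- by [].
- by move=> x _; rewrite invr_ge0 sqrtr_ge0.
- move=> x /andP[x0 _]; apply: cvgV; first by rewrite gt_eqF ?sqrtr_gt0.
  exact: sqrt_continuous.
- move=> x /andP[x0 _].
  have := is_deriveZ 2 (is_derive1_sqrt x0).
  rewrite (_ : (sqrtr x)^-1 = 2 *: (2 * sqrtr x)^-1)//.
  by rewrite /GRing.scale /= invfM mulrA divff// mul1r.
- by apply: cvg_at_right_filter; exact: cs.
- by apply: cvg_at_left_filter; exact: cs.
Qed.

(** Young's inequality for the rearrangement against half the logarithm: the exponential of the half
    is a multiple of t^(-1/2), which is integrable on (0, 2), whereas that of the whole, 2 e / t, is
    not. *)
Lemma norm_upper : itg r -> itg (fun x => Phi (r x)) ->
  (\int[mu]_(t in D2) (rs t * llog t)%:E < +oo)%E.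
Proof.
move=> ir iP; have mD2 : measurable D2 by exact: measurable_itv.
have mrs := measurable_rs.
pose h (y : R) := (Phi (Num.max 0 y))%:E.
have mPhi : measurable_fun [set: R] (@Phi R).
  apply: measurable_funM => //; apply: measurableT_comp; first exact: measurable_ln.
  exact: measurable_maxr.
have mh : measurable_fun [set: R] h.
  by apply/measurable_EFinP; apply: measurableT_comp mPhi _; exact: measurable_maxr.
have h0 y : (0 <= h y)%E by rewrite lee_fin Phi_ge0// le_max lexx.
have Hh : (\int[mu]_(t in D2) h (rs t) < +oo)%E.
  rewrite -int_rs//.
  have -> : (\int[mu]_(x in I) h (r x) = \int[mu]_(x in I) (Phi (r x))%:E)%E.
    by apply: eq_integral => x /set_mem Ix; rewrite /h max_r// r0.
  exact: J_ge0_lty.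
pose c : R := sqrtr (2 * expR 1).
have mc : measurable_fun D2 (fun t => (sqrtr t)^-1).
  apply: measurable_funTS; apply: measurableT_comp; first exact: measurable_invr.
  by apply: continuous_measurable_fun; exact: sqrt_continuous.
apply: (@le_lt_trans _ _ (\int[mu]_(t in D2) (2%:E * h (rs t) + (2 * c)%:E * ((sqrtr t)^-1)%:E))%E).
  apply: ge0_le_integral => //.
  - by move=> t Dt; rewrite lee_fin mulr_ge0 ?rs_ge0//; have := llog_ge1 Dt; lra.
  - by apply/measurable_EFinP; apply: measurable_funM => //; exact: measurable_llog.
  - apply: emeasurable_funD; apply: measurable_funeM; last exact/measurable_EFinP.
    by apply: measurableT_comp mh _; exact: mrs.
  move=> t Dt; rewrite /h max_r ?rs_ge0// -!EFinM -EFinD lee_fin.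
  move: Dt; rewrite /= in_itv /= => /andP[t0 t2].
  have e0 := expR_gt0 (1 : R).
  have p0 : 0 < 2 * expR 1 / t by rewrite divr_gt0 ?mulr_gt0.
  have := @young R (rs t) (llog t / 2) (rs_ge0 t).
  rewrite (_ : expR (llog t / 2) = c * (sqrtr t)^-1); first by lra.
  have s0 : 0 < sqrtr (2 * expR 1 / t) by rewrite sqrtr_gt0.
  have -> : llog t / 2 = ln (sqrtr (2 * expR 1 / t)).
    by rewrite /llog -{1}[2 * expR 1 / t](sqr_sqrtr (ltW p0)) lnXn// mulr2n; field.
  rewrite lnK ?posrE//.
  by rewrite sqrtrM ?mulr_ge0 ?(ltW e0)// sqrtrV// ltW.
rewrite ge0_integralD//.
- rewrite ge0_integralZl//; last by apply: measurableT_comp mh _; exact: mrs.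
  rewrite ge0_integralZl//; last 2 first.
  - exact/measurable_EFinP.
  - by rewrite lee_fin mulr_ge0 ?sqrtr_ge0.
  by rewrite int_rsqrt lte_add_pinfty// lte_mul_pinfty// ?ltry// lee_fin mulr_ge0 ?sqrtr_ge0.
- by move=> t _; rewrite mule_ge0.
- by apply: measurable_funeM; apply: measurableT_comp mh _; exact: mrs.
- by move=> t _; rewrite -EFinM lee_fin !mulr_ge0 ?invr_ge0 ?sqrtr_ge0.
- by apply: measurable_funeM; exact/measurable_EFinP.
Qed.

End rearrangement.

(** * Complex functions through Borel real and imaginary parts *)

Section representation.
Context {R : realType}.
Implicit Types (F G : R -> R[i]) (u v U V : R -> R) (t e x : R).
Local Notation lambda := (@lebesgue_measure R).
Local Notation cmu := (@completed_lebesgue_measure R).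
Local Notation I := (I11 R).

(** The bridge to the real theory: F need only be measurable for the completed measure, u and v are
    Borel, and equality is a.e. *)
Definition rep F u v := [/\ mI u, mI v & {ae lambda, forall x, I x -> F x = Complex (u x) (v x)}].

Definition md u v x : R := sqrtr (u x ^+ 2 + v x ^+ 2).

Lemma md_ge0 u v x : 0 <= md u v x.
Proof. exact: sqrtr_ge0. Qed.

Lemma mI_md u v : mI u -> mI v -> mI (md u v).
Proof.
move=> mu mv; apply: (mI_comp (F := sqrtr)).
  by apply: continuous_measurable_fun; exact: sqrt_continuous.
by apply: mI_D; apply: mI_X.
Qed.

Lemma le_md u v x : `|u x| <= md u v x /\ `|v x| <= md u v x.
Proof. by rewrite /md -!sqrtr_sqr !ler_wsqrtr// ?lerDl ?lerDr ?sqr_ge0. Qed.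

Lemma md_le u v x : md u v x <= `|u x| + `|v x|.
Proof.
rewrite /md -[leRHS]ger0_norm ?addr_ge0// -sqrtr_sqr ler_wsqrtr//.
rewrite sqrrD !real_normK ?num_real// -addrA addrCA -[leLHS]add0r.
have := mulr_ge0 (normr_ge0 (u x)) (normr_ge0 (v x)); lra.
Qed.

Lemma cmeasurable_rep F : cmeasurable F -> exists u v, rep F u v.
Proof.
move=> [/borel_rep[u mu [N1 [m1 z1 s1]]] /borel_rep[v mv [N2 [m2 z2 s2]]]].
exists u, v; split=> //; exists (N1 `|` N2); split; first exact: measurableU.
  by rewrite measureU0.
move=> x /= nP; case: (pselect (N1 x)) => n1; [by left|right].
apply: contrapT => n2; apply: nP => Ix.
have e1 : complex.Re (F x) = u x.
  by apply: contrapT => h; apply: n1; apply: s1 => /= h'; apply: h; exact: h'.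
have e2 : complex.Im (F x) = v x.
  by apply: contrapT => h; apply: n2; apply: s2 => /= h'; apply: h; exact: h'.
by rewrite -e1 -e2; case: (F x).
Qed.

Lemma ae_leb_mfun (f g : R -> R) : mI g -> {ae lambda, forall x, I x -> f x = g x} ->
  measurable_fun (I : set (leb R)) f.
Proof.
move=> mg fg; apply/measurable_EFinP.
apply: (@ae_measurable_fun _ (leb R) R cmu completed_lebesgue_measure_is_complete (I : set (leb R)) (EFin \o g)).
  have [N [mN N0 sN]] := fg; apply/ae_leb; exists N; split=> // x /= nx; apply: sN => /= h; apply: nx => Ix.
  by rewrite h.
by apply/measurable_EFinP; apply: mfun_leb => //; exact: measurableI11.
Qed.

Lemma rep_Re F u v : rep F u v -> {ae lambda, forall x, I x -> complex.Re (F x) = u x}.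
Proof.
move=> [_ _ [N [mN N0 sN]]]; exists N; split=> // x /= nx; apply: sN => /= h; apply: nx => Ix.
by rewrite h.
Qed.

Lemma rep_Im F u v : rep F u v -> {ae lambda, forall x, I x -> complex.Im (F x) = v x}.
Proof.
move=> [_ _ [N [mN N0 sN]]]; exists N; split=> // x /= nx; apply: sN => /= h; apply: nx => Ix.
by rewrite h.
Qed.

Lemma rep_cmeasurable F u v : rep F u v -> cmeasurable F.
Proof.
move=> Fr; have [mu mv _] := Fr.
by split; [exact: ae_leb_mfun mu (rep_Re Fr)|exact: ae_leb_mfun mv (rep_Im Fr)].
Qed.

Lemma ae_int_leb (D : set R) (f g : R -> R) : measurable (D : set (measurableTypeR R)) -> D `<=` I ->
  measurable_fun (I : set (leb R)) f -> mI g -> {ae lambda, forall x, I x -> f x = g x} ->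
  (\int[cmu]_(x in D) (f x)%:E = \int[lambda]_(x in D) (g x)%:E)%E.
Proof.
move=> mD DI mf mg fg.
have mgD : measurable_fun (D : set (measurableTypeR R)) (EFin \o g).
  by apply/measurable_EFinP; apply: measurable_funS mg => //; exact: measurableI11.
rewrite -(int_leb mD mgD); apply: ae_eq_integral.
- exact: leb_of_borel.
- apply/measurable_EFinP; apply: measurable_funS mf => //.
  by apply: leb_of_borel; exact: measurableI11.
- exact: mfun_leb.
have [N [mN N0 sN]] := fg; apply/ae_leb; exists N; split=> // x /= nx; apply: sN => /= h; apply: nx => Dx.
by rewrite h//; exact: DI.
Qed.

Lemma rep_normc F u v : rep F u v -> {ae lambda, forall x, I x -> Normc.normc (F x) = md u v x}.
Proof.
move=> [_ _ [N [mN N0 sN]]]; exists N; split=> // x /= nx; apply: sN => /= h; apply: nx => Ix.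
by rewrite h.
Qed.

Lemma norm1E F u v : rep F u v -> norm1 F = (\int[lambda]_(x in I) (md u v x)%:E)%E.
Proof.
move=> Fr; have [mu mv _] := Fr; have mm := mI_md mu mv.
exact: (ae_int_leb measurableI11 (@subset_refl _ I) (ae_leb_mfun mm (rep_normc Fr)) mm (rep_normc Fr)).
Qed.

(** The completed measure is the restriction of an outer measure given on all sets, so the level
    sets of F and of its Borel modulus are compared by subadditivity, off a null set. *)
Lemma rearrangementE F u v t : rep F u v -> rearrangement F t = rearr (md u v) t.
Proof.
move=> Fr; have [N [mN N0 sN]] := rep_normc Fr.
have le (A B : set R) : (forall x, ~ N x -> A x -> B x) -> (cmu A <= cmu B)%E.
  move=> AB; apply: (@le_trans _ _ (cmu (B `|` N))).
    apply: (@le_outer_measure _ _ (mu_ext (@wlength R idfun))) => x Ax.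
    by case: (pselect (N x)) => Nx; [right|left; exact: AB].
  apply: (le_trans (outer_measureU2 (mu_ext (@wlength R idfun)) _ _)).
  by rewrite [X in (_ + X)%E](_ : _ = 0%E) ?adde0.
have FE x : ~ N x -> I x -> Normc.normc (F x) = md u v x.
  by move=> Nx Ix; apply: contrapT => h; apply: Nx; apply: sN => /= h'; apply: h; exact: h'.
have E l : cmu [set x | I x /\ l < Normc.normc (F x)] = dist (md u v) l.
  apply: le_anti; rewrite !le// => x Nx [Ix lx]; split=> //.
    by rewrite FE.
  by rewrite -FE.
by rewrite /rearrangement /rearr; congr (ereal_inf _); apply/seteqP; split=> _ [l [l0 dl] <-]; exists l => //; split=> //; move: dl; rewrite E.
Qed.

Lemma norm_LlogLE F u v n : rep F u v -> norm_LlogL n%:R F =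
  (\int[lambda]_(t in (`]0%R, 2%R[%classic : set R)) (rs (md u v) t * llog t ^+ n)%:E)%E.
Proof.
move=> Fr; have [mu mv _] := Fr; have mm := mI_md mu mv.
have mD2 : measurable (`]0%R, 2%R[%classic : set (measurableTypeR R)) by exact: measurable_itv.
rewrite /norm_LlogL -int_leb//; last first.
  apply/measurable_EFinP; apply: measurable_funM; first by apply: measurable_rs => // x _; exact: md_ge0.
  by apply: measurable_funX; exact: measurable_llog.
apply: eq_integral => t /set_mem Dt; have W1 := llog_ge1 Dt.
rewrite (rearrangementE _ Fr) EFinM /rs fineK; last first.
  by apply: rearr_fin => //; move: Dt; rewrite /= in_itv /= => /andP[].
by rewrite powR_mulrn//; have := llog_ge1 Dt; rewrite /llog; lra.
Qed.

Lemma zygP u : zyg (fun=> 1) u <-> [/\ mI u, itg u & itg (fun x => Phi `|u x|)].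
Proof.
split=> [[mu iu iP]|[mu iu iP]].
  split=> //; last by apply: eq_itg iP => x _; rewrite mulr1.
  by apply: itg_le iu => // x _; rewrite mulr1.
split=> //; last by apply: eq_itg iP => x _; rewrite mulr1.
by apply: eq_itg (itg_norm iu) => x _; rewrite mulr1.
Qed.

Lemma zyg1_scale u s : 0 <= s -> zyg (fun=> 1) u -> itg (fun x => Phi (s * `|u x|)).
Proof.
move=> s0 zu; have m1 : mI (fun=> 1 : R) by exact: mI_cst.
by apply: eq_itg (zyg_scale m1 (fun _ _ => ltr01) s0 zu) => x _; rewrite mulr1.
Qed.

Lemma zygD u v : zyg (fun=> 1) u -> zyg (fun=> 1) v -> zyg (fun=> 1) (fun x => u x + v x).
Proof.
move=> zu zv; have /zygP[mu iu _] := zu; have /zygP[mv iv _] := zv; apply/zygP.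
have muv := mI_D mu mv; split=> //; first exact: itgD.
apply: itg_le (itgD (zyg1_scale (ler0n _ 2) zu) (zyg1_scale (ler0n _ 2) zv)) => [|x _].
  by apply: mI_Phi; exact: mI_norm.
rewrite ger0_norm ?Phi_ge0//; apply: (@le_trans _ _ (Phi (`|u x| + `|v x|))).
  by apply: le_Phi => //; exact: ler_normD.
exact: PhiD.
Qed.

Lemma zygM u (h : R -> R) (M : R) : mI h -> (forall x, I x -> `|h x| <= M) ->
  zyg (fun=> 1) u -> zyg (fun=> 1) (fun x => h x * u x).
Proof.
move=> mh hM zu; have /zygP[mu iu _] := zu; apply/zygP.
have M0 : 0 <= M by apply: le_trans (hM 0 _) => //; apply/I11P; rewrite ltrN10 ltr01.
split; [exact: mI_M|exact: itgM hM iu|].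
apply: itg_le (zyg1_scale M0 zu) => [|x Ix].
  by apply: mI_Phi; apply: mI_norm; exact: mI_M.
rewrite ger0_norm ?Phi_ge0//; apply: le_Phi => //.
by rewrite normrM ler_wpM2r// hM.
Qed.

Lemma zyg_cst (k : R) : zyg (fun=> 1) (fun=> k).
Proof. by apply/zygP; split; [exact: mI_cst|exact: itg_cst|exact: itg_cst]. Qed.

Lemma LlogL_rep F : LlogL 1 F <->
  exists u v, [/\ rep F u v, zyg (fun=> 1) u & zyg (fun=> 1) v].
Proof.
split=> [[/cmeasurable_rep[u [v Fr]] H]|[u [v [Fr zu zv]]]].
  have [mu mv _] := Fr; have mm := mI_md mu mv.
  move: H; rewrite (norm_LlogLE 1 Fr) => H.
  have [im iPm] := norm_lower mm (fun x _ => md_ge0 u v x) H.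
  have [uu vv] : (forall x, `|u x| <= md u v x) /\ (forall x, `|v x| <= md u v x).
    by split=> x; case: (le_md u v x).
  have z (k : R -> R) : mI k -> (forall x, `|k x| <= md u v x) -> zyg (fun=> 1) k.
    move=> mk km; apply/zygP; split=> //; first by apply: itg_le im.
    apply: itg_le iPm => [|x _]; first by apply: mI_Phi; exact: mI_norm.
    by rewrite ger0_norm ?Phi_ge0//; apply: le_Phi.
  by exists u, v; split=> //; exact: z.
have [mu mv _] := Fr; have mm := mI_md mu mv.
split; first exact: rep_cmeasurable Fr.
rewrite (norm_LlogLE 1 Fr); apply: norm_upper => //.
- by move=> x _; exact: md_ge0.
- have /zygP[_ iu _] := zu; have /zygP[_ iv _] := zv.
  apply: itg_le (itgD (itg_norm iu) (itg_norm iv)) => // x _.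
  by rewrite ger0_norm ?md_ge0// md_le.
- apply: itg_le (itgD (zyg1_scale (ler0n _ 2) zu) (zyg1_scale (ler0n _ 2) zv)) => [|x _].
    exact: mI_Phi.
  rewrite ger0_norm ?Phi_ge0 ?md_ge0//; apply: (@le_trans _ _ (Phi (`|u x| + `|v x|))).
    by apply: le_Phi; [exact: md_ge0|exact: md_le].
  exact: PhiD.
Qed.

Lemma LlogL2_rep F : LlogL 2 F -> exists u v,
  [/\ rep F u v, itg u /\ itg (fun x => `|u x| * lnp `|u x| ^+ 2) &
    itg v /\ itg (fun x => `|v x| * lnp `|v x| ^+ 2)].
Proof.
move=> [/cmeasurable_rep[u [v Fr]] H]; have [mu mv _] := Fr; have mm := mI_md mu mv.
move: H; rewrite (norm_LlogLE 2 Fr) => H.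
have [im iPm] := norm_lower mm (fun x _ => md_ge0 u v x) H.
have z (k : R -> R) : mI k -> (forall x, `|k x| <= md u v x) ->
    itg k /\ itg (fun x => `|k x| * lnp `|k x| ^+ 2).
  move=> mk km; split; first by apply: itg_le im.
  apply: itg_le iPm => [|x _].
    apply: mI_M; first exact: mI_norm.
    by apply: mI_X; apply: mI_lnp; exact: mI_norm.
  rewrite ger0_norm ?mulr_ge0 ?exprn_ge0 ?lnp_ge0//; apply: ler_pM => //.
    by rewrite exprn_ge0 ?lnp_ge0.
  by rewrite lerXn2r ?nnegrE ?lnp_ge0// le_lnp.
by exists u, v; split=> //; apply: z => // x; case: (le_md u v x).
Qed.

Lemma L1_rep F : L1 R F <-> exists u v, [/\ rep F u v, itg u & itg v].
Proof.
split=> [[/cmeasurable_rep[u [v Fr]]]|[u [v [Fr iu iv]]]]; have [mu mv _] := Fr;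
    have mm := mI_md mu mv.
  rewrite (norm1E Fr) => H; have im : itg (md u v).
    by apply: itg_ge0P => // x _; exact: md_ge0.
  by exists u, v; split=> //; apply: itg_le im => // x _; case: (le_md u v x).
split; first exact: rep_cmeasurable Fr.
rewrite (norm1E Fr); apply: J_ge0_lty; apply: itg_le (itgD (itg_norm iu) (itg_norm iv)) => // x _.
by rewrite ger0_norm ?md_ge0// md_le.
Qed.

Lemma Re_divC (z : R[i]) (y : R) : complex.Re (z / y%:C%C) = complex.Re z / y.
Proof. by rewrite -fmorphV; case: z => a b; rewrite cReM /= mulr0 subr0. Qed.

Lemma Im_divC (z : R[i]) (y : R) : complex.Im (z / y%:C%C) = complex.Im z / y.
Proof. by rewrite -fmorphV; case: z => a b; rewrite cImM /= mulr0 add0r. Qed.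

Lemma pieces (f g : R -> R) t e : 0 < e -> I t -> measurable_fun (I : set (leb R)) f -> itg g ->
  {ae lambda, forall x, I x -> f x = g x} ->
  \int[cmu]_(x in (`]-1, t - e[%classic : set R)) (f x / (x - t)) +
  \int[cmu]_(x in (`]t + e, 1[%classic : set R)) (f x / (x - t)) = pvtrunc g t e.
Proof.
move=> e0 It mf ig fg; case/I11P/andP: (It) => t0 t1.
have mk : mI (fun x => (x - t)^-1) by apply: mI_V; apply: mI_B; [exact: mI_id|exact: mI_cst].
have mg : mI (fun x => g x / (x - t)) by apply: mI_M => //; exact: itg_m.
have mf' : measurable_fun (I : set (leb R)) (fun x => f x / (x - t)).
  exact: (measurable_funM mf (mfun_leb measurableI11 mk)).
have fg' : {ae lambda, forall x, I x -> f x / (x - t) = g x / (x - t)}.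
  have [N [mN N0 sN]] := fg; exists N; split=> // x /= nx; apply: sN => /= h; apply: nx => Ix.
  by rewrite h.
have E a b : -1 <= a -> b <= 1 ->
    \int[cmu]_(x in (`]a, b[%classic : set R)) (f x / (x - t)) =
    J (fun x => if a < x < b then g x / (x - t) else 0).
  move=> a1 b1; rewrite /J /Rintegral int_I_sub//; congr fine.
  apply: ae_int_leb => //.
  move=> x; rewrite /= in_itv /= => /andP[xa xb]; apply/I11P.
  by rewrite (le_lt_trans a1)// (lt_le_trans xb).
rewrite !E//; [|lra|lra].
have bnd a b : (forall x, a < x < b -> e <= `|x - t|) ->
    itg (fun x => if a < x < b then g x / (x - t) else 0).
  move=> ab; apply: itg_le (itgZ e^-1 (itg_norm ig)) => [|x _]; first exact: mI_if01.
  case: ifP => [/ab h|_]; last by rewrite normr0 mulr_ge0 ?invr_ge0 ?(ltW e0).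
  by rewrite normrM mulrC ler_wpM2r// normfV lef_pV2 ?posrE// (lt_le_trans e0).
rewrite -JD.
- apply: eq_J => x /I11P/andP[x0 x1]; rewrite x0 x1 andbT /= real_ltr_normr ?num_real//.
  have [h|h] := ltP x (t - e).
    have -> : (t + e < x) = false by apply/negbTE; rewrite -leNgt; lra.
    by rewrite addr0 (_ : e < - (x - t)) ?orbT//; lra.
  rewrite add0r; have -> : (e < - (x - t)) = false by apply/negbTE; rewrite -leNgt; lra.
  by rewrite orbF (_ : (e < x - t) = (t + e < x))//; apply/idP/idP; lra.
- by apply: bnd => x /andP[_ h]; rewrite ler_normr; apply/orP; right; lra.
- by apply: bnd => x /andP[h _]; rewrite ler_normr; apply/orP; left; lra.
Qed.

Lemma truncated_fhtE F u v t e : 0 < e -> I t -> rep F u v -> itg u -> itg v ->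
  truncated_fht F t e = Complex (pi^-1 * pvtrunc u t e) (pi^-1 * pvtrunc v t e).
Proof.
move=> e0 It Fr iu iv; have [mRe mIm] := rep_cmeasurable Fr.
rewrite -(pieces e0 It mRe iu (rep_Re Fr)) -(pieces e0 It mIm iv (rep_Im Fr)).
rewrite /truncated_fht /cintegral.
have eRe D : \int[cmu]_(x in D) complex.Re (F x / (x - t)%:C%C) =
    \int[cmu]_(x in D) (complex.Re (F x) / (x - t)).
  by apply: eq_Rintegral => x _; rewrite Re_divC.
have eIm D : \int[cmu]_(x in D) complex.Im (F x / (x - t)%:C%C) =
    \int[cmu]_(x in D) (complex.Im (F x) / (x - t)).
  by apply: eq_Rintegral => x _; rewrite Im_divC.
rewrite !eRe !eIm.
by congr Complex; rewrite /=; ring.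
Qed.

Lemma complex_lim (f : R -> R[i]) (u v : R -> R) (a b : R) :
  (forall e, 0 < e -> f e = Complex (u e) (v e)) ->
  lim0 (fun e => u e - a) -> lim0 (fun e => v e - b) ->
  lim ((f e : (R[i] : numClosedFieldType)) @[e --> (0 : R)^'+]) = Complex a b.
Proof.
move=> fE ua vb; apply: cvg_lim => //; apply/cvgrPdist_le => d d0.
(* A positive element of [R[i]] has imaginary part 0, so the complex tolerance is a real one. *)
have dE : d = (complex.Re d)%:C%C.
  by move: d0; case: d => p q; rewrite ltcE /= => /andP[/eqP q0 _]; congr Complex.
have r0 : 0 < complex.Re d / 2.
  by move: d0; rewrite {1}dE ltcR => ?; rewrite divr_gt0.
have [e1 e10 H1] := ua _ r0; have [e2 e20 H2] := vb _ r0.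
near=> e.
have e0 : 0 < e by near: e; exact: nbhs_right_gt.
have ee1 : e < e1 by near: e; exact: nbhs_right_lt.
have ee2 : e < e2 by near: e; exact: nbhs_right_lt.
have h1 : `|u e - a| <= complex.Re d / 2 by apply: H1; rewrite e0.
have h2 : `|v e - b| <= complex.Re d / 2 by apply: H2; rewrite e0.
rewrite fE// dE normc_def lecR /=.
have := md_le (fun=> a - u e) (fun=> b - v e) 0; rewrite /md => /le_trans; apply.
by rewrite distrC [`|b - _|]distrC; lra.
Unshelve. all: by end_near. Qed.

(** At almost every t the truncated integrals of both parts converge to pi times the values of their
    conjugates, so the limit in [fht] is genuine there. *)
Theorem fht_rep F u v U V : rep F u v -> conj_pair u U -> conj_pair v V -> rep (fht F) U V.
Proof.
move=> Fr uU vV; have [iu iU _] := uU; have [iv iV _] := vV.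
split; [exact: itg_m|exact: itg_m|].
have [N1 [m1 z1 s1]] := ae_lim0_trunc uU; have [N2 [m2 z2 s2]] := ae_lim0_trunc vV.
exists (N1 `|` N2); split; first exact: measurableU.
  by rewrite measureU0.
move=> t /= nP; case: (pselect (N1 t)) => n1; [by left|right].
apply: contrapT => n2; apply: nP => It.
have h1 : lim0 (fun e => pvtrunc u t e - pi * U t).
  by apply: contrapT => h; apply: n1; apply: s1 => /= h'; apply: h; exact: h'.
have h2 : lim0 (fun e => pvtrunc v t e - pi * V t).
  by apply: contrapT => h; apply: n2; apply: s2 => /= h'; apply: h; exact: h'.
have pi0 : pi != 0 :> R by rewrite gt_eqF ?pi_gt0.
have sc (k : R -> R) (c : R) : lim0 (fun e => k e - pi * c) -> lim0 (fun e => pi^-1 * k e - c).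
  move=> h d d0; have [e0 e00 H] := lim0Z pi^-1 h d0; exists e0 => // e /H.
  by rewrite mulrBr mulKf.
apply: (complex_lim (u := fun e => pi^-1 * pvtrunc u t e) (v := fun e => pi^-1 * pvtrunc v t e)).
- by move=> e e0; exact: truncated_fhtE.
- exact: sc.
- exact: sc.
Qed.

End representation.

(** * The range statements *)

Section ranges.
Context {R : realType}.
Implicit Types (F G g : R -> R[i]) (f h u v U V : R -> R) (t e x : R).
Local Notation lambda := (@lebesgue_measure R).
Local Notation I := (I11 R).
Local Notation zyg1 := (zyg (fun=> 1 : R)).

Lemma aeI2 (P Q S : R -> Prop) : (forall x, I x -> P x -> Q x -> S x) ->
  {ae lambda, forall x, I x -> P x} -> {ae lambda, forall x, I x -> Q x} ->
  {ae lambda, forall x, I x -> S x}.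
Proof.
move=> PQS [N1 [m1 z1 s1]] [N2 [m2 z2 s2]].
exists (N1 `|` N2); split; first exact: measurableU.
  by rewrite measureU0.
move=> t /= nP; case: (pselect (N1 t)) => n1; [by left|right].
apply: contrapT => n2; apply: nP => It; apply: PQS => //.
  by apply: contrapT => h; apply: n1; apply: s1 => /= h'; apply: h; exact: h'.
by apply: contrapT => h; apply: n2; apply: s2 => /= h'; apply: h; exact: h'.
Qed.

Lemma aeI1 (P S : R -> Prop) : (forall x, I x -> P x -> S x) ->
  {ae lambda, forall x, I x -> P x} -> {ae lambda, forall x, I x -> S x}.
Proof. by move=> PS H; apply: (aeI2 _ H H) => x Ix Px _; exact: PS. Qed.

Lemma ae_eqJ f h : mI f -> mI h -> {ae lambda, forall x, I x -> f x = h x} -> J f = J h.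
Proof.
move=> mf mh fh; rewrite /J /Rintegral; congr fine.
apply: ae_eq_integral; [exact: measurableI11|exact/measurable_EFinP|exact/measurable_EFinP|].
by apply: (aeI1 (P := fun x => f x = h x)) fh => x _ /= ->.
Qed.

Lemma ae_itg f h : itg f -> mI h -> {ae lambda, forall x, I x -> f x = h x} -> itg h.
Proof.
move=> fi mh fh; apply/integrableP; split; first exact/measurable_EFinP.
have mf := itg_m fi.
rewrite (_ : (\int[lambda]_(x in I) _)%E = (\int[lambda]_(x in I) `|(f x)%:E|)%E).
  by have /integrableP[] := fi.
apply: ae_eq_integral.
- exact: measurableI11.
- by apply: measurableT_comp => //; exact/measurable_EFinP.
- by apply: measurableT_comp => //; exact/measurable_EFinP.
- by apply: (aeI1 (P := fun x => f x = h x)) fh => x _ /= ->.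
Qed.

Lemma rep_ae F G u v : ae_eq11 G F -> rep F u v -> rep G u v.
Proof.
move=> /ae_leb GF [mu mv Fr]; split=> //.
by apply: (aeI2 _ GF Fr) => x _ /= -> ->.
Qed.

Lemma rep_eq F G u v : rep F u v -> rep G u v -> ae_eq11 F G.
Proof.
move=> [_ _ Fr] [_ _ Gr]; apply/ae_leb.
by apply: (aeI2 _ Fr Gr) => x _ /= -> ->.
Qed.

Lemma rep_complex u v : mI u -> mI v -> rep (fun x => Complex (u x) (v x)) u v.
Proof. by move=> mu mv; split=> //; exists set0; split=> // x /= nx; apply: nx. Qed.

Lemma rep_unique F u v u' v' : rep F u v -> rep F u' v' ->
  {ae lambda, forall x, I x -> u x = u' x} /\ {ae lambda, forall x, I x -> v x = v' x}.
Proof.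
move=> [_ _ r1] [_ _ r2].
by split; apply: (aeI2 _ r1 r2) => x _ /= -> [].
Qed.

Lemma zyg1_le u h : zyg1 u -> mI h -> {ae lambda, forall x, I x -> `|h x| <= `|u x|} -> zyg1 h.
Proof.
move=> /zygP[mu iu iP] mh hu; apply/zygP.
(* The minimum is dominated by |u| everywhere and agrees with |h| a.e., so everywhere-comparison
   applies to it first. *)
pose k x := Num.min `|h x| `|u x|.
have mk : mI k by apply: mI_min; exact: mI_norm.
have hk : {ae lambda, forall x, I x -> k x = `|h x|}.
  by apply: (aeI1 _ hu) => x _ /min_idPl.
have k0 x : 0 <= k x by rewrite le_min !normr_ge0.
have ku x : k x <= `|u x| by rewrite ge_min lexx orbT.
have ik : itg k by apply: itg_le (itg_norm iu) => // x _; rewrite ger0_norm.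
have iPk : itg (fun x => Phi (k x)).
  apply: itg_le iP => [|x _]; first exact: mI_Phi.
  by rewrite ger0_norm ?Phi_ge0//; apply: le_Phi.
split=> //.
  have ihn : itg (fun x => `|h x|) by apply: ae_itg ik _ hk; exact: mI_norm.
  by apply: itg_le ihn.
apply: ae_itg iPk _ _; first by apply: mI_Phi; exact: mI_norm.
by apply: (aeI1 _ hk) => x _ ->.
Qed.

Lemma conj_pair_ae u U U' : conj_pair u U -> mI U' -> {ae lambda, forall x, I x -> U x = U' x} ->
  conj_pair u U'.
Proof.
move=> [iu iU H] mU' UU'; have mU := itg_m iU.
split=> //; first exact: ae_itg iU mU' UU'.
move=> n; rewrite -H; apply: ae_eqJ; [apply: mI_M => //; exact: mI_S|apply: mI_M => //; exact: mI_S|].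
by apply: (aeI1 _ UU') => x _ ->.
Qed.

Lemma conj_pair_lin a b u v U V : conj_pair u U -> conj_pair v V ->
  conj_pair (fun x => a * u x + b * v x) (fun x => a * U x + b * V x).
Proof.
move=> [iu iU HU] [iv iV HV]; split; [by apply: itgD; apply: itgZ|by apply: itgD; apply: itgZ|].
move=> n.
have lin (k p q : R -> R) : mI k -> (forall x, I x -> `|k x| <= 1) -> itg p -> itg q ->
    J (fun x => k x * (a * p x + b * q x)) = a * J (fun x => k x * p x) + b * J (fun x => k x * q x).
  move=> mk k1 ip iq.
  have i1 : itg (fun x => k x * p x) by apply: (itgM (M := 1)).
  have i2 : itg (fun x => k x * q x) by apply: (itgM (M := 1)).
  rewrite -(JZ a i1) -(JZ b i2) -JD; [|exact: itgZ|exact: itgZ].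
  by apply: eq_J => x _; ring.
rewrite !lin//; [by rewrite HU HV|exact: mI_C|exact: C_le1|exact: mI_S|exact: S_le1].
Qed.

Lemma zyg1_lin a b u v : zyg1 u -> zyg1 v -> zyg1 (fun x => a * u x + b * v x).
Proof.
by move=> zu zv; apply: zygD; [apply: (zygM (M := `|a|)) zu|apply: (zygM (M := `|b|)) zv] => //; exact: mI_cst.
Qed.

(** Describes the range by moments alone; the range statements for T below need no limits of
    truncated integrals. *)
Lemma fht_range_rep g : ae_range (@fht R) (LlogL 1) g <-> exists u v U V,
  [/\ zyg1 u, zyg1 v, conj_pair u U, conj_pair v V & rep g U V].
Proof.
split=> [[F /LlogL_rep[u [v [Fr zu zv]]] gF]|[u [v [U [V [zu zv uU vV gr]]]]]].
  have [U uU] := conj_pair_exists zu; have [V vV] := conj_pair_exists zv.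
  by exists u, v, U, V; split=> //; apply: rep_ae gF _; exact: fht_rep Fr uU vV.
have /zygP[mu _ _] := zu; have /zygP[mv _ _] := zv; have Fr := rep_complex mu mv.
exists (fun x => Complex (u x) (v x)); first by apply/LlogL_rep; exists u, v.
exact: rep_eq gr (fht_rep Fr uU vV).
Qed.

Definition cexC x : R[i] := Complex (cex x) 0.

Lemma rep_cexC : rep cexC cex (fun=> 0).
Proof. by apply: rep_complex; [exact: mI_cex|exact: mI_cst]. Qed.

Lemma LlogL_cexC : LlogL 1 cexC.
Proof.
by apply/LlogL_rep; exists cex, (fun=> 0); split; [exact: rep_cexC|exact: zyg_cex|exact: zyg_cst].
Qed.

Lemma w_bounds : [/\ mI (@w R), (forall x : R, I x -> 0 <= w x <= 1) & forall x : R, 0 < x < 1 / 2 -> 1 / 4 <= w x ^+ 2].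
Proof.
split; [exact: mI_w|by move=> x _; rewrite w_ge0 w_le1|].
move=> x /andP[x0 x1]; rewrite w2; last by apply/I11P; lra.
nra.
Qed.

Lemma w_lower (x : R) : 0 < x < 1 / 2 -> 1 / 4 <= w x.
Proof.
move=> x01; have [_ _ h] := w_bounds; apply: (le_trans (h x x01)).
by rewrite expr2 ler_piMl ?w_ge0 ?w_le1.
Qed.

Lemma zyg1_w u : zyg1 u -> zyg1 (fun x => w x * u x).
Proof. by apply: (zygM (M := 1)); [exact: mI_w|move=> x _; rewrite ger0_norm ?w_ge0 ?w_le1]. Qed.

Lemma zyg1_Phi u : zyg1 u -> itg (fun x => Phi `|u x|).
Proof. by case/zygP. Qed.

Lemma rep_Z F u v : rep F u v -> forall (k : R -> R), mI k ->
  rep (fun x => (k x)%:C%C * F x) (fun x => k x * u x) (fun x => k x * v x).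
Proof.
move=> [mu mv Fr] k mk; split; [exact: mI_M|exact: mI_M|].
by apply: (aeI1 _ Fr) => x _ ->; congr Complex; rewrite /=; ring.
Qed.

Lemma fht_not_LlogL : ~ (ae_range (@fht R) (LlogL 1) `<=` LlogL 1).
Proof.
move=> H; have zc := @zyg_cex R; have [U cU] := conj_pair_exists zc.
have [V zV] := conj_pair_exists (zyg_cst (0 : R)).
have Tr := fht_rep rep_cexC cU zV.
have /LlogL_rep[p [q [Pr zp zq]]] : LlogL 1 (fht cexC).
  by apply: H; exists cexC; [exact: LlogL_cexC|exact: (rep_eq Tr Tr)].
have [pU _] := rep_unique Pr Tr.
have [_ iU _] := cU.
have zU : zyg1 U by apply: zyg1_le zp (itg_m iU) _; apply: (aeI1 _ pU) => x _ ->.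
apply: (@cex_not_LlogL R (fun=> 1) U (mI_cst 1)) (zyg1_Phi zU) => //.
- by move=> x _; rewrite ler01 lexx.
- by move=> x _; lra.
by case: cU => ic _ HU; split=> //; [apply: eq_itg ic => x _; rewrite mul1r|move=> n; rewrite HU; apply: eq_J => x _; rewrite mul1r].
Qed.

Lemma mI_hatw : mI (fun x : R => - 1 / sqrtr (1 - x ^+ 2)).
Proof. by apply: mI_M; [exact: mI_cst|exact: mI_rw]. Qed.

Lemma fht_hat_rep F u v U V : rep F u v -> conj_pair (fun x => w x * u x) U ->
  conj_pair (fun x => w x * v x) V ->
  rep (fht_hat F) (fun x => - 1 / w x * U x) (fun x => - 1 / w x * V x).
Proof.
move=> Fr uU vV; have mw := @mI_w R.
exact: (rep_Z (fht_rep (rep_Z Fr mw) uU vV) mI_hatw).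
Qed.

(** Since w <= 1, |T (w c)| is at most |T^ c|, so membership of T^ c in L log L would pass to T (w
    c). *)
Lemma fht_hat_not_LlogL : ~ (ae_range (@fht_hat R) (LlogL 1) `<=` LlogL 1).
Proof.
move=> H; have zc := zyg1_w zyg_cex; have [U cU] := conj_pair_exists zc.
have [V zV] := conj_pair_exists (zyg1_w (zyg_cst (0 : R))).
have Tr := fht_hat_rep rep_cexC cU zV.
have /LlogL_rep[p [q [Pr zp zq]]] : LlogL 1 (fht_hat cexC).
  by apply: H; exists cexC; [exact: LlogL_cexC|exact: (rep_eq Tr Tr)].
have [pU _] := rep_unique Pr Tr.
have [_ iU _] := cU.
have zU : zyg1 U.
  apply: zyg1_le zp (itg_m iU) _; apply: (aeI1 _ pU) => x Ix ->.
  have w0 := w_gt0 Ix; rewrite normrM -[leLHS]mul1r ler_wpM2r//.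
  by rewrite normrM normrN1 mul1r normfV gtr0_norm// invf_ge1// w_le1.
have [mw w01 _] := w_bounds.
exact: (@cex_not_LlogL R w U mw w01 w_lower cU (zyg1_Phi zU)).
Qed.

Lemma LlogL_not_fht : ~ (LlogL 1 `<=` ae_range (@fht R) (LlogL 1)).
Proof.
move=> H; have /fht_range_rep[u [v [U [V [zu zv uU vV cr]]]]] := H _ LlogL_cexC.
have [cU _] := rep_unique cr rep_cexC.
have uc := conj_pair_ae uU mI_cex cU.
have wc := conj_pair_mulw uc.
have [mw w01 _] := w_bounds.
have zG : zyg1 (fun x => J u / pi - w x * u x).
  have -> : (fun x => J u / pi - w x * u x) = (fun x => 1 * (J u / pi) + -1 * (w x * u x)).
    by apply/funext => x; ring.
  exact: zyg1_lin (zyg_cst _) (zyg1_w zu).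
apply: (@cex_not_LlogL R w _ mw w01 w_lower _ (zyg1_Phi zG)).
case: wc => i1 i2 HH; split=> //; first by apply: eq_itg i1 => x _; rewrite mulrC.
by move=> n; rewrite HH; apply: eq_J => x _; rewrite [w x * _]mulrC.
Qed.

Lemma LlogL_not_fht_hat : ~ (LlogL 1 `<=` ae_range (@fht_hat R) (LlogL 1)).
Proof.
move=> H; have [F /LlogL_rep[u [v [Fr zu zv]]] cF] := H _ LlogL_cexC.
have [U uU] := conj_pair_exists (zyg1_w zu); have [V vV] := conj_pair_exists (zyg1_w zv).
have [cU _] := rep_unique (rep_ae cF (fht_hat_rep Fr uU vV)) rep_cexC.
have [mw w01 w4] := w_bounds.
have mwc : mI (fun x => - (w x * cex x)) by apply: mI_N; apply: mI_M => //; exact: mI_cex.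
have uc : conj_pair (fun x => w x * u x) (fun x => - (w x * cex x)).
  apply: conj_pair_ae uU mwc _; apply: (aeI1 _ cU) => x Ix <-.
  by field; rewrite gt_eqF ?w_gt0.
have wc := conj_pair_mulw uc.
pose A := J (fun x => w x * u x) / pi.
(* The minus sign in T^ made the partner - w c; it is undone so that the multiplier w^2 is
   nonnegative. *)
have wc2 := conj_pair_lin (-1) 0 wc wc.
have zG : zyg1 (fun x => -1 * (A - w x * (w x * u x)) + 0 * (A - w x * (w x * u x))).
  have -> : (fun x => -1 * (A - w x * (w x * u x)) + 0 * (A - w x * (w x * u x))) =
      (fun x => -1 * A + 1 * (w x * (w x * u x))) by apply/funext => x; ring.
  exact: zyg1_lin (zyg_cst _) (zyg1_w (zyg1_w zu)).
apply: (@cex_not_LlogL R (fun x => w x ^+ 2) _ (mI_X 2 mw) _ w4 _ (zyg1_Phi zG)).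
  by move=> x Ix; have /andP[h0 h1] := w01 x Ix; rewrite sqr_ge0 exprn_ile1.
case: wc2 => i1 i2 HH; split=> //; first by apply: eq_itg i1 => x _; ring.
by move=> n; rewrite HH; apply: eq_J => x _; ring.
Qed.

Lemma LlogL2_sub_fht : LlogL 2 `<=` ae_range (@fht R) (LlogL 1).
Proof.
move=> g /LlogL2_rep[u [v [gr [iu iu2] [iv iv2]]]].
have [f zf fu] := conj_pair_onto (itg_m iu) iu iu2.
have [h zh hv] := conj_pair_onto (itg_m iv) iv iv2.
by apply/fht_range_rep; exists f, h, u, v.
Qed.

Lemma fht_range_subspace : linear_subspace (ae_range (@fht R) (LlogL 1)) (L1 R).
Proof.
have c00 : conj_pair (fun=> 0 : R) (fun=> 0).
  split; [exact: itg_cst|exact: itg_cst|move=> n].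
  by apply: eq_J => x _; rewrite !mulr0.
split.
- move=> g /fht_range_rep[u [v [U [V [zu zv [_ iU _] [_ iV _] gr]]]]].
  by apply/L1_rep; exists U, V.
- apply/fht_range_rep; exists (fun=> 0), (fun=> 0), (fun=> 0), (fun=> 0).
  by split; [exact: zyg_cst|exact: zyg_cst|exact: c00|exact: c00|apply: rep_complex; exact: mI_cst].
- move=> f g /fht_range_rep[u [v [U [V [zu zv uU vV [mU mV fr]]]]]].
  move=> /fht_range_rep[u' [v' [U' [V' [zu' zv' uU' vV' [mU' mV' gr]]]]]].
  apply/fht_range_rep; exists (fun x => 1 * u x + 1 * u' x), (fun x => 1 * v x + 1 * v' x),
    (fun x => 1 * U x + 1 * U' x), (fun x => 1 * V x + 1 * V' x).
  split; [exact: zyg1_lin|exact: zyg1_lin|exact: conj_pair_lin|exact: conj_pair_lin|].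
  split; [by apply: mI_D; apply: mI_M => //; exact: mI_cst|by apply: mI_D; apply: mI_M => //; exact: mI_cst|].
  by apply: (aeI2 _ fr gr) => x _ -> ->; rewrite !mul1r.
- move=> [a b] f /fht_range_rep[u [v [U [V [zu zv uU vV [mU mV fr]]]]]].
  apply/fht_range_rep; exists (fun x => a * u x + (- b) * v x), (fun x => a * v x + b * u x),
    (fun x => a * U x + (- b) * V x), (fun x => a * V x + b * U x).
  split; [exact: zyg1_lin|exact: zyg1_lin|exact: conj_pair_lin|exact: conj_pair_lin|].
  split; [by apply: mI_D; apply: mI_M => //; exact: mI_cst|by apply: mI_D; apply: mI_M => //; exact: mI_cst|].
  by apply: (aeI1 _ fr) => x _ ->; congr Complex; rewrite /=; ring.
Qed.

Lemma trunc_approx u e : itg u -> 0 < e -> exists f,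
  [/\ mI f, (exists M, forall x, `|f x| <= M) & J (fun x => `|u x - f x|) <= e].
Proof.
move=> iu e0; have mu := itg_m iu.
pose f N x := if `|u x| <= N%:R then u x else 0.
have mf N : mI (f N) by apply: mI_ifle => //; [exact: mI_norm|exact: mI_cst|exact: mI_cst].
have cv : J (fun x => `|u x - f N x|) @[N --> \oo] --> J (fun=> 0 : R).
  apply: (J_dct (F := fun N x => `|u x - f N x|) (g := fun x => `|u x|)).
  - by move=> N; apply: mI_norm; exact: mI_B.
  - exact: mI_cst.
  - move=> x _; have [N0 H] := ex_nat_ge `|u x|; apply: (cvg_eventually (N := N0)) => N /H h.
    by rewrite /f h subrr normr0.
  - exact: itg_norm.
  - by move=> N x _; rewrite normr_id /f; case: ifP => _; rewrite ?subrr ?normr0 ?subr0.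
rewrite J0 in cv; have [N H] := cvg_ex_le cv e0.
exists (f N); split=> //.
  exists N%:R => x; rewrite /f; case: ifP => // _; by rewrite normr0.
by have := H N (leqnn N); rewrite subr0; exact: le_trans (ler_norm _).
Qed.

Lemma conj_pair_onto_bounded (g : R -> R) : mI g -> (exists M, forall x, `|g x| <= M) ->
  exists2 f, zyg1 f & conj_pair f g.
Proof.
move=> mg [M gM]; apply: conj_pair_onto => //; first by apply: itg_bd (M) mg _ => x _.
apply: (itg_bd (M := M * lnp M ^+ 2)).
  by apply: mI_M; [exact: mI_norm|apply: mI_X; apply: mI_lnp; exact: mI_norm].
move=> x _; rewrite ger0_norm ?mulr_ge0 ?exprn_ge0 ?lnp_ge0//.
by apply: ler_pM => //; rewrite ?exprn_ge0 ?lnp_ge0// lerXn2r ?nnegrE ?lnp_ge0// le_lnp.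
Qed.

Lemma fht_range_dense : dense_in_L1 (ae_range (@fht R) (LlogL 1)).
Proof.
move=> h /L1_rep[u [v [[mu mv hr] iu iv]]] e e0.
have e4 : 0 < e / 4 by rewrite divr_gt0.
have [f [mf bf fu]] := trunc_approx iu e4; have [k [mk bk kv]] := trunc_approx iv e4.
have [p zp pf] := conj_pair_onto_bounded mf bf; have [q zq qk] := conj_pair_onto_bounded mk bk.
have gr := rep_complex mf mk.
exists (fun x => Complex (f x) (k x)); first by apply/fht_range_rep; exists p, q, f, k.
have dr : rep (fun x => h x - Complex (f x) (k x)) (fun x => u x - f x) (fun x => v x - k x).
  split; [exact: mI_B|exact: mI_B|].
  by apply: (aeI1 _ hr) => x _ ->.
have [_ iF _] := pf; have [_ iK _] := qk.
have i1 : itg (fun x => `|u x - f x|) by apply: itg_norm; exact: itgB.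
have i2 : itg (fun x => `|v x - k x|) by apply: itg_norm; exact: itgB.
have im : itg (md (fun x => u x - f x) (fun x => v x - k x)).
  apply: itg_le (itgD i1 i2) => [|x _]; first by apply: mI_md; exact: mI_B.
  by rewrite ger0_norm ?md_ge0// md_le.
rewrite (norm1E dr) EFin_J// lte_fin.
apply: (@le_lt_trans _ _ (J (fun x => `|u x - f x| + `|v x - k x|))).
  by apply: J_le => //; [exact: itgD|move=> x _; exact: md_le].
by rewrite JD//; lra.
Qed.

End ranges.

Theorem proposition4p12 (R : realType) :
  (* (i) *)
  [/\ linear_subspace (ae_range (@fht R) (LlogL 1)) (L1 R),
      ae_range (@fht R) (LlogL 1) <> L1 R
    & dense_in_L1 (ae_range (@fht R) (LlogL 1))] /\
  (* (ii) *)
  LlogL 2 `<=` ae_range (@fht R) (LlogL 1) /\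
  (* (iii) *)
  ~ (ae_range (@fht R) (LlogL 1) `<=` LlogL 1) /\
  (* (iv) *)
  ~ (ae_range (@fht_hat R) (LlogL 1) `<=` LlogL 1) /\
  (* (v) *)
  ~ (LlogL 1 `<=` ae_range (@fht R) (LlogL 1)) /\
  (* (vi) *)
  ~ (LlogL 1 `<=` ae_range (@fht_hat R) (LlogL 1)).
Proof.
split; last by split; [exact: LlogL2_sub_fht|split; [exact: fht_not_LlogL|split;
  [exact: fht_hat_not_LlogL|split; [exact: LlogL_not_fht|exact: LlogL_not_fht_hat]]]].
split; [exact: fht_range_subspace| |exact: fht_range_dense].
(* L log L lies in L^1, so a range equal to L^1 would contain L log L, against (v). *)
move=> E; apply: (@LlogL_not_fht R) => g /LlogL_rep[u [v [gr /zygP[_ iu _] /zygP[_ iv _]]]].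
by rewrite E; apply/L1_rep; exists u, v.
Qed.
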